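(* Given a balanced parenthesis sequence of length $2n$, one can support the operations $\mathrm{open}$, $\mathrm{close}$, $\mathrm{excess}$, and $\mathrm{next\_excess}(i,k)$ for all positions $i$ and integers $k$ with $|k - \mathrm{excess}(i)| \le \lg^2 n$, each in constant time, using an additional index of size $o(n)$ bits (in addition to the $2n$ bits of the sequence).
   Context: $\lg$ denotes the logarithm to base 2. The model of computation is the unit-cost word RAM with words of $\Theta(\lg n)$ bits; space is measured in bits. A balanced parenthesis sequence is a string over $\{(,)\}$ in which every prefix has at least as many open as closing parentheses and the whole string has equally many. For a position $i$: $\mathrm{close}(i)$ returns the position of the closing parenthesis matching the open parenthesis at position $i$; $\mathrm{open}(i)$ returns the position of the open parenthesis matching the closing parenthesis at position $i$; $\mathrm{excess}(i)$ is the number of open parentheses minus the number of closing parentheses from the beginning of the sequence up to position $i$; $\mathrm{next\_excess}(i,k)$ returns the least position $j>i$ with $\mathrm{excess}(j)=k$ (if one exists). *)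

(* Defs.v *)
From Stdlib Require Import Reals ZArith NArith List.
Import ListNotations.

(** * Asymptotic notation *)

Definition lg (n : nat) : R := Rlog 2 (INR n).

Definition little_o (f g : nat -> R) : Prop :=
  forall eps : R, (0 < eps)%R ->
  exists n0 : nat, forall n : nat, n0 <= n -> (Rabs (f n) <= eps * Rabs (g n))%R.

Definition big_theta (f g : nat -> R) : Prop :=
  exists c1 c2 : R, (0 < c1)%R /\ (0 < c2)%R /\
  exists n0 : nat, forall n : nat, n0 <= n ->
    (c1 * Rabs (g n) <= Rabs (f n) <= c2 * Rabs (g n))%R.

(** * Balanced parenthesis sequences

    [true] is an open parenthesis and [false] a closing one.  Positions are
    numbered from 1 to [length P]. *)

Definition total_excess (s : list bool) : Z :=
  (Z.of_nat (count_occ Bool.bool_dec s true)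
   - Z.of_nat (count_occ Bool.bool_dec s false))%Z.

Definition excess (P : list bool) (i : nat) : Z := total_excess (firstn i P).

Definition balanced (P : list bool) : Prop :=
  (forall i : nat, i <= length P -> (0 <= excess P i)%Z) /\ total_excess P = 0%Z.

Definition position (P : list bool) (i : nat) : Prop := 1 <= i <= length P.

Definition paren_at (P : list bool) (i : nat) (b : bool) : Prop :=
  position P i /\ nth_error P (i - 1) = Some b.

(** The parentheses at [i] and [j] match when the sequence strictly between
    them, at positions [i+1], ..., [j-1], is itself balanced. *)
Definition matching (P : list bool) (i j : nat) : Prop :=
  paren_at P i true /\ paren_at P j false /\ i < j /\
  balanced (firstn (j - i - 1) (skipn i P)).

Definition next_excess (P : list bool) (i : nat) (k : Z) : option nat :=
  find (fun j => (excess P j =? k)%Z) (seq (S i) (length P - i)).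

(** * The unit-cost word RAM with [w]-bit words

    A word is a natural number below [2 ^ w].  A program is a fixed finite list
    of instructions, so it uses finitely many registers; memory is accessed
    through addresses held in registers. *)

Inductive binop : Set :=
| OpAdd | OpSub | OpMul | OpDiv | OpMod | OpAnd | OpOr | OpXor | OpShl | OpShr.

Inductive instr : Set :=
| LoadConst (d : nat) (c : N)
| Move (d a : nat)
| Op (o : binop) (d a b : nat)
| LoadMem (d a : nat)
| StoreMem (a b : nat)
| Jump (l : nat)
| JumpEq (a b l : nat)
| JumpLt (a b l : nat)
| Halt.

Definition program : Set := list instr.

Record state : Set := State {
  pc : nat;
  reg : nat -> N;
  mem : N -> N
}.

Definition trunc (w : nat) (x : N) : N := (x mod 2 ^ N.of_nat w)%N.

(** Addition, subtraction, multiplication and left shift are modulo [2 ^ w];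
    division by 0 follows the conventions of [N.div] and [N.modulo]. *)
Definition eval_binop (w : nat) (o : binop) (x y : N) : N :=
  match o with
  | OpAdd => trunc w (x + y)
  | OpSub => trunc w (x + 2 ^ N.of_nat w - y)
  | OpMul => trunc w (x * y)
  | OpDiv => x / y
  | OpMod => x mod y
  | OpAnd => N.land x y
  | OpOr => N.lor x y
  | OpXor => N.lxor x y
  | OpShl => trunc w (N.shiftl x y)
  | OpShr => N.shiftr x y
  end%N.

Definition set_reg (r : nat -> N) (d : nat) (v : N) : nat -> N :=
  fun e => if Nat.eqb e d then v else r e.

Definition set_mem (m : N -> N) (a v : N) : N -> N :=
  fun b => if N.eqb b a then v else m b.

Definition step (w : nat) (c : instr) (s : state) : state :=
  let (p, r, m) := s in
  match c with
  | LoadConst d x => State (S p) (set_reg r d (trunc w x)) m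
  | Move d a => State (S p) (set_reg r d (r a)) m
  | Op o d a b => State (S p) (set_reg r d (eval_binop w o (r a) (r b))) m
  | LoadMem d a => State (S p) (set_reg r d (m (r a))) m
  | StoreMem a b => State (S p) r (set_mem m (r a) (r b))
  | Jump l => State l r m
  | JumpEq a b l => State (if N.eqb (r a) (r b) then l else S p) r m
  | JumpLt a b l => State (if N.ltb (r a) (r b) then l else S p) r m
  | Halt => s
  end.

(** [None] when the program has not reached [Halt] within [t] steps, or when
    control leaves the program. *)
Fixpoint exec (w : nat) (prog : program) (t : nat) (s : state) : option state :=
  match nth_error prog (pc s) with
  | None => None
  | Some Halt => Some s
  | Some c => match t with
              | O => None
              | S t' => exec w prog t' (step w c s)
              end
  end.

(** * Indexed parenthesis sequences in memory *)

(** Least significant bit first. *)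
Fixpoint N_of_bits (s : list bool) : N :=
  match s with
  | [] => 0
  | b :: s' => N.b2n b + 2 * N_of_bits s'
  end%N.

(** The [a]-th [w]-bit word of the packed bit string [s], which is padded with
    zeros on the right. *)
Definition packed_word (w : nat) (s : list bool) (a : N) : N :=
  N_of_bits (firstn w (skipn (N.to_nat a * w) s)).

Definition words (w : nat) (s : list bool) : N :=
  N.of_nat ((length s + w - 1) / w).

(** The words of the sequence [P] start at address 0 and are followed by the
    words of the index [I]. *)
Definition layout (w : nat) (P I : list bool) (a : N) : N :=
  if N.ltb a (words w P) then packed_word w P a
  else packed_word w I (a - words w P).

(** Register 0 holds the address of the index and registers 1, 2, ... hold the
    arguments of the query; all other registers are 0. *)
Definition initial (w : nat) (P I : list bool) (args : list N) : state :=
  State 0 (fun e => nth e (words w P :: args) 0%N) (layout w P I).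

(** The answer is left in register 0.  The structure is static: the memory
    must be left as it was found, so that further queries can be made. *)
Definition answers (w : nat) (P I : list bool) (prog : program) (t : nat)
    (args : list N) (v : Z) : Prop :=
  exists s : state,
    exec w prog t (initial w P I args) = Some s /\
    Z.of_N (reg s 0) = v /\
    (forall a : N, mem s a = layout w P I a).

Definition nat_args (i : nat) : list N := [N.of_nat i].

(** The integer argument [k] is passed as its absolute value followed by its
    sign bit. *)
Definition nat_int_args (i : nat) (k : Z) : list N :=
  [N.of_nat i; Z.abs_N k; N.b2n (k <? 0)%Z].

(** 0 is not a position; it reports that no position exists. *)
Definition answer_of_option (o : option nat) : Z :=
  match o with
  | Some j => Z.of_nat j
  | None => 0%Z
  end.

(* Main.v *)
Require Import Defs.
From Stdlib Require Import Reals Lra ZArith NArith List Lia.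
Import ListNotations.

(** Everything reduces to one search: given a walk [E] with steps of at most 1
    and a target [k] with [E x - D <= k < E x], find the first [y > x] with
    [E y <= k].  The walk is the excess, its negation (to search upwards) or its
    reversal (to search backwards for [open]).

    With [g] about [sqrt (lg n)], a tree of fan-out [g] stands on micro blocks
    of [g ^ 2] bits; a node stores in one word the minima of its children,
    [g] fields of [g] bits, and tables indexed by such a word (or by the bits of
    a micro block) answer in one step which child to enter.  Since there are only
    [O (n / g ^ 3)] nodes and a word has [O (g ^ 2)] bits, this takes [o(n)] bits.
    After 6 levels, blocks of [g ^ 8] positions are reached.

    Between blocks, with minima [mn], the answer for block [S] and level [k] is
    the first block [A > S] with [mn A <= k].  For fixed [S] it is a step function
    of [k]; if it changes from [A] to a later block between the levels [k + 1] and
    [k], then [k + 1 = mn A] and [S] is the last block before [A] with minimum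
    below [mn A].  So each [A] is responsible for one change only, and cutting the
    levels into chunks of [D = g ^ 5], all chunks but one per block [A] (and
    the one below [mn S]) are constant: they are stored as one word, the others
    as explicit lists of [D] words.

    For the finitely many small [n] the program reads all of [P] bit by bit and
    contains all the answers. *)

(** The exponents come from one budget: with words of [O (g ^ 2)] bits, [O (n / g ^ 3)] words make
    an index of [o(n)] bits. So nothing of a full word is stored per micro block; even their
    starting excesses are packed, [g] to a word. [D] has to exceed [lg n ^ 2], of order [g ^ 4]; the
    factor left over in [D = g ^ 5] absorbs the constants. Slots take [2 * D] words per block, which
    asks for blocks of [g ^ 8] positions, hence the 6 levels.

    The program must be the same for all [n], while word size, fan-out and addresses vary. It reads
    them from a header in the index, and is written in a language without loops, so that constant
    time follows from program length.

    Registers hold naturals only. The walks are shifted by [bias = g ^ 9], more than a block plus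
    [D], and the same shift turns the packed differences into naturals below [2 ^ g]. Blocks must be
    complete, so the walk runs on past the end of the sequence, over the words that follow; the bits
    there are arbitrary, and answers in that region have to be excluded. *)

Inductive expr : Set :=
| Va (r : nat) | Cst (c : N) | Bin (o : binop) (a b : expr) | Ld (a : expr).

Inductive stm : Set :=
| Skip | Asg (r : nat) (e : expr) | Sq (a b : stm) | Ifl (a b : expr) (s1 s2 : stm).

Fixpoint ev (w : nat) (m : N -> N) (r : nat -> N) (e : expr) : N :=
  match e with
  | Va x => r x
  | Cst c => trunc w c
  | Bin o a b => eval_binop w o (ev w m r a) (ev w m r b)
  | Ld a => m (ev w m r a)
  end.

Fixpoint run (w : nat) (m : N -> N) (s : stm) (r : nat -> N) : nat -> N :=
  match s with
  | Skip => r
  | Asg x e => set_reg r x (ev w m r e)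
  | Sq a b => run w m b (run w m a r)
  | Ifl a b s1 s2 =>
      if N.ltb (ev w m r a) (ev w m r b) then run w m s1 r else run w m s2 r
  end.

(** * Compilation to the word RAM and its correctness *)

Fixpoint compile_exp (d : nat) (e : expr) : program :=
  match e with
  | Va x => [Move d x]
  | Cst c => [LoadConst d c]
  | Bin o a b => compile_exp d a ++ compile_exp (S d) b ++ [Op o d d (S d)]
  | Ld a => compile_exp d a ++ [LoadMem d d]
  end.

(** Jump targets are absolute: [p] is the address of the first instruction. *)
Fixpoint compile_stm (d p : nat) (s : stm) : program :=
  match s with
  | Skip => []
  | Asg x e => compile_exp d e ++ [Move x d]
  | Sq a b =>
      let ca := compile_stm d p a in ca ++ compile_stm d (p + length ca) b
  | Ifl a b s1 s2 =>
      let ce := compile_exp d a ++ compile_exp (S d) b in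
      let c2 := compile_stm d (p + length ce + 1) s2 in
      let l1 := p + length ce + 1 + length c2 + 1 in
      let c1 := compile_stm d l1 s1 in
      ce ++ [JumpLt d (S d) l1] ++ c2 ++ [Jump (l1 + length c1)] ++ c1
  end.

(** Registers from [d] upward serve the compiled code as an evaluation stack; the source program has
    to stay below them. *)
Fixpoint exp_fits (d : nat) (e : expr) : Prop :=
  match e with
  | Va x => x < d
  | Cst _ => True
  | Bin _ a b => exp_fits d a /\ exp_fits d b
  | Ld a => exp_fits d a
  end.

Fixpoint stm_fits (d : nat) (s : stm) : Prop :=
  match s with
  | Skip => True
  | Asg x e => x < d /\ exp_fits d e
  | Sq a b => stm_fits d a /\ stm_fits d b
  | Ifl a b s1 s2 => exp_fits d a /\ exp_fits d b /\ stm_fits d s1 /\ stm_fits d s2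
  end.

Lemma exp_fits_mono d d' e : d <= d' -> exp_fits d e -> exp_fits d' e.
Proof. induction e; simpl; intuition lia. Qed.

Lemma stm_fits_mono d d' s : d <= d' -> stm_fits d s -> stm_fits d' s.
Proof.
  intros H; induction s; simpl; intuition eauto using exp_fits_mono; lia.
Qed.

Lemma exp_fits_ex e : exists d, exp_fits d e.
Proof.
  induction e as [x|c|o a [da Ha] b [db Hb]|a [da Ha]]; simpl.
  - exists (S x); lia.
  - exists 0; exact I.
  - exists (da + db); split; eapply exp_fits_mono; try eassumption; lia.
  - exists da; exact Ha.
Qed.

Lemma stm_fits_ex s : exists d, stm_fits d s.
Proof.
  induction s as [|x e|a [da Ha] b [db Hb]|a b s1 [d1 H1] s2 [d2 H2]]; simpl.
  - exists 0; exact I.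
  - destruct (exp_fits_ex e) as [d Hd]; exists (S x + d); split; [lia|].
    eapply exp_fits_mono; [|eassumption]; lia.
  - exists (da + db); split; eapply stm_fits_mono; try eassumption; lia.
  - destruct (exp_fits_ex a) as [da Ha], (exp_fits_ex b) as [db Hb].
    exists (da + db + d1 + d2).
    repeat split; (eapply exp_fits_mono + eapply stm_fits_mono); try eassumption; lia.
Qed.

(** Jump targets are absolute, so a fragment only has a meaning at its place in the whole
    program. *)
Definition code_at (prog : program) (p : nat) (c : program) : Prop :=
  forall i x, nth_error c i = Some x -> nth_error prog (p + i) = Some x.

Lemma code_at_app prog p c1 c2 :
  code_at prog p (c1 ++ c2) -> code_at prog p c1 /\ code_at prog (p + length c1) c2.
Proof.
  intros H; split; intros i x Hi.
  - apply H. rewrite nth_error_app1; [assumption|].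
    apply nth_error_Some; congruence.
  - rewrite <- Nat.add_assoc; apply H.
    rewrite nth_error_app2 by lia. now replace (length c1 + i - length c1) with i by lia.
Qed.

Lemma code_at_one prog p x c : code_at prog p (x :: c) -> nth_error prog p = Some x.
Proof. intros H. rewrite <- (Nat.add_0_r p). now apply H. Qed.

(** [exec] yields a state only at [Halt] and so cannot describe a fragment; this relation
    composes. *)
Inductive steps (w : nat) (prog : program) : nat -> state -> state -> Prop :=
| steps_0 s : steps w prog 0 s s
| steps_S k c s s' : nth_error prog (pc s) = Some c -> c <> Halt ->
    steps w prog k (step w c s) s' -> steps w prog (S k) s s'.

Lemma steps_trans w prog a b s1 s2 s3 :
  steps w prog a s1 s2 -> steps w prog b s2 s3 -> steps w prog (a + b) s1 s3.
Proof. induction 1; simpl; eauto using steps. Qed.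

Lemma steps_one w prog c s :
  nth_error prog (pc s) = Some c -> c <> Halt -> steps w prog 1 s (step w c s).
Proof. eauto using steps. Qed.

Lemma steps_exec w prog k s s' t :
  steps w prog k s s' -> nth_error prog (pc s') = Some Halt -> k <= t ->
  exec w prog t s = Some s'.
Proof.
  intros H Hh; revert t; induction H as [s|k c s s' Hc Hn Hs IH]; intros t Ht.
  - destruct t; simpl; now rewrite Hh.
  - destruct t as [|t]; [lia|].
    simpl. rewrite Hc. destruct c; try (now apply IH; [|lia]); congruence.
Qed.

Definition agree (d : nat) (r r' : nat -> N) : Prop := forall x, x < d -> r x = r' x.

Lemma ev_agree w m d e r r' : exp_fits d e -> agree d r r' -> ev w m r e = ev w m r' e.
Proof.
  intros He Ha; induction e; simpl in *; auto.
  - now rewrite IHe1, IHe2 by tauto.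
  - now rewrite IHe.
Qed.

Lemma set_reg_eq r d v : set_reg r d v d = v.
Proof. unfold set_reg; now rewrite Nat.eqb_refl. Qed.

Lemma set_reg_neq r d v e : e <> d -> set_reg r d v e = r e.
Proof. intros H; unfold set_reg; now rewrite (proj2 (Nat.eqb_neq e d) H). Qed.

(** Two bounds occur because the stack height [d] grows at each second operand, while the bound [d0]
    on the registers read stays fixed. The memory is the same before and after since no [StoreMem]
    is ever emitted. *)
Lemma compile_exp_correct w m prog d0 e : forall d p r,
  exp_fits d0 e -> d0 <= d -> code_at prog p (compile_exp d e) ->
  exists r', steps w prog (length (compile_exp d e)) (State p r m)
               (State (p + length (compile_exp d e)) r' m) /\
    r' d = ev w m r e /\ agree d r' r.
Proof.
  induction e as [x|c|o a IHa b IHb|a IHa]; intros d p r Hf Hd Hc; simpl in *.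
  - apply code_at_one in Hc. exists (set_reg r d (r x)).
    rewrite Nat.add_1_r; repeat split.
    + now apply (steps_one w prog (Move d x) (State p r m)).
    + apply set_reg_eq.
    + intros y Hy; apply set_reg_neq; lia.
  - apply code_at_one in Hc. exists (set_reg r d (trunc w c)).
    rewrite Nat.add_1_r; repeat split.
    + now apply (steps_one w prog (LoadConst d c) (State p r m)).
    + apply set_reg_eq.
    + intros y Hy; apply set_reg_neq; lia.
  - apply code_at_app in Hc as [Hca Hc]. apply code_at_app in Hc as [Hcb Hc].
    apply code_at_one in Hc. destruct Hf as [Hfa Hfb].
    destruct (IHa d p r Hfa Hd Hca) as (ra & Sa & Va_ & Aa).
    destruct (IHb (S d) _ ra Hfb (le_S _ _ Hd) Hcb) as (rb & Sb & Vb & Ab).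
    exists (set_reg rb d (eval_binop w o (rb d) (rb (S d)))).
    rewrite !length_app; simpl. repeat split.
    + eapply steps_trans; [exact Sa|]. eapply steps_trans; [exact Sb|].
      rewrite !Nat.add_assoc, Nat.add_1_r.
      now apply (steps_one w prog (Op o d d (S d)) (State _ rb m)).
    (* The second operand ran on [ra], which agrees with [r] on all source registers; its own stack
       starts above [d], so the first operand survives. *)
    + rewrite set_reg_eq, Vb, (Ab d) by lia. rewrite Va_. f_equal.
      apply (ev_agree w m d0); auto. intros y Hy; apply Aa; lia.
    + intros y Hy. rewrite set_reg_neq by lia. rewrite Ab by lia. now apply Aa.
  - apply code_at_app in Hc as [Hca Hc]. apply code_at_one in Hc.
    destruct (IHa d p r Hf Hd Hca) as (ra & Sa & Va_ & Aa).
    exists (set_reg ra d (m (ra d))). rewrite length_app; simpl. repeat split.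
    + eapply steps_trans; [exact Sa|].
      rewrite !Nat.add_assoc, Nat.add_1_r.
      now apply (steps_one w prog (LoadMem d d) (State _ ra m)).
    + now rewrite set_reg_eq, Va_.
    + intros y Hy. rewrite set_reg_neq by lia. now apply Aa.
Qed.

Lemma agree_trans d r1 r2 r3 : agree d r1 r2 -> agree d r2 r3 -> agree d r1 r3.
Proof. intros H1 H2 x Hx; now rewrite H1, H2. Qed.

Lemma run_agree w m d s r r' : stm_fits d s -> agree d r r' ->
  agree d (run w m s r) (run w m s r').
Proof.
  revert r r'; induction s; simpl; intros r1 r2 Hf Ha; auto.
  - intros y Hy; unfold set_reg; destruct (Nat.eqb y r); auto.
    eapply ev_agree; [apply Hf|assumption].
  - apply IHs2; [tauto|]. apply IHs1; tauto.
  - rewrite (ev_agree w m d a r1 r2), (ev_agree w m d b r1 r2) by tauto.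
    destruct (N.ltb _ _); [apply IHs1|apply IHs2]; tauto.
Qed.

(** All jumps go forward, so no instruction is executed twice and the step count is at most the code
    length. Only registers below [d] are compared, the stack being left in an arbitrary state. *)
Lemma compile_stm_correct w m prog d s : forall p r,
  stm_fits d s -> code_at prog p (compile_stm d p s) ->
  exists k r', k <= length (compile_stm d p s) /\
    steps w prog k (State p r m) (State (p + length (compile_stm d p s)) r' m) /\
    agree d r' (run w m s r).
Proof.
  induction s as [|x e|a IHa b IHb|a b s1 IH1 s2 IH2]; intros p r Hf Hc; simpl in *.
  - exists 0, r; rewrite Nat.add_0_r; repeat split; [lia|constructor].
  - apply code_at_app in Hc as [Hc Hm]. apply code_at_one in Hm.
    destruct (compile_exp_correct w m prog d e d p r (proj2 Hf) (Nat.le_refl _) Hc)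
      as (r1 & S1 & V1 & A1).
    exists (length (compile_exp d e) + 1), (set_reg r1 x (r1 d)).
    rewrite length_app; simpl. repeat split; [lia| |].
    + eapply steps_trans; [exact S1|].
      rewrite !Nat.add_assoc, Nat.add_1_r.
      now apply (steps_one w prog (Move x d) (State _ r1 m)).
    + rewrite V1. intros y Hy; unfold set_reg; destruct (Nat.eqb y x); auto.
  - apply code_at_app in Hc as [Hca Hcb]. destruct Hf as [Hfa Hfb].
    destruct (IHa p r Hfa Hca) as (ka & ra & La & Sa & Aa).
    destruct (IHb _ ra Hfb Hcb) as (kb & rb & Lb & Sb & Ab).
    exists (ka + kb), rb. rewrite length_app; repeat split; [lia| |].
    + rewrite Nat.add_assoc. eapply steps_trans; eassumption.
    + eapply agree_trans; [exact Ab|]. now apply run_agree.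
  - destruct Hf as (Ha & Hb & Hs1 & Hs2).
    set (ca := compile_exp d a) in *. set (cb := compile_exp (S d) b) in *.
    rewrite length_app in *.
    set (c2 := compile_stm d (p + (length ca + length cb) + 1) s2) in *.
    set (l1 := p + (length ca + length cb) + 1 + length c2 + 1) in *.
    set (c1 := compile_stm d l1 s1) in *.
    apply code_at_app in Hc as [Hce Hc]. apply code_at_app in Hce as [Hca Hcb].
    change (JumpLt d (S d) l1 :: c2 ++ Jump (l1 + length c1) :: c1)
      with ([JumpLt d (S d) l1] ++ (c2 ++ ([Jump (l1 + length c1)] ++ c1))) in Hc.
    apply code_at_app in Hc as [Hj Hc]. apply code_at_app in Hc as [Hc2 Hc].
    apply code_at_app in Hc as [Hj2 Hc1]. apply code_at_one in Hj, Hj2. simpl in *.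
    rewrite (length_app ca cb) in *.
    destruct (compile_exp_correct w m prog d a d p r Ha (Nat.le_refl _) Hca)
      as (ra & Sa & Va_ & Aa).
    destruct (compile_exp_correct w m prog d b (S d) _ ra Hb (le_S _ _ (Nat.le_refl _)) Hcb)
      as (rb & Sb & Vb & Ab).
    fold ca in Sa. fold cb in Sb.
    assert (Arb : agree d rb r) by (intros y Hy; rewrite Ab by lia; now apply Aa).
    assert (Ea : rb d = ev w m r a) by (now rewrite Ab, Va_ by lia).
    assert (Eb : rb (S d) = ev w m r b)
      by (rewrite Vb; apply (ev_agree w m d); auto).
    assert (Sc := steps_trans _ _ _ _ _ _ _ Sa Sb).
    rewrite <- Nat.add_assoc in Sc.
    assert (Sd := steps_trans _ _ _ _ _ _ _ Sc
      (steps_one w prog (JumpLt d (S d) l1)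
        (State (p + (length ca + length cb)) rb m) Hj ltac:(discriminate))).
    simpl in Sd. rewrite Ea, Eb in Sd.
    rewrite !length_app; simpl. fold c2. fold l1. fold c1.
    destruct (N.ltb (ev w m r a) (ev w m r b)).
    + fold l1 in Hc1.
      destruct (IH1 l1 rb Hs1 Hc1) as (k & r' & Lk & Sk & Ak). fold c1 in Lk, Sk.
      exists (length ca + length cb + 1 + k), r'. repeat split; [lia| |].
      * replace (p + (length ca + length cb + S (length c2 + S (length c1))))
          with (l1 + length c1) by (unfold l1; lia).
        eapply steps_trans; eassumption.
      * eapply agree_trans; [exact Ak|]. now apply run_agree.
    + destruct (IH2 (p + (length ca + length cb) + 1) rb Hs2 Hc2) as (k & r' & Lk & Sk & Ak).
      fold c2 in Lk, Sk.
      rewrite <- (Nat.add_1_r (p + _)) in Sd.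
      assert (Se := steps_trans _ _ _ _ _ _ _ Sd Sk).
      assert (Sf := steps_trans _ _ _ _ _ _ _ Se
        (steps_one w prog (Jump (l1 + length c1))
          (State (p + (length ca + length cb) + 1 + length c2) r' m) Hj2 ltac:(discriminate))).
      simpl in Sf.
      exists (length ca + length cb + 1 + k + 1), r'. repeat split; [lia| |].
      * replace (p + (length ca + length cb + S (length c2 + S (length c1))))
          with (l1 + length c1) by (unfold l1; lia).
        exact Sf.
      * eapply agree_trans; [exact Ak|]. now apply run_agree.
Qed.

(** Without loops, the running time is bounded by the length of the program. *)
Lemma stm_program (s : stm) :
  exists (prog : program) (t : nat), forall w P I args v t', t <= t' ->
    Z.of_N (run w (layout w P I) s (fun e => nth e (words w P :: args) 0%N) 0) = v ->
    answers w P I prog t' args v.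
Proof.
  destruct (stm_fits_ex s) as [d0 Hd0].
  assert (Hd : stm_fits (S d0) s) by (eapply stm_fits_mono; [|eassumption]; lia).
  set (c := compile_stm (S d0) 0 s).
  exists (c ++ [Halt]), (length c). intros w P I args v t' Ht Hv.
  assert (Hc : code_at (c ++ [Halt]) 0 c).
  { intros i x Hi; simpl. rewrite nth_error_app1; [assumption|].
    apply nth_error_Some; congruence. }
  destruct (compile_stm_correct w (layout w P I) _ _ s 0
             (fun e => nth e (words w P :: args) 0%N) Hd Hc) as (k & r' & Lk & Sk & Ak).
  fold c in Lk, Sk.
  exists (State (0 + length c) r' (layout w P I)). repeat split.
  - unfold initial. eapply steps_exec; [exact Sk| |lia]. simpl.
    rewrite nth_error_app2 by lia. now rewrite Nat.sub_diag.
  - rewrite <- Hv. simpl. rewrite (Ak 0) by lia. reflexivity.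
Qed.

(** * Bounded search over the naturals *)

Local Open Scope N_scope.

(** [a + n] when no element of [a, ..., a + n - 1] satisfies [p]. *)
Fixpoint first (p : N -> bool) (a : N) (n : nat) : N :=
  match n with
  | O => a
  | S n' => if p a then a else first p (N.succ a) n'
  end.

Lemma first_spec p n : forall a,
  a <= first p a n <= a + N.of_nat n /\
  (forall x, a <= x < first p a n -> p x = false) /\
  (first p a n < a + N.of_nat n -> p (first p a n) = true).
Proof.
  induction n as [|n IH]; intros a.
  - cbn [first]. repeat split; intros; lia.
  - cbn [first]. destruct (p a) eqn:Hp.
    + repeat split; intros; auto; lia.
    + destruct (IH (N.succ a)) as (H1 & H2 & H3). split; [lia|]. split.
      * intros x Hx. destruct (N.eq_dec x a) as [->|]; auto. apply H2; lia.
      * intros H; apply H3; lia.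
Qed.

(** 0 also when no element satisfies [p]. *)
Fixpoint last_below (p : N -> bool) (n : nat) : N :=
  match n with
  | O => 0
  | S n' => if p (N.of_nat n') then N.of_nat n' else last_below p n'
  end.

Lemma last_below_eq p x n : x < N.of_nat n -> p x = true ->
  (forall y, x < y < N.of_nat n -> p y = false) -> last_below p n = x.
Proof.
  intros Hx Hp; induction n as [|n IH]; intros Hy; [lia|]. cbn [last_below].
  destruct (N.eq_dec x (N.of_nat n)) as [<-|Hne]; [now rewrite Hp|].
  rewrite Hy by lia. apply IH; [lia|]. intros y H; apply Hy; lia.
Qed.

(** * Jumping between blocks *)

Section Jump.
Variables (mn : N -> Z) (nb D : N).
Hypothesis HD : 0 < D.

Definition jump (S : N) (k : Z) : N :=
  first (fun A => (mn A <=? k)%Z) (N.succ S) (N.to_nat (nb - N.succ S)).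

(** If no block qualifies, the default 0 may attach a needless slot to block 0; this is harmless,
    since the slot still lists correct answers. *)
Definition source (A : N) : N :=
  last_below (fun S => (mn S <? mn A)%Z) (N.to_nat A).

(** Chunks are aligned at [mn S]. Chunk 0 holds the [D] levels just below it, where [source] gives
    no information; on later chunks [mn S] is at most the level, as the argument on [source]
    requires. *)
Definition chunk_of (S : N) (k : Z) : N := Z.to_N ((k + Z.of_N D - mn S) / Z.of_N D).

Definition chunk_level (S c o : N) : Z :=
  (mn S + (Z.of_N c - 1) * Z.of_N D + Z.of_N o)%Z.

Definition blocks : list N := map N.of_nat (seq 0 (N.to_nat nb)).

(** The values of [jump S] on a chunk are either all equal or listed in a slot;
    the first block [A] at which they change identifies both [S] and the chunk.
    A stored value above [nb] stands for the slot [value - (nb + 1)]. *)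
Definition jump_top (S c : N) : N :=
  if c =? 0 then nb + 1 + (nb + S) else
  match find (fun A => (source A =? S) && (chunk_of S (mn A) =? c))%bool blocks with
  | Some A => nb + 1 + A
  | None => jump S (chunk_level S c 0)
  end.

(** A slot [j < nb] recovers its block and chunk from [j] alone; slot [nb + S] serves chunk 0 of
    [S]. Hence [2 * nb] slots of [D] words. *)
Definition jump_slot (j o : N) : N :=
  if j <? nb then jump (source j) (chunk_level (source j) (chunk_of (source j) (mn j)) o)
  else jump (j - nb) (chunk_level (j - nb) 0 o).

Lemma jump_spec S k : S < nb ->
  S < jump S k <= nb /\
  (forall A, S < A < jump S k -> (k < mn A)%Z) /\
  (jump S k < nb -> (mn (jump S k) <= k)%Z).
Proof using.
  clear HD.
  intros HS. unfold jump.
  destruct (first_spec (fun A => (mn A <=? k)%Z) (N.to_nat (nb - N.succ S)) (N.succ S))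
    as (H1 & H2 & H3).
  split; [lia|]. split.
  - intros A HA. specialize (H2 A). lia.
  - intros H. lia.
Qed.

Lemma jump_const S c o : S < nb -> 1 <= c ->
  find (fun A => (source A =? S) && (chunk_of S (mn A) =? c))%bool blocks = None ->
  o < D -> jump S (chunk_level S c o) = jump S (chunk_level S c 0).
Proof.
  intros HS Hc Hnone. induction o as [|o IH] using N.peano_ind; auto. intros Ho.
  rewrite <- IH by lia.
  set (k := chunk_level S c o).
  assert (Hk : chunk_level S c (N.succ o) = (k + 1)%Z) by (unfold k, chunk_level; lia).
  rewrite Hk.
  destruct (jump_spec S k HS) as (P1 & P2 & P3).
  destruct (jump_spec S (k + 1) HS) as (Q1 & Q2 & Q3).
  destruct (N.eq_dec (jump S (k + 1)) (jump S k)) as [|Hne]; auto. exfalso.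
  set (A := jump S (k + 1)) in *. set (B := jump S k) in *.
  (* A higher level is attained no later, so the answer can only move forward when the level
     drops. *)
  assert (A < B).
  { destruct (N.lt_trichotomy A B) as [H|[H|H]]; auto; [easy|].
    specialize (Q2 B ltac:(lia)). specialize (P3 ltac:(lia)). lia. }
  specialize (Q3 ltac:(lia)). specialize (P2 A ltac:(lia)).
  assert (HA : mn A = (k + 1)%Z) by lia.
  (* This is where chunk 0 is excluded: [S] itself must have a minimum below [mn A]. *)
  assert (HkS : (mn S <= k)%Z) by (unfold k, chunk_level; nia).
  assert (E1 : source A = S).
  { unfold source. apply last_below_eq; try lia.
    intros y Hy. specialize (Q2 y). lia. }
  assert (E2 : chunk_of S (mn A) = c).
  { unfold chunk_of. rewrite HA. unfold k, chunk_level.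
    replace (mn S + (Z.of_N c - 1) * Z.of_N D + Z.of_N o + 1 + Z.of_N D - mn S)%Z
      with (Z.of_N o + 1 + Z.of_N c * Z.of_N D)%Z by ring.
    rewrite Z.div_add by lia. rewrite Z.div_small by lia. lia. }
  apply (find_none _ _ ) with (x := A) in Hnone.
  - rewrite E1, E2, !N.eqb_refl in Hnone. discriminate.
  - unfold blocks. apply in_map_iff. exists (N.to_nat A). split; [lia|].
    apply in_seq; lia.
Qed.

(** This is the computation made by [p_jump]: [d] is the offset of [k] from the bottom of chunk 0,
    its quotient by [D] selects the chunk and its remainder the place in the list. *)
Lemma jump_lookup S k :
  S < nb -> (mn S - Z.of_N D <= k)%Z ->
  let d := Z.to_N (k + Z.of_N D - mn S) in
  let t := jump_top S (d / D) in
  (if t <? nb + 1 then t else jump_slot (t - (nb + 1)) (d mod D)) = jump S k.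
Proof.
  intros HS Hk d t.
  assert (Hkl : chunk_level S (d / D) (d mod D) = k).
  { unfold chunk_level. pose proof (N.div_mod d D ltac:(lia)) as H.
    apply (f_equal Z.of_N) in H. rewrite N2Z.inj_add, N2Z.inj_mul in H. nia. }
  assert (Hmod : d mod D < D) by (apply N.mod_lt; lia).
  unfold t, jump_top. destruct (N.eqb_spec (d / D) 0) as [E0|E0].
  - destruct (N.ltb_spec (nb + 1 + (nb + S)) (nb + 1)) as [?|?]; [lia|].
    unfold jump_slot. replace (nb + 1 + (nb + S) - (nb + 1)) with (nb + S) by lia.
    destruct (N.ltb_spec (nb + S) nb) as [?|?]; [lia|].
    replace (nb + S - nb) with S by lia. rewrite <- E0. now rewrite Hkl.
  - destruct (find _ _) as [A|] eqn:Hf.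
    + apply find_some in Hf as [Hin HA]. apply andb_prop in HA as [H1 H2].
      apply N.eqb_eq in H1, H2.
      apply in_map_iff in Hin as (a & <- & Ha). apply in_seq in Ha.
      set (A := N.of_nat a) in *.
      destruct (N.ltb_spec (nb + 1 + A) (nb + 1)) as [?|?]; [lia|].
      unfold jump_slot. replace (nb + 1 + A - (nb + 1)) with A by lia.
      destruct (N.ltb_spec A nb) as [?|?]; [|lia].
      now rewrite H1, H2, Hkl.
    + destruct (jump_spec S (chunk_level S (d / D) 0) HS) as (P1 & _ & _).
      destruct (N.ltb_spec (jump S (chunk_level S (d / D) 0)) (nb + 1)) as [?|?]; [|lia].
      rewrite <- (jump_const S (d / D) (d mod D)); auto; [now rewrite Hkl|].
      revert E0; generalize (d / D); lia.
Qed.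

Lemma source_lt A n : last_below (fun S => (mn S <? mn A)%Z) n < N.max 1 (N.of_nat n).
Proof using.
  clear HD.
  induction n as [|n IH]; cbn [last_below]; [lia|].
  destruct (_ <? _)%Z; lia.
Qed.

Lemma jump_slot_le j o : 0 < nb -> j < 2 * nb -> jump_slot j o <= nb.
Proof using.
  clear HD.
  intros Hnb Hj. unfold jump_slot. destruct (N.ltb_spec j nb) as [H|H].
  - apply jump_spec. pose proof (source_lt j (N.to_nat j)). unfold source. lia.
  - apply jump_spec. lia.
Qed.

Lemma jump_top_le S c : S < nb -> jump_top S c <= nb + 1 + 2 * nb.
Proof using.
  clear HD.
  intros HS. unfold jump_top. destruct (N.eqb_spec c 0); [lia|].
  destruct (find _ _) as [A|] eqn:Hf.
  - apply find_some in Hf as [Hin _].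
    apply in_map_iff in Hin as (a & <- & Ha). apply in_seq in Ha. lia.
  - destruct (jump_spec S (chunk_level S c 0) HS). lia.
Qed.

Lemma jump_top_index S c : S < nb -> nb + 1 <= jump_top S c -> jump_top S c - (nb + 1) < 2 * nb.
Proof using.
  clear HD.
  intros HS. unfold jump_top. destruct (N.eqb_spec c 0); [lia|].
  destruct (find _ _) as [A|] eqn:Hf.
  - apply find_some in Hf as [Hin _].
    apply in_map_iff in Hin as (a & <- & Ha). apply in_seq in Ha. lia.
  - destruct (jump_spec S (chunk_level S c 0) HS). lia.
Qed.

End Jump.

(** * Fields of [g] bits packed into a word *)

Fixpoint pack (g : N) (f : N -> N) (n : nat) : N :=
  match n with
  | O => 0
  | S n' => pack g f n' + f (N.of_nat n') * 2 ^ (g * N.of_nat n')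
  end.

Definition field (g p c : N) : N := N.shiftr p (g * c) mod 2 ^ g.

Lemma pow2_pos a : 0 < 2 ^ a.
Proof. apply N.neq_0_lt_0, N.pow_nonzero. lia. Qed.

Lemma pack_lt g f n : (forall c, c < N.of_nat n -> f c < 2 ^ g) ->
  pack g f n < 2 ^ (g * N.of_nat n).
Proof.
  induction n as [|n IH]; intros Hf; cbn [pack]; [pose proof (pow2_pos (g * N.of_nat 0)); lia|].
  specialize (IH ltac:(intros; apply Hf; lia)). specialize (Hf (N.of_nat n) ltac:(lia)).
  replace (g * N.of_nat (S n)) with (g * N.of_nat n + g) by lia.
  rewrite N.pow_add_r. nia.
Qed.

Lemma field_pack g f n c : (forall c, c < N.of_nat n -> f c < 2 ^ g) -> c < N.of_nat n ->
  field g (pack g f n) c = f c.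
Proof.
  induction n as [|n IH]; intros Hf Hc; [lia|]. cbn [pack].
  unfold field in *. rewrite N.shiftr_div_pow2 in *.
  pose proof (pow2_pos g).
  destruct (N.eq_dec c (N.of_nat n)) as [->|Hne].
  - rewrite N.div_add by (pose proof (pow2_pos (g * N.of_nat n)); lia).
    rewrite N.div_small by (apply pack_lt; intros; apply Hf; lia).
    rewrite N.add_0_l. apply N.mod_small, Hf; lia.
  (* After the shift the last field contributes a multiple of [2 ^ g], which the reduction
     removes. *)
  - rewrite <- IH by (try (intros; apply Hf); lia).
    replace (g * N.of_nat n) with (g * (N.of_nat n - c - 1) + g + g * c) by nia.
    rewrite !N.pow_add_r, !N.mul_assoc, N.div_add
      by (pose proof (pow2_pos (g * c)); lia).
    rewrite N.Div0.add_mod, N.Div0.mod_mul, N.add_0_r, N.Div0.mod_mod. reflexivity.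
Qed.

(** The interval has [n + 1] points, which avoids the minimum of an empty set. *)
Fixpoint min_over (E : N -> Z) (a : N) (n : nat) : Z :=
  match n with
  | O => E a
  | S n' => Z.min (E a) (min_over E (N.succ a) n')
  end.

Lemma min_over_spec E n : forall a,
  (forall y, a <= y <= a + N.of_nat n -> (min_over E a n <= E y)%Z) /\
  (exists y, a <= y <= a + N.of_nat n /\ min_over E a n = E y).
Proof.
  induction n as [|n IH]; intros a; cbn [min_over].
  - split; [intros y Hy; replace y with a by lia; lia|exists a; lia].
  - destruct (IH (N.succ a)) as [H1 (y & Hy & Ey)]. split.
    + intros x Hx. destruct (N.eq_dec x a) as [->|]; [lia|].
      specialize (H1 x ltac:(lia)). lia.
    + destruct (Z.le_gt_cases (E a) (min_over E (N.succ a) n)).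
      * exists a; lia.
      * exists y; lia.
Qed.

Definition unit_steps (E : N -> Z) (len : N) : Prop :=
  forall x, N.succ x < len -> (Z.abs (E (N.succ x) - E x) <= 1)%Z.

Lemma unit_steps_dist E len x y : unit_steps E len -> x <= y < len ->
  (Z.abs (E y - E x) <= Z.of_N (y - x))%Z.
Proof.
  intros HE. induction y as [|y IH] using N.peano_ind; intros H.
  - replace x with 0 by lia. lia.
  - destruct (N.eq_dec x (N.succ y)) as [->|]; [lia|].
    specialize (IH ltac:(lia)). specialize (HE y ltac:(lia)). lia.
Qed.

(** * Search trees over micro blocks, and their lookup tables *)

Section Tree.
Variables (g bias nb : N) (E : N -> Z).

(** A node of level [l] covers [zsize l] positions; those of level 0 have
    single positions as children. *)
Fixpoint zsize (l : nat) : N :=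
  match l with O => g * g | S l' => zsize l' * g end.
Definition csize (l : nat) : N := match l with O => 1 | S l' => zsize l' end.
Definition fan (l : nat) : N := match l with O => g * g | S _ => g end.

Lemma zsize_fan l : zsize l = fan l * csize l.
Proof. destruct l; cbn [zsize fan csize]; lia. Qed.

Definition block_min (l : nat) (u : N) : Z := min_over E (u * zsize l) (N.to_nat (zsize l - 1)).

(** Taken relative to the start of the node, a minimum is bounded by the node size; the shift by
    [bias] makes it a natural that fits in [g] bits. *)
Definition node_field (l : nat) (v c : N) : N :=
  Z.to_N (block_min l (v * g + c) - E (v * zsize (S l)) + Z.of_N bias).

Definition node_word (l : nat) (v : N) : N := pack g (node_field l v) (N.to_nat g).

(** One word for the start of each micro block would cost [n / g ^ 2] words, hence order [n] bits.
    Relative to the node above, [g] of them share a word. *)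
Definition start_field (v c : N) : N :=
  Z.to_N (E ((v * g + c) * zsize 0) - E (v * zsize 1) + Z.of_N bias).
Definition start_word (v : N) : N := pack g (start_field v) (N.to_nat g).

(** The argument is a triple in mixed radix: node word, first child to consider ([g] is allowed,
    when none is left) and shifted level. *)
Definition field_table (i : N) : N :=
  let q := i / 2 ^ g in
  first (fun c => field g (q / (g + 1)) c <=? i mod 2 ^ g)
    (q mod (g + 1)) (N.to_nat (g - q mod (g + 1))).

(** The result [fan l] reports that the rest of the node stays above [k]. *)
Definition step_result (l : nat) (v o : N) (k : Z) (c : N) : Prop :=
  o <= c <= fan l /\
  (forall y, v * zsize l + o * csize l <= y < v * zsize l + c * csize l -> (k < E y)%Z) /\
  (c < fan l -> exists y,
     v * zsize l + c * csize l <= y < v * zsize l + c * csize l + csize l /\ (E y <= k)%Z).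

Hypothesis Hg : 0 < g.
Let len := nb * zsize 6.
Hypothesis HE : unit_steps E len.
Hypothesis Hb : zsize 6 < bias.
Hypothesis Hb2 : 2 * bias <= 2 ^ g.

Lemma zsize_pos l : 0 < zsize l.
Proof using Hg.
  clear - Hg. induction l; cbn [zsize]; nia. Qed.

Lemma zsize_mono l l' : (l <= l')%nat -> zsize l <= zsize l'.
Proof using Hg.
  clear - Hg.
  induction 1 as [|l' H IH]; [lia|]. cbn [zsize]. pose proof (zsize_pos l'). nia.
Qed.

Lemma block_min_spec l u :
  (forall y, u * zsize l <= y < u * zsize l + zsize l -> (block_min l u <= E y)%Z) /\
  (exists y, u * zsize l <= y < u * zsize l + zsize l /\ block_min l u = E y).
Proof using Hg.
  clear - Hg.
  pose proof (zsize_pos l).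
  destruct (min_over_spec E (N.to_nat (zsize l - 1)) (u * zsize l)) as [H1 (y & Hy & Ey)].
  split.
  - intros x Hx. apply H1. lia.
  - exists y; split; [lia|exact Ey].
Qed.

Lemma node_dist l v x y : (l <= 6)%nat -> v * zsize l + zsize l <= len ->
  v * zsize l <= x < v * zsize l + zsize l ->
  v * zsize l <= y < v * zsize l + zsize l -> (Z.abs (E x - E y) < Z.of_N (zsize l))%Z.
Proof using Hg HE.
  clear - Hg HE.
  intros Hl Hv Hx Hy. pose proof (zsize_mono l 6 Hl).
  destruct (N.le_ge_cases x y).
  - pose proof (unit_steps_dist E len x y HE ltac:(lia)). lia.
  - pose proof (unit_steps_dist E len y x HE ltac:(lia)). lia.
Qed.

Lemma child_range l v c : c < g ->
  v * zsize (S l) <= (v * g + c) * zsize l /\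
  (v * g + c) * zsize l + zsize l <= v * zsize (S l) + zsize (S l).
Proof using Hg.
  clear - Hg. intros Hc. cbn [zsize]. generalize (zsize l). intros z. nia. Qed.

Lemma node_field_spec l v c : (l < 6)%nat -> v * zsize (S l) + zsize (S l) <= len -> c < g ->
  (Z.of_N (node_field l v c) = block_min l (v * g + c) - E (v * zsize (S l)) + Z.of_N bias)%Z /\
  node_field l v c < 2 ^ g.
Proof.
  intros Hl Hv Hc. unfold node_field.
  destruct (child_range l v c Hc) as [R1 R2].
  destruct (block_min_spec l (v * g + c)) as [_ (y & Hy & ->)].
  pose proof (node_dist (S l) v y (v * zsize (S l)) ltac:(lia) Hv ltac:(lia)
    ltac:(pose proof (zsize_pos (S l)); lia)) as Hd.
  pose proof (zsize_mono (S l) 6 Hl). lia.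
Qed.

Lemma start_field_spec v c : v * zsize 1 + zsize 1 <= len -> c < g ->
  (Z.of_N (start_field v c) = E ((v * g + c) * zsize 0) - E (v * zsize 1) + Z.of_N bias)%Z /\
  start_field v c < 2 ^ g.
Proof.
  intros Hv Hc. unfold start_field.
  destruct (child_range 0 v c Hc) as [R1 R2]. pose proof (zsize_pos 0).
  pose proof (node_dist 1 v ((v * g + c) * zsize 0) (v * zsize 1) ltac:(lia) Hv ltac:(lia)
    ltac:(pose proof (zsize_pos 1); lia)) as Hd.
  pose proof (zsize_mono 1 6 ltac:(lia)). lia.
Qed.

Lemma node_word_lt l v : (l < 6)%nat -> v * zsize (S l) + zsize (S l) <= len ->
  node_word l v < 2 ^ (g * g).
Proof.
  intros Hl Hv. unfold node_word.
  replace (g * g) with (g * N.of_nat (N.to_nat g)) by lia.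
  apply pack_lt. intros c Hc. apply node_field_spec; auto; lia.
Qed.

Lemma start_word_lt v : v * zsize 1 + zsize 1 <= len -> start_word v < 2 ^ (g * g).
Proof.
  intros Hv. unfold start_word.
  replace (g * g) with (g * N.of_nat (N.to_nat g)) by lia.
  apply pack_lt. intros c Hc. apply start_field_spec; auto; lia.
Qed.

Lemma start_word_field v c : v * zsize 1 + zsize 1 <= len -> c < g ->
  (Z.of_N (field g (start_word v) c) =
   E ((v * g + c) * zsize 0) - E (v * zsize 1) + Z.of_N bias)%Z.
Proof.
  intros Hv Hc. unfold start_word. rewrite field_pack.
  - now apply start_field_spec.
  - intros c' Hc'. apply start_field_spec; auto; lia.
  - lia.
Qed.

Lemma index_split a b o k : o < b -> k < a ->
  forall p, ((p * b + o) * a + k) mod a = k /\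
       ((p * b + o) * a + k) / a mod b = o /\ ((p * b + o) * a + k) / a / b = p.
Proof using.
  clear.
  intros Ho Hk p.
  assert (E1 : ((p * b + o) * a + k) / a = p * b + o)
    by (rewrite N.div_add_l by lia; rewrite N.div_small by lia; lia).
  rewrite E1. repeat split.
  - rewrite N.add_comm, N.Div0.mod_add. now apply N.mod_small.
  - rewrite N.add_comm, N.Div0.mod_add. now apply N.mod_small.
  - rewrite N.div_add_l by lia. rewrite N.div_small by lia. lia.
Qed.

(** Fields and [kap] carry the same offset, namely [bias] minus the walk at the start of the node,
    so comparing them compares minima with [k]. *)
Lemma field_table_step l v o k kap : (l < 6)%nat -> v * zsize (S l) + zsize (S l) <= len ->
  o <= g -> kap < 2 ^ g -> (Z.of_N kap = k + Z.of_N bias - E (v * zsize (S l)))%Z ->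
  step_result (S l) v o k (field_table ((node_word l v * (g + 1) + o) * 2 ^ g + kap)).
Proof.
  intros Hl Hv Ho Hk Ek. unfold field_table.
  destruct (index_split (2 ^ g) (g + 1) o kap ltac:(lia) Hk (node_word l v)) as (-> & -> & ->).
  destruct (first_spec (fun c => field g (node_word l v) c <=? kap) (N.to_nat (g - o)) o)
    as (H1 & H2 & H3).
  set (c := first _ _ _) in *.
  assert (F : forall c', c' < g ->
    (Z.of_N (field g (node_word l v) c') =
     block_min l (v * g + c') - E (v * zsize (S l)) + Z.of_N bias)%Z).
  { intros c' Hc'. unfold node_word. rewrite field_pack.
    - now apply node_field_spec.
    - intros c'' Hc''. apply node_field_spec; auto; lia.
    - lia. }
  assert (Ez : forall c', v * zsize (S l) + c' * zsize l = (v * g + c') * zsize l)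
    by (intros c'; cbn [zsize]; ring).
  assert (Hcg : o <= c <= g) by lia.
  unfold step_result. cbn [fan csize]. split; [exact Hcg|]. split.
  - intros y Hy.
    (* The child containing [y]; it was passed over, so its minimum, and with it [E y], is above
       [k]. *)
    set (c' := y / zsize l - v * g).
    pose proof (zsize_pos l) as Hz.
    assert (Hq : y / zsize l * zsize l <= y < y / zsize l * zsize l + zsize l).
    { pose proof (N.div_mod y (zsize l) ltac:(lia)). pose proof (N.mod_lt y (zsize l) ltac:(lia)).
      revert H H0. generalize (y / zsize l) (y mod zsize l). intros; lia. }
    rewrite !Ez in Hy.
    assert (Hc' : y / zsize l = v * g + c' /\ o <= c' < c).
    { assert (v * g + o <= y / zsize l) by (apply N.div_le_lower_bound; lia).
      assert (y / zsize l < v * g + c) by (apply N.Div0.div_lt_upper_bound; lia).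
      unfold c'. revert H H0. generalize (y / zsize l). intros; lia. }
    destruct Hc' as [Eq Hc']. rewrite Eq in Hq. clearbody c'. clear Eq.
    destruct (block_min_spec l (v * g + c')) as [B _]. specialize (B y Hq).
    specialize (H2 c' Hc'). specialize (F c' ltac:(clear - Hc' Hcg; lia)).
    apply N.leb_gt in H2. lia.
  - intros Hc. rewrite Ez.
    destruct (block_min_spec l (v * g + c)) as [_ (y & Hy & Ey)].
    exists y. split; [exact Hy|]. specialize (F c Hc).
    specialize (H3 ltac:(clear - Hc Ho; lia)). apply N.leb_le in H3. lia.
Qed.

(** [phi p o] is the displacement of the walk after [o] positions of a micro
    block with bit pattern [p]. *)
Variable phi : N -> N -> Z.

(** As in [field_table], but positions themselves are compared. Entries depend on a micro block only
    through its bits, so one table serves the whole walk. *)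
Definition micro_table (i : N) : N :=
  let q := i / 2 ^ g in
  first (fun c => (phi (q / (g * g + 1)) c + Z.of_N bias <=? Z.of_N (i mod 2 ^ g))%Z)
    (q mod (g * g + 1)) (N.to_nat (g * g - q mod (g * g + 1))).

Lemma micro_table_step (p v o : N) (k : Z) (kap : N) :
  (forall c, c < g * g -> E (v * zsize 0 + c) = (E (v * zsize 0) + phi p c)%Z) ->
  o <= g * g -> kap < 2 ^ g -> (Z.of_N kap = k + Z.of_N bias - E (v * zsize 0))%Z ->
  step_result 0 v o k (micro_table ((p * (g * g + 1) + o) * 2 ^ g + kap)).
Proof using.
  clear.
  intros Hphi Ho Hk Ek. unfold micro_table.
  destruct (index_split (2 ^ g) (g * g + 1) o kap ltac:(lia) Hk p) as (-> & -> & ->).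
  destruct (first_spec (fun c => (phi p c + Z.of_N bias <=? Z.of_N kap)%Z)
    (N.to_nat (g * g - o)) o) as (H1 & H2 & H3).
  set (c := first _ _ _) in *.
  unfold step_result. cbn [fan csize]. split; [lia|]. split.
  - intros y Hy. specialize (H2 (y - v * zsize 0) ltac:(lia)).
    specialize (Hphi (y - v * zsize 0) ltac:(lia)).
    replace (v * zsize 0 + (y - v * zsize 0)) with y in Hphi by lia. lia.
  - intros Hc. exists (v * zsize 0 + c). split; [lia|].
    specialize (H3 ltac:(lia)). rewrite Hphi by lia. lia.
Qed.

End Tree.

(** * The search program *)

Declare Scope exp_scope.
Delimit Scope exp_scope with exp.
Notation "a + b" := (Bin OpAdd a b) : exp_scope.
Notation "a - b" := (Bin OpSub a b) : exp_scope.
Notation "a * b" := (Bin OpMul a b) : exp_scope.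
Notation "a / b" := (Bin OpDiv a b) : exp_scope.
Notation "a 'mod' b" := (Bin OpMod a b) : exp_scope.
Notation "a ;; b" := (Sq a b) (at level 90, right associativity).
Notation "x <- e" := (Asg x e%exp) (at level 80).
Bind Scope exp_scope with expr.

(** The header is an array of parameters and base addresses of tables. It is
    preceded by one word holding [n]. *)
Definition par (j : N) : expr := Ld (Va 0 + Cst (j + 1)).
Definition arr (j : N) (e : expr) : expr := Ld (par j + e).

Definition h_w : N := 0.   Definition h_g : N := 1.   Definition h_s : N := 2.
Definition h_2s : N := 3.  Definition h_2g : N := 4.  Definition h_bias : N := 5.
Definition h_D : N := 6.   Definition h_nb : N := 7.  Definition h_nch : N := 8.
Definition h_len : N := 9. Definition h_2n : N := 10. Definition h_n : N := 11.

(** Sixteen common entries come first; each walk [u] then owns 32. *)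
Definition hw (u j : N) : N := 16 + 32 * u + j.
(** [w_alpha] and [w_beta] give the affine map from micro blocks of a walk to those of the memory:
    the identity, or a reversal with slope -1 modulo the word size. The other entries are base
    addresses. *)
Definition w_alpha : N := 0. Definition w_beta : N := 1. Definition w_micro : N := 2.
Definition w_phi : N := 3.   Definition w_start : N := 4. Definition w_field : N := 5.
Definition w_min : N := 6.   Definition w_top : N := 7.  Definition w_slot : N := 8.
Definition w_abs (l : nat) : N := 9 + N.of_nat l.
Definition w_node (l : nat) : N := 16 + N.of_nat l.

(** Registers: 0 header, 4 position, 5 target excess, 6 node, 7 first child,
    8 result of a search step, 9 excess, 10 and above scratch. *)
Definition p_window (u : N) : stm :=
  12%nat <- (par (hw u w_alpha) + par (hw u w_beta) * Va 6) * par h_s ;;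
  13%nat <- Va 12 / par h_w ;;
  14%nat <- Va 12 mod par h_w ;;
  12%nat <- Bin OpOr (Bin OpShr (Ld (Va 13)) (Va 14))
              (Bin OpShl (Ld (Va 13 + Cst 1)) (par h_w - Va 14)) mod par h_2s.

Definition p_start (u : N) : stm :=
  10%nat <- arr (hw u (w_abs 0)) (Va 6 / par h_g) +
            Bin OpShr (arr (hw u w_start) (Va 6 / par h_g)) (par h_g * (Va 6 mod par h_g))
              mod par h_2g - par h_bias.

Definition table_index (p q o k e : expr) : expr :=
  ((p * (q + Cst 1) + o) * par h_2g + (k + par h_bias - e))%exp.

Definition p_level (u : N) (l : nat) : stm :=
  match l with
  | O => p_window u ;; p_start u ;;
         8%nat <- arr (hw u w_micro) (table_index (Va 12) (par h_s) (Va 7) (Va 5) (Va 10))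
  | S l' => 8%nat <- arr (hw u w_field)
              (table_index (arr (hw u (w_node l')) (Va 6)) (par h_g) (Va 7) (Va 5)
                 (arr (hw u (w_abs l')) (Va 6)))
  end.

(** Run only in a node known to contain the answer, so each step finds a child and no test is
    made. *)
Fixpoint p_down (u : N) (l : nat) : stm :=
  7%nat <- Cst 0 ;; p_level u l ;;
  match l with
  | O => 4%nat <- Va 6 * par h_s + Va 8
  | S l' => 6%nat <- Va 6 * par h_g + Va 8 ;; p_down u l'
  end.

Definition p_jump (u : N) : stm :=
  7%nat <- Va 5 + par h_D - arr (hw u w_min) (Va 6) ;;
  8%nat <- arr (hw u w_top) (Va 6 * par h_nch + Va 7 / par h_D) ;;
  Ifl (Va 8) (par h_nb + Cst 1)
    (6%nat <- Va 8)
    (6%nat <- arr (hw u w_slot)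
       ((Va 8 - (par h_nb + Cst 1)) * par h_D + Va 7 mod par h_D)) ;;
  Ifl (Va 6) (par h_nb) (p_down u 6) (4%nat <- Cst 0).

(** [n] counts the levels left above [l]. The recursion is unfolded into code: each level has its
    own copy of the descent. The search resumes just after the child that was left. *)
Fixpoint p_up (u : N) (n l : nat) : stm :=
  match n with
  | O => p_jump u
  | S n' =>
      7%nat <- Va 6 mod par h_g + Cst 1 ;;
      6%nat <- Va 6 / par h_g ;;
      p_level u (S l) ;;
      Ifl (Va 8) (par h_g) (6%nat <- Va 6 * par h_g + Va 8 ;; p_down u l) (p_up u n' (S l))
  end.

Definition p_search (u : N) : stm :=
  6%nat <- Va 4 / par h_s ;;
  7%nat <- Va 4 mod par h_s + Cst 1 ;;
  p_level u 0 ;;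
  Ifl (Va 8) (par h_s) (4%nat <- Va 6 * par h_s + Va 8) (p_up u 6 0).

Definition p_excess (u : N) : stm :=
  6%nat <- Va 4 / par h_s ;; p_window u ;; p_start u ;;
  9%nat <- Va 10 + arr (hw u w_phi) (Va 12 * par h_s + Va 4 mod par h_s) - par h_bias.

Lemma run_Sq w m a b r : run w m (Sq a b) r = run w m b (run w m a r).
Proof. reflexivity. Qed.
Lemma run_Asg w m x e r : run w m (Asg x e) r = set_reg r x (ev w m r e).
Proof. reflexivity. Qed.
Lemma run_Ifl w m a b s1 s2 r : run w m (Ifl a b s1 s2) r =
  if N.ltb (ev w m r a) (ev w m r b) then run w m s1 r else run w m s2 r.
Proof. reflexivity. Qed.

(** The bits at positions [v * s, ..., v * s + s - 1] of the memory, as the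
    program gathers them from two consecutive words. *)
Definition window (w : nat) (m : N -> N) (s v : N) : N :=
  let p := v * s in
  let b := p mod N.of_nat w in
  N.lor (N.shiftr (m (p / N.of_nat w)) b)
    (trunc w (N.shiftl (m (p / N.of_nat w + 1)) (N.of_nat w - b))) mod 2 ^ s.

(** * Correctness of the search program on an abstract walk *)

Section Correct.
Variables (w : nat) (m : N -> N) (a0 : N) (hv : N -> N).
Let W := 2 ^ N.of_nat w.

(** Intermediate results may wrap around. Expressions are followed as integers modulo [W], and only
    the final value is shown to be in range, by [cg_val]. *)
Definition cg (x : N) (z : Z) : Prop := (Z.of_N x mod Z.of_N W = z mod Z.of_N W)%Z.

Lemma W_pos : 0 < W.
Proof. apply pow2_pos. Qed.

Lemma trunc_cg x z : (Z.of_N x mod Z.of_N W = z mod Z.of_N W)%Z -> cg (trunc w x) z.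
Proof.
  intros H. unfold cg, trunc. fold W. rewrite N2Z.inj_mod, Zmod_mod. exact H.
Qed.

Lemma cg_ev r e x : ev w m r e = x -> cg (ev w m r e) (Z.of_N x).
Proof. intros ->. reflexivity. Qed.

Lemma cg_add r a b x y : cg (ev w m r a) x -> cg (ev w m r b) y ->
  cg (ev w m r (a + b)%exp) (x + y).
Proof.
  intros Hx Hy. apply trunc_cg. rewrite N2Z.inj_add, Zplus_mod, Hx, Hy, <- Zplus_mod. reflexivity.
Qed.

Lemma cg_mul r a b x y : cg (ev w m r a) x -> cg (ev w m r b) y ->
  cg (ev w m r (a * b)%exp) (x * y).
Proof.
  intros Hx Hy. apply trunc_cg. rewrite N2Z.inj_mul, Zmult_mod, Hx, Hy, <- Zmult_mod. reflexivity.
Qed.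

(** The subtrahend must be bounded because [x + 2 ^ w - y] is a truncated subtraction of
    naturals. *)
Lemma cg_sub r a b x y : ev w m r b < W -> cg (ev w m r a) x -> cg (ev w m r b) y ->
  cg (ev w m r (a - b)%exp) (x - y).
Proof.
  intros Hb Hx Hy.
  change (ev w m r (a - b)%exp) with (trunc w (ev w m r a + W - ev w m r b)). apply trunc_cg.
  rewrite N2Z.inj_sub, N2Z.inj_add by lia.
  replace (Z.of_N (ev w m r a) + Z.of_N W - Z.of_N (ev w m r b))%Z
    with (Z.of_N (ev w m r a) - Z.of_N (ev w m r b) + 1 * Z.of_N W)%Z by ring.
  rewrite Z.mod_add by (pose proof W_pos; lia).
  rewrite Zminus_mod, Hx, Hy, <- Zminus_mod. reflexivity.
Qed.

Lemma trunc_lt x : trunc w x < W.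
Proof. apply N.mod_lt. pose proof W_pos. unfold W in *. lia. Qed.

Lemma cg_val x z X : cg x z -> x < W -> z = Z.of_N X -> X < W -> x = X.
Proof.
  intros H Hx -> HX. unfold cg in H. rewrite !Z.mod_small in H by lia. lia.
Qed.

Lemma ev_add_lt r a b : ev w m r (a + b)%exp < W.
Proof. apply trunc_lt. Qed.
Lemma ev_sub_lt r a b : ev w m r (a - b)%exp < W.
Proof. apply trunc_lt. Qed.
Lemma ev_mul_lt r a b : ev w m r (a * b)%exp < W.
Proof. apply trunc_lt. Qed.

Variable nh : N.
Hypothesis Hh : forall j, j < nh -> hv j < W /\ a0 + (j + 1) < W /\ m (a0 + (j + 1)) = hv j.

Lemma ev_cst r c : c < W -> ev w m r (Cst c) = c.
Proof. intros H. cbn [ev]. apply N.mod_small. exact H. Qed.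

Lemma ev_par r j : r 0%nat = a0 -> j < nh -> ev w m r (par j) = hv j.
Proof.
  intros Hr Hj. destruct (Hh j Hj) as (H1 & H2 & <-).
  unfold par. cbn [ev eval_binop]. rewrite Hr. unfold trunc. fold W.
  rewrite (N.mod_small (j + 1)), N.mod_small; lia.
Qed.

(** The bound on addresses also bounds the indices, which is how the computed table indices are seen
    not to overflow. *)
Definition is_array (j len : N) (A : N -> N) : Prop :=
  j < nh /\ forall i, i < len -> hv j + i < W /\ m (hv j + i) = A i.

Lemma ev_arr r j len A e i : r 0%nat = a0 -> is_array j len A ->
  ev w m r e = i -> i < len -> ev w m r (arr j e) = A i.
Proof.
  intros Hr [Hj HA] He Hi. destruct (HA i Hi) as [H1 H2].
  unfold arr. cbn [ev eval_binop]. rewrite ev_par, He by assumption.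
  unfold trunc. fold W. rewrite N.mod_small; assumption.
Qed.

Variables (g bias nb D nch len : N) (u : N) (E : N -> Z).
Variables (phi : N -> N -> Z) (mpos : N -> N).
Let s := g * g.
Let zs := zsize g.
Let win v := window w m s (mpos v).

(** [bias] exceeds [zs 6 + D] because a target is at most [D] below the walk at the starting
    position, which differs by less than [zs 6] from the walk at the start of its node. *)
Record params_ok : Prop := {
  ok_nh : hw u 31 < nh;
  ok_w : hv h_w = N.of_nat w;
  ok_g : hv h_g = g;
  ok_s : hv h_s = s;
  ok_2s : hv h_2s = 2 ^ s;
  ok_2g : hv h_2g = 2 ^ g;
  ok_bias : hv h_bias = bias;
  ok_D : hv h_D = D;
  ok_nb : hv h_nb = nb;
  ok_nch : hv h_nch = nch;
  ok_g2 : 2 <= g;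
  ok_wpos : 0 < N.of_nat w;
  ok_D_pos : 0 < D;
  ok_bias_large : zs 6 + D < bias;
  ok_bias_small : 2 * bias <= 2 ^ g;
  ok_nb_lt : nb + 1 < W;
  ok_len : len = nb * zs 6;
  ok_len_lt : len <= W;
  ok_nch_large : zs 6 / D + 2 <= nch
}.

(** All that the program needs of a walk: [mpos] says which micro block of the memory to read, and
    [phi] turns its bits into displacements. Downward, upward and backward search are instances. *)
Record walk_ok : Prop := {
  wk_steps : unit_steps E len;
  wk_range : forall x, x < len -> (0 <= E x < Z.of_N W)%Z;
  wk_pos : forall v, v * s + s <= len -> mpos v * s + s <= len /\
    cg (hv (hw u w_alpha) + hv (hw u w_beta) * v) (Z.of_N (mpos v));
  wk_phi : forall v c, v * s + s <= len -> c < s ->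
    E (v * s + c) = (E (v * s) + phi (win v) c)%Z;
  wk_micro : is_array (hw u w_micro) (2 ^ s * (s + 1) * 2 ^ g) (micro_table g bias phi);
  wk_phitab : is_array (hw u w_phi) (2 ^ s * s)
     (fun i => Z.to_N (phi (i / s) (i mod s) + Z.of_N bias));
  wk_start : is_array (hw u w_start) (nb * g ^ 5) (start_word g bias E);
  wk_field : is_array (hw u w_field) (2 ^ s * (g + 1) * 2 ^ g) (field_table g);
  wk_min : is_array (hw u w_min) nb (fun S => Z.to_N (block_min g E 6 S));
  wk_top : is_array (hw u w_top) (nb * nch)
     (fun i => jump_top (block_min g E 6) nb D (i / nch) (i mod nch));
  wk_slot : is_array (hw u w_slot) (2 * nb * D)
     (fun i => jump_slot (block_min g E 6) nb D (i / D) (i mod D));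
  wk_abs : forall l, (l < 6)%nat -> is_array (hw u (w_abs l)) (nb * g ^ N.of_nat (5 - l))
     (fun v => Z.to_N (E (v * zs (S l))));
  wk_node : forall l, (l < 6)%nat -> is_array (hw u (w_node l)) (nb * g ^ N.of_nat (5 - l))
     (node_word g bias E l)
}.

Hypothesis HP : params_ok.
Hypothesis HW : walk_ok.

Lemma hw_lt j : j <= 31 -> hw u j < nh.
Proof. pose proof (ok_nh HP). unfold hw in *. lia. Qed.

Lemma h_lt j : j < 16 -> j < nh.
Proof. pose proof (ok_nh HP). unfold hw in *. lia. Qed.

Lemma node_count l v : (l <= 6)%nat -> (v * zs l + zs l <= len <-> v < nb * g ^ N.of_nat (6 - l)).
Proof.
  intros Hl. rewrite (ok_len HP).
  pose proof (ok_g2 HP) as H.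
  assert (E6 : zs 6 = zs l * g ^ N.of_nat (6 - l)).
  { unfold zs. clear - Hl.
    destruct l as [|[|[|[|[|[|[|l]]]]]]]; cbn [zsize Nat.sub N.of_nat Pos.of_succ_nat Pos.succ]; try lia;
    rewrite ?N.pow_1_r, ?N.pow_0_r; try ring. }
  rewrite E6. pose proof (zsize_pos g ltac:(clear - H; lia) l) as Hz. fold (zs l) in Hz.
  generalize (g ^ N.of_nat (6 - l)). intros q. split; intros H1; nia.
Qed.

Lemma node_parent l v : (l < 6)%nat -> v * zs l + zs l <= len ->
  v / g * zs (S l) + zs (S l) <= len.
Proof.
  intros Hl Hv. apply node_count in Hv; [|lia]. apply node_count; [lia|].
  pose proof (ok_g2 HP) as H.
  replace (6 - l)%nat with (S (6 - S l))%nat in Hv by lia.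
  rewrite Nat2N.inj_succ, N.pow_succ_r' in Hv.
  apply N.Div0.div_lt_upper_bound.
  revert Hv. generalize (g ^ N.of_nat (6 - S l)). intros; nia.
Qed.

Lemma g_pos : 0 < g.
Proof. pose proof (ok_g2 HP). lia. Qed.

Lemma s_pos : 4 <= s.
Proof. pose proof (ok_g2 HP). unfold s. nia. Qed.

Lemma zs_pos l : 0 < zs l.
Proof. apply zsize_pos, g_pos. Qed.

Lemma len_le : len <= W.
Proof. exact (ok_len_lt HP). Qed.

Definition keep (k : nat) (r r' : nat -> N) : Prop := forall x, (x < k)%nat -> r' x = r x.

Lemma keep_set k r x v : (k <= x)%nat -> keep k r (set_reg r x v).
Proof using. clear. intros H y Hy. apply set_reg_neq. lia. Qed.

Lemma keep_trans k r1 r2 r3 : keep k r1 r2 -> keep k r2 r3 -> keep k r1 r3.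
Proof using. clear. intros H1 H2 x Hx. now rewrite H2, H1. Qed.

Lemma keep_le k k' r r' : (k <= k')%nat -> keep k' r r' -> keep k r r'.
Proof using. clear. intros H H1 x Hx. apply H1. lia. Qed.

Lemma win_lt v : win v < 2 ^ s.
Proof. apply N.mod_lt. pose proof (pow2_pos s). lia. Qed.

Lemma p_window_ok r v : r 0%nat = a0 -> r 6%nat = v -> v * s + s <= len ->
  let r' := run w m (p_window u) r in r' 12%nat = win v /\ keep 12 r r'.
Proof.
  intros R0 R6 Hv. cbv zeta. unfold p_window. rewrite !run_Sq, !run_Asg.
  pose proof s_pos as Hs. pose proof len_le as Hlen.
  destruct (wk_pos HW v Hv) as [Hp Hc]. set (p := mpos v * s) in *.
  assert (V1 : ev w m r ((par (hw u w_alpha) + par (hw u w_beta) * Va 6) * par h_s)%exp = p).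
  { eapply cg_val; [| apply ev_mul_lt | |].
    - apply cg_mul.
      (* For the backward walk the slope is [W - 1], so the position is known only up to congruence
         before the final reduction. *)
      + instantiate (1 := Z.of_N (mpos v)).
        unfold cg. rewrite <- Hc. fold (cg (ev w m r (par (hw u w_alpha) + par (hw u w_beta) * Va 6)%exp)
          (Z.of_N (hv (hw u w_alpha) + hv (hw u w_beta) * v))).
        rewrite N2Z.inj_add, N2Z.inj_mul. apply cg_add; [|apply cg_mul]; apply cg_ev.
        * apply ev_par; auto. apply hw_lt. unfold w_alpha; lia.
        * apply ev_par; auto. apply hw_lt. unfold w_beta; lia.
        * exact R6.
      + apply cg_ev. apply ev_par; auto. apply h_lt. unfold h_s; lia.
    - rewrite (ok_s HP). unfold p. lia.
    - unfold p. lia. }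
  rewrite V1. set (r1 := set_reg r 12 p).
  assert (K1 : keep 12 r r1) by (apply keep_set; lia).
  assert (V2 : ev w m r1 (Va 12 / par h_w)%exp = p / N.of_nat w).
  { cbn [ev eval_binop]. rewrite (ev_par r1); [|now rewrite K1 by lia|apply h_lt; unfold h_w; lia].
    rewrite (ok_w HP). reflexivity. }
  rewrite V2. set (r2 := set_reg r1 13 (p / N.of_nat w)).
  assert (K2 : keep 12 r r2) by (eapply keep_trans; [exact K1|apply keep_set; lia]).
  assert (V3 : ev w m r2 (Va 12 mod par h_w)%exp = p mod N.of_nat w).
  { cbn [ev eval_binop]. rewrite (ev_par r2); [|now rewrite K2 by lia|apply h_lt; unfold h_w; lia].
    rewrite (ok_w HP). reflexivity. }
  rewrite V3. set (r3 := set_reg r2 14 (p mod N.of_nat w)).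
  assert (K3 : keep 12 r r3) by (eapply keep_trans; [exact K2|apply keep_set; lia]).
  pose proof (ok_wpos HP) as Hw.
  assert (Hb : p mod N.of_nat w < N.of_nat w) by (apply N.mod_lt; lia).
  assert (HwW : N.of_nat w < W) by (unfold W; apply N.pow_gt_lin_r; lia).
  assert (V5 : ev w m r3 (Va 13 + Cst 1)%exp = p / N.of_nat w + 1).
  { eapply cg_val; [| apply ev_add_lt | |].
    - apply cg_add; [apply cg_ev; reflexivity|]. apply cg_ev. apply ev_cst.
      unfold W. apply N.pow_gt_1; lia.
    - rewrite N2Z.inj_add. reflexivity.
    - assert (Hq : p / N.of_nat w <= p) by (apply N.Div0.div_le_upper_bound; clear - Hw; nia).
      assert (p + 4 <= W) by (unfold p in *; lia).
      revert Hq. generalize (p / N.of_nat w). intros; lia. }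
  assert (V6 : ev w m r3 (par h_w - Va 14)%exp = N.of_nat w - p mod N.of_nat w).
  { assert (Hw0 : ev w m r3 (par h_w) = N.of_nat w).
    { rewrite (ev_par r3); [|now rewrite K3 by lia|apply h_lt; unfold h_w; lia]. apply (ok_w HP). }
    eapply cg_val; [| apply ev_sub_lt | |].
    - apply cg_sub.
      + change (p mod N.of_nat w < W). lia.
      + apply cg_ev. exact Hw0.
      + apply cg_ev. reflexivity.
    - rewrite N2Z.inj_sub by lia. reflexivity.
    - lia. }
  split.
  - rewrite set_reg_eq. cbn [ev eval_binop].
    change (ev w m r3 (Va 13 + Cst 1)%exp) with (eval_binop w OpAdd (r3 13%nat) (trunc w 1)) in V5.
    change (ev w m r3 (par h_w - Va 14)%exp) with
      (eval_binop w OpSub (ev w m r3 (par h_w)) (r3 14%nat)) in V6.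
    cbn [eval_binop] in V5, V6. rewrite V5, V6.
    rewrite (ev_par r3); [|now rewrite K3 by lia|apply h_lt; unfold h_2s; lia].
    rewrite (ok_2s HP). reflexivity.
  - eapply keep_trans; [exact K3|apply keep_set; lia].
Qed.
Lemma E_val x : x < len -> Z.of_N (Z.to_N (E x)) = E x /\ Z.to_N (E x) < W.
Proof. intros Hx. pose proof (wk_range HW x Hx). split; lia. Qed.

Lemma steps_len : unit_steps E (nb * zs 6).
Proof. pose proof (wk_steps HW) as H. now rewrite (ok_len HP) in H. Qed.

Lemma bias_6 : zs 6 < bias.
Proof. pose proof (ok_bias_large HP). lia. Qed.

Lemma node_len l v : v * zs l + zs l <= len -> v * zs l + zs l <= nb * zs 6.
Proof. now rewrite (ok_len HP). Qed.

Lemma ev_common j r : r 0%nat = a0 -> j < 16 -> ev w m r (par j) = hv j.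
Proof. intros H0 H. apply ev_par; auto. now apply h_lt. Qed.

Lemma hv_lt j : j < 16 -> hv j < W.
Proof. intros H. apply Hh. now apply h_lt. Qed.

Lemma ev_1 r : ev w m r (Cst 1) = 1.
Proof.
  apply ev_cst. pose proof (ok_wpos HP). unfold W. apply N.pow_gt_1; lia.
Qed.

Lemma p_start_ok r v : r 0%nat = a0 -> r 6%nat = v -> v * s + s <= len ->
  let r' := run w m (p_start u) r in r' 10%nat = Z.to_N (E (v * s)) /\ keep 10 r r'
    /\ r' 12%nat = r 12%nat.
Proof.
  intros R0 R6 Hv. cbv zeta. unfold p_start. rewrite run_Asg. split; [|split].
  2: now apply keep_set. 2: reflexivity.
  rewrite set_reg_eq. pose proof g_pos as Hg.
  assert (Hp := node_parent 0 v ltac:(lia) Hv).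
  assert (Hi : v / g < nb * g ^ 5).
  { apply (node_count 1 (v / g)) in Hp; [exact Hp|lia]. }
  assert (Vg : ev w m r (Va 6 / par h_g)%exp = v / g).
  { cbn [ev eval_binop]. rewrite ev_common by (auto; unfold h_g; lia). now rewrite R6, (ok_g HP). }
  assert (Va1 : ev w m r (arr (hw u (w_abs 0)) (Va 6 / par h_g)) = Z.to_N (E (v / g * zs 1))).
  { exact (ev_arr _ _ _ _ _ _ R0 (wk_abs HW 0 ltac:(lia)) Vg Hi). }
  assert (Va2 : ev w m r (arr (hw u w_start) (Va 6 / par h_g)) = start_word g bias E (v / g)).
  { exact (ev_arr _ _ _ _ _ _ R0 (wk_start HW) Vg Hi). }
  assert (Hmod : v mod g < g) by (apply N.mod_lt; lia).
  assert (Hbits : v = v / g * g + v mod g).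
  { pose proof (N.div_mod v g ltac:(lia)). lia. }
  assert (Vm : ev w m r (par h_g * (Va 6 mod par h_g))%exp = g * (v mod g)).
  { eapply cg_val; [apply cg_mul; apply cg_ev|apply ev_mul_lt| |].
    - apply ev_common; auto. unfold h_g; lia.
    - cbn [ev eval_binop]. rewrite ev_common by (auto; unfold h_g; lia). rewrite R6. reflexivity.
    - rewrite N2Z.inj_mul, (ok_g HP). reflexivity.
    - assert (g * (v mod g) < s) by (unfold s; apply N.mul_lt_mono_pos_l; lia).
      pose proof len_le. lia. }
  assert (Vf : ev w m r (Bin OpShr (arr (hw u w_start) (Va 6 / par h_g))
                (par h_g * (Va 6 mod par h_g)) mod par h_2g)%exp
               = field g (start_word g bias E (v / g)) (v mod g)).
  { change (N.shiftr (ev w m r (arr (hw u w_start) (Va 6 / par h_g)))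
      (ev w m r (par h_g * (Va 6 mod par h_g))%exp) mod ev w m r (par h_2g) =
      field g (start_word g bias E (v / g)) (v mod g)).
    rewrite Va2, Vm, ev_common, (ok_2g HP) by (auto; unfold h_2g; lia). reflexivity. }
  assert (Hf := start_word_field g bias nb E Hg steps_len bias_6 (ok_bias_small HP)
    (v / g) (v mod g) (node_len 1 _ Hp) Hmod).
  rewrite <- Hbits in Hf.
  assert (Hx1 : v / g * zs 1 < len) by (pose proof (zs_pos 1); lia).
  assert (Hx0 : v * s < len) by (pose proof s_pos; lia).
  destruct (E_val _ Hx1) as [E1 L1]. destruct (E_val _ Hx0) as [E0 L0].
  eapply cg_val; [| apply ev_sub_lt | | exact L0].
  - apply cg_sub; [| apply cg_add | ]; try apply cg_ev.
    + rewrite ev_common by (auto; unfold h_bias; lia). apply hv_lt. unfold h_bias; lia.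
    + exact Va1.
    + exact Vf.
    + apply ev_common; auto. unfold h_bias; lia.
  - rewrite Hf, E0, E1, (ok_bias HP).
    change (zsize g 0) with s. change (zsize g 1) with (zs 1). ring.
Qed.

Lemma ev_table_index r p q o k e P Q O K Ee kap :
  r 0%nat = a0 -> ev w m r p = P -> ev w m r q = Q -> ev w m r o = O -> ev w m r k = K ->
  ev w m r e = Ee -> Ee < W -> (Z.of_N kap = Z.of_N K + Z.of_N bias - Z.of_N Ee)%Z ->
  (P * (Q + 1) + O) * 2 ^ g + kap < W ->
  ev w m r (table_index p q o k e) = (P * (Q + 1) + O) * 2 ^ g + kap.
Proof.
  intros R0 HPp HQ HO HK He HeW Hkap HX. unfold table_index.
  eapply cg_val; [| apply ev_add_lt | | exact HX].
  - apply cg_add; [apply cg_mul; [apply cg_add; [apply cg_mul; [|apply cg_add]|]|]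
                  |apply cg_sub; [|apply cg_add|]]; try apply cg_ev; try eassumption.
    + apply ev_1.
    + apply ev_common; auto. unfold h_2g; lia.
    + now rewrite He.
    + apply ev_common; auto. unfold h_bias; lia.
  - rewrite (ok_2g HP), (ok_bias HP), !N2Z.inj_add, !N2Z.inj_mul, !N2Z.inj_add, !N2Z.inj_mul,
      Hkap, !N2Z.inj_add. generalize (Z.of_N (2 ^ g)). intros; ring.
Qed.

Lemma table_index_lt a q o b k t : a < t -> o < q -> k < b -> (a * q + o) * b + k < t * q * b.
Proof.
  clear. intros Ha Ho Hk. assert (H : a * q + o + 1 <= t * q) by nia.
  generalize dependent (a * q + o). intros c Hc. nia.
Qed.

(** The distance between [k] and the start of the node is less than [bias], so the shifted level
    falls in the range below [2 * bias] that the tables cover. *)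
Lemma p_level_ok r l v o k : r 0%nat = a0 -> r 6%nat = v -> r 7%nat = o -> r 5%nat = k ->
  (l <= 6)%nat -> v * zs l + zs l <= len -> o <= fan g l ->
  (Z.abs (Z.of_N k - E (v * zs l)) < Z.of_N bias)%Z ->
  let r' := run w m (p_level u l) r in
  step_result g E l v o (Z.of_N k) (r' 8%nat) /\ keep 8 r r'.
Proof.
  intros R0 R6 R7 R5 Hl Hv Ho Hk. cbv zeta.
  assert (Hx : v * zs l < len) by (pose proof (zs_pos l); lia).
  destruct (E_val _ Hx) as [Ev Lv].
  set (kap := Z.to_N (Z.of_N k + Z.of_N bias - E (v * zs l))).
  assert (Hkap : (Z.of_N kap = Z.of_N k + Z.of_N bias - E (v * zs l))%Z) by lia.
  assert (Hkap2 : kap < 2 ^ g) by (pose proof (ok_bias_small HP); lia).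
  destruct l as [|l]; unfold p_level.
  - rewrite !run_Sq, run_Asg.
    destruct (p_window_ok r v R0 R6 Hv) as [W1 W2].
    set (r1 := run w m (p_window u) r) in *.
    destruct (p_start_ok r1 v ltac:(now rewrite W2 by lia) ltac:(now rewrite W2 by lia) Hv)
      as (S1 & S2 & S3).
    set (r2 := run w m (p_start u) r1) in *.
    assert (K2 : keep 10 r r2) by (eapply keep_trans; [eapply keep_le; [|exact W2]; lia|exact S2]).
    split; [|eapply keep_trans; [eapply keep_le; [|exact K2]; lia|now apply keep_set]].
    rewrite set_reg_eq.
    assert (HX : (win v * (s + 1) + o) * 2 ^ g + kap < 2 ^ s * (s + 1) * 2 ^ g).
    { apply table_index_lt; auto; [apply win_lt|]. cbn [fan] in Ho. unfold s. lia. }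
    assert (R20 : r2 0%nat = a0) by (now rewrite K2 by lia).
    erewrite (ev_arr _ _ _ _ _ _ R20 (wk_micro HW)); [| |exact HX].
    + apply (micro_table_step g bias E phi (win v) v o (Z.of_N k) kap); auto.
      intros c Hc. now apply (wk_phi HW).
    + apply (ev_table_index r2 _ _ _ _ _ (win v) s o k (Z.to_N (E (v * zs 0))) kap).
      * exact R20.
      * cbn [ev]. now rewrite S3.
      * rewrite ev_common by (auto; unfold h_s; lia). apply (ok_s HP).
      * cbn [ev]. now rewrite K2 by lia.
      * cbn [ev]. now rewrite K2 by lia.
      * exact S1.
      * exact Lv.
      * rewrite Ev. exact Hkap.
      * destruct (wk_micro HW) as [_ HA]. destruct (HA _ HX). lia.
  - rewrite run_Asg. split; [|now apply keep_set]. rewrite set_reg_eq.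
    assert (Hi : v < nb * g ^ N.of_nat (5 - l)).
    { apply (node_count (S l) v) in Hv; [|lia]. exact Hv. }
    assert (HX : (node_word g bias E l v * (g + 1) + o) * 2 ^ g + kap < 2 ^ s * (g + 1) * 2 ^ g).
    { apply table_index_lt; auto; [|cbn [fan] in Ho; lia].
      apply (node_word_lt g bias nb E g_pos steps_len bias_6 (ok_bias_small HP));
        [lia|]. apply (node_len (S l)), Hv. }
    erewrite (ev_arr _ _ _ _ _ _ R0 (wk_field HW)); [| |exact HX].
    + apply (field_table_step g bias nb E g_pos steps_len bias_6 (ok_bias_small HP)).
      * lia.
      * apply (node_len (S l)), Hv.
      * exact Ho.
      * exact Hkap2.
      * exact Hkap.
    + apply (ev_table_index r _ _ _ _ _ (node_word g bias E l v) g o k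
               (Z.to_N (E (v * zs (S l)))) kap).
      * exact R0.
      * exact (ev_arr r _ _ _ (Va 6) v R0 (wk_node HW l ltac:(lia)) R6 Hi).
      * rewrite ev_common by (auto; unfold h_g; lia). apply (ok_g HP).
      * exact R7.
      * exact R5.
      * exact (ev_arr r _ _ _ (Va 6) v R0 (wk_abs HW l ltac:(lia)) R6 Hi).
      * exact Lv.
      * rewrite Ev. exact Hkap.
      * destruct (wk_field HW) as [_ HA]. destruct (HA _ HX). lia.
Qed.
(** Minima can only find values at most [k]; [is_next_val] turns this into equality. [Y = len]
    stands for absence. *)
Definition is_next (x : N) (k : Z) (Y : N) : Prop :=
  x < Y <= len /\ (forall y, x < y < Y -> (k < E y)%Z) /\ (Y < len -> (E Y <= k)%Z).

(** Just before [Y] the walk is still above [k], and one step descends by at most 1. *)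
Lemma is_next_val x k Y : (k < E x)%Z -> is_next x k Y -> Y < len -> E Y = k.
Proof.
  intros Hx (H1 & H2 & H3) HY. specialize (H3 HY).
  assert (Hp : (k < E (N.pred Y))%Z).
  { destruct (N.eq_dec (N.pred Y) x) as [->|]; [exact Hx|]. apply H2. lia. }
  pose proof (wk_steps HW (N.pred Y)) as Hs. rewrite N.succ_pred in Hs by lia.
  specialize (Hs HY). lia.
Qed.

(** The children passed over stay above [k], so [Y] is not in them; a child with a value at most [k]
    cannot lie wholly before [Y], the first such position after [x]. *)
Lemma step_next l v o c x k Y : step_result g E l v o k c -> is_next x k Y ->
  x < v * zs l + o * csize g l <= Y -> v * zs l + zs l <= len ->
  (c < fan g l -> v * zs l + c * csize g l <= Y < v * zs l + c * csize g l + csize g l) /\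
  (fan g l <= c -> v * zs l + zs l <= Y).
Proof.
  intros (S1 & S2 & S3) (N1 & N2 & N3) Hx Hv. fold (zs l) in S2, S3.
  pose proof (zsize_fan g l) as Ez. fold (zs l) in Ez.
  assert (Hle : v * zs l + c * csize g l <= v * zs l + zs l).
  { rewrite Ez. apply N.add_le_mono_l, N.mul_le_mono_r. lia. }
  assert (HY : v * zs l + c * csize g l <= Y).
  { destruct (N.le_gt_cases (v * zs l + c * csize g l) Y) as [|H]; auto. exfalso.
    specialize (S2 Y ltac:(lia)). specialize (N3 ltac:(lia)). lia. }
  split.
  - intros Hc. destruct (S3 Hc) as (y & Hy1 & Hy2). split; [exact HY|].
    destruct (N.le_gt_cases Y y) as [|H]; [lia|]. exfalso.
    assert (o * csize g l <= c * csize g l) by (apply N.mul_le_mono_r; lia).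
    specialize (N2 y ltac:(lia)). lia.
  - intros Hc. replace c with (fan g l) in HY by lia. rewrite <- Ez in HY. exact HY.
Qed.

Lemma child_node l v c : c < g -> v * zs (S l) + zs (S l) <= len ->
  (v * g + c) * zs l = v * zs (S l) + c * zs l /\ (v * g + c) * zs l + zs l <= len.
Proof.
  intros Hc Hv. pose proof (child_range g g_pos l v c Hc) as [_ H].
  unfold zs in *. split; [cbn [zsize]; ring|lia].
Qed.

Lemma micro_node x : x < len -> x / s * s + s <= len.
Proof.
  intros Hx. apply (node_count 0); [lia|].
  apply N.Div0.div_lt_upper_bound.
  replace (s * (nb * g ^ N.of_nat (6 - 0))) with len; [exact Hx|].
  rewrite (ok_len HP). change (N.of_nat (6 - 0)) with 6. unfold zs, s. clear. cbn [zsize]. lia.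
Qed.

Lemma ev_child r e q a b : ev w m r e = q -> r 6%nat = a -> r 8%nat = b -> a * q + b < W ->
  ev w m r (Va 6 * e + Va 8)%exp = a * q + b.
Proof.
  intros He R6 R8 HX. eapply cg_val; [| apply ev_add_lt | |exact HX].
  - apply cg_add; [apply cg_mul|]; apply cg_ev; eassumption.
  - rewrite !N2Z.inj_add, !N2Z.inj_mul. reflexivity.
Qed.

(** * One search: climb, jump, descend *)

Section Query.
Variables (x k Y : N).
Hypothesis Hx : x < len.
Hypothesis Hk : (E x - Z.of_N D <= Z.of_N k < E x)%Z.
Hypothesis HY : is_next x (Z.of_N k) Y.

(** For the descent: the node contains [Y], where the walk equals [k]. *)
Lemma near_target l v : (l <= 6)%nat -> v * zs l + zs l <= len ->
  v * zs l <= Y < v * zs l + zs l -> (Z.abs (Z.of_N k - E (v * zs l)) < Z.of_N bias)%Z.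
Proof.
  intros Hl Hv HYv. rewrite <- (is_next_val x (Z.of_N k) Y) by (try apply Hk; auto; lia).
  pose proof (node_dist g nb E g_pos steps_len l v Y (v * zs l) Hl (node_len l v Hv) HYv
    ltac:(pose proof (zs_pos l); unfold zs in *; lia)).
  pose proof (zsize_mono g g_pos l 6 Hl). pose proof bias_6. unfold zs in *. lia.
Qed.

(** For the climb: the node contains [x] only, and the gap of up to [D] between [E x] and [k] has to
    be added. *)
Lemma near_start l v : (l <= 6)%nat -> v * zs l + zs l <= len ->
  v * zs l <= x < v * zs l + zs l -> (Z.abs (Z.of_N k - E (v * zs l)) < Z.of_N bias)%Z.
Proof.
  intros Hl Hv Hxv.
  pose proof (node_dist g nb E g_pos steps_len l v x (v * zs l) Hl (node_len l v Hv) Hxv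
    ltac:(pose proof (zs_pos l); unfold zs in *; lia)).
  pose proof (zsize_mono g g_pos l 6 Hl). pose proof (ok_bias_large HP). unfold zs in *. lia.
Qed.

Lemma p_down_ok l : forall v r, (l <= 6)%nat -> r 0%nat = a0 -> r 5%nat = k -> r 6%nat = v ->
  v * zs l + zs l <= len -> x < v * zs l -> v * zs l <= Y < v * zs l + zs l ->
  let r' := run w m (p_down u l) r in r' 4%nat = Y /\ keep 4 r r'.
Proof.
  induction l as [|l IH]; intros v r Hl R0 R5 R6 Hv Hxv HYv; cbv zeta; cbn [p_down];
    rewrite !run_Sq, !run_Asg, ev_cst by (apply W_pos);
    set (r1 := set_reg r 7 0);
    assert (K1 : keep 7 r r1) by (apply keep_set; lia).
  - destruct (p_level_ok r1 0 v 0 k R0 R6 eq_refl R5 Hl Hv ltac:(lia) (near_target 0 v Hl Hv HYv))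
      as [St K2].
    set (r2 := run w m (p_level u 0) r1) in *.
    destruct (step_next 0 v 0 (r2 8%nat) x (Z.of_N k) Y St HY ltac:(lia) Hv) as [C1 C2].
    (* A failed step would put [Y] beyond the node. *)
    assert (Hc : r2 8%nat < fan g 0).
    { destruct (N.lt_ge_cases (r2 8%nat) (fan g 0)) as [|H]; auto. specialize (C2 H). lia. }
    specialize (C1 Hc). cbn [csize] in C1.
    assert (EY : v * s + r2 8%nat = Y) by (change (zs 0) with s in C1; lia).
    split.
    + rewrite set_reg_eq. rewrite <- EY. apply ev_child.
      * rewrite ev_common; [apply (ok_s HP)|now rewrite K2 by lia|unfold h_s; lia].
      * now rewrite K2 by lia.
      * reflexivity.
      * rewrite EY. pose proof len_le. lia.
    + eapply keep_trans; [eapply keep_le; [|exact K1]; lia|].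
      eapply keep_trans; [eapply keep_le; [|exact K2]; lia|]. apply keep_set; lia.
  - destruct (p_level_ok r1 (S l) v 0 k R0 R6 eq_refl R5 Hl Hv ltac:(lia)
      (near_target (S l) v Hl Hv HYv)) as [St K2].
    set (r2 := run w m (p_level u (S l)) r1) in *.
    destruct (step_next (S l) v 0 (r2 8%nat) x (Z.of_N k) Y St HY ltac:(lia) Hv) as [C1 C2].
    assert (Hc : r2 8%nat < fan g (S l)).
    { destruct (N.lt_ge_cases (r2 8%nat) (fan g (S l))) as [|H]; auto. specialize (C2 H). lia. }
    specialize (C1 Hc). cbn [csize fan] in C1, Hc. fold (zs l) in C1.
    destruct (child_node l v _ Hc Hv) as [E1 L1]. rewrite <- E1 in C1.
    assert (V : ev w m r2 (Va 6 * par h_g + Va 8)%exp = v * g + r2 8%nat).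
    { apply ev_child.
      - rewrite ev_common; [apply (ok_g HP)|now rewrite K2 by lia|unfold h_g; lia].
      - now rewrite K2 by lia.
      - reflexivity.
      - pose proof len_le. pose proof (zs_pos l).
        assert ((v * g + r2 8%nat) * 1 <= (v * g + r2 8%nat) * zs l)
          by (apply N.mul_le_mono_l; lia). lia. }
    rewrite V. set (r3 := set_reg r2 6 _).
    assert (K3 : keep 6 r r3).
    { eapply keep_trans; [eapply keep_le; [|exact K1]; lia|].
      eapply keep_trans; [eapply keep_le; [|exact K2]; lia|]. apply keep_set; lia. }
    destruct (IH (v * g + r2 8%nat) r3) as [I1 I2].
    + lia.
    + now rewrite K3 by lia.
    + now rewrite K3 by lia.
    + reflexivity.
    + exact L1.
    + rewrite E1. lia.
    + exact C1.
    + split; [exact I1|]. eapply keep_trans; [|exact I2]. eapply keep_le; [|exact K3]; lia.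
Qed.

Lemma block_lt a b z : a < b -> a * z + z <= b * z.
Proof using. clear. intros. nia. Qed.

Lemma block_le a b z : a <= b -> a * z <= b * z.
Proof using. clear. apply N.mul_le_mono_r. Qed.

Lemma block_between a b c z y : a * z + z <= y -> b * z <= y < b * z + z -> y < c * z ->
  a < b < c.
Proof using. clear. intros. nia. Qed.

(** 0 is free to report absence, since a position found lies strictly after [x]. *)
Definition answer : N := if Y <? len then Y else 0.

Lemma p_jump_ok S r : r 0%nat = a0 -> r 5%nat = k -> r 6%nat = S ->
  S * zs 6 <= x < S * zs 6 + zs 6 -> S * zs 6 + zs 6 <= Y -> S < nb ->
  let r' := run w m (p_jump u) r in r' 4%nat = answer /\ keep 4 r r'.
Proof.
  intros R0 R5 R6 HxS HYS HS. cbv zeta. unfold p_jump.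
  rewrite run_Sq, run_Asg.
  pose proof (ok_D_pos HP) as HD. pose proof len_le as HlenW.
  assert (Hlen : len = nb * zs 6) by apply (ok_len HP).
  assert (HSv : S * zs 6 + zs 6 <= len) by (rewrite Hlen; now apply block_lt).
  set (mn := block_min g E 6).
  destruct (block_min_spec g E g_pos 6 S) as [B1 (y0 & By & Bv)]. fold mn in B1, Bv.
  fold (zs 6) in B1, By.
  assert (Hy0 : y0 < len) by lia.
  destruct (E_val _ Hy0) as [Ev Lv]. rewrite <- Bv in Ev, Lv.
  assert (Hmn1 : (mn S <= E x)%Z) by (apply B1; lia).
  assert (Hmn2 : (E x - mn S < Z.of_N (zs 6))%Z).
  { rewrite Bv.
    pose proof (node_dist g nb E g_pos steps_len 6 S x y0 ltac:(lia) (node_len 6 S HSv) HxS By).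
    unfold zs. lia. }
  (* Since [mn S <= E x < mn S + zs 6], the offset [d] is at least 0 and less than [zs 6 + D]: the
     table needs [zs 6 / D + 2] chunks per block. *)
  set (d := Z.to_N (Z.of_N k + Z.of_N D - mn S)).
  assert (Hd : (Z.of_N d = Z.of_N k + Z.of_N D - mn S)%Z) by lia.
  assert (Hd2 : d < zs 6 + D) by lia.
  assert (HbW : bias < W).
  { rewrite <- (ok_bias HP). apply hv_lt. unfold h_bias; lia. }
  assert (V1 : ev w m r (Va 5 + par h_D - arr (hw u w_min) (Va 6))%exp = d).
  { assert (Vm : ev w m r (arr (hw u w_min) (Va 6)) = Z.to_N (mn S)).
    { exact (ev_arr r _ _ _ (Va 6) S R0 (wk_min HW) R6 HS). }
    eapply cg_val; [| apply ev_sub_lt | |].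
    - apply cg_sub; [|apply cg_add|]; try apply cg_ev.
      + rewrite Vm. exact Lv.
      + exact R5.
      + apply ev_common; auto. unfold h_D; lia.
      + exact Vm.
    - rewrite (ok_D HP). lia.
    - pose proof (ok_bias_large HP). lia. }
  rewrite V1. set (r1 := set_reg r 7 d).
  assert (K1 : keep 7 r r1) by (apply keep_set; lia).
  rewrite run_Sq, run_Asg.
  assert (Hc : d / D < nch).
  { eapply N.lt_le_trans; [|apply (ok_nch_large HP)].
    assert (d / D <= (zs 6 + D) / D) by (apply N.Div0.div_le_mono; lia).
    replace (zs 6 + D) with (zs 6 + 1 * D) in H by lia. rewrite N.div_add in H by lia. lia. }
  assert (Hi : S * nch + d / D < nb * nch).
  { revert Hc. generalize (d / D). intros q Hc. nia. }
  assert (Vq : ev w m r1 (Va 7 / par h_D)%exp = d / D).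
  { cbn [ev eval_binop]. rewrite ev_common; [|exact R0|unfold h_D; lia]. now rewrite (ok_D HP). }
  assert (Vo : ev w m r1 (Va 7 mod par h_D)%exp = d mod D).
  { cbn [ev eval_binop]. rewrite ev_common; [|exact R0|unfold h_D; lia]. now rewrite (ok_D HP). }
  assert (Vi : ev w m r1 (Va 6 * par h_nch + Va 7 / par h_D)%exp = S * nch + d / D).
  { eapply cg_val; [| apply ev_add_lt | |].
    - apply cg_add; [apply cg_mul|]; apply cg_ev; [exact R6|apply ev_common; auto; unfold h_nch; lia|exact Vq].
    - rewrite (ok_nch HP), N2Z.inj_add, N2Z.inj_mul. reflexivity.
    - destruct (wk_top HW) as [_ HA]. destruct (HA _ Hi). lia. }
  set (t := jump_top mn nb D S (d / D)).
  assert (Vt : ev w m r1 (arr (hw u w_top) (Va 6 * par h_nch + Va 7 / par h_D)%exp) = t).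
  { rewrite (ev_arr r1 _ _ _ _ _ R0 (wk_top HW) Vi Hi). unfold t. f_equal.
    - rewrite N.div_add_l by lia. rewrite N.div_small by exact Hc. apply N.add_0_r.
    - rewrite N.add_comm, N.Div0.mod_add. apply N.mod_small. exact Hc. }
  rewrite Vt. set (r2 := set_reg r1 8 t).
  assert (K2 : keep 7 r r2).
  { eapply keep_trans; [exact K1|]. apply keep_set. lia. }
  rewrite run_Sq.
  assert (Vn : forall r', r' 0%nat = a0 -> ev w m r' (par h_nb) = nb).
  { intros r' H. rewrite ev_common; [apply (ok_nb HP)|exact H|unfold h_nb; lia]. }
  assert (Vn1 : ev w m r2 (par h_nb + Cst 1)%exp = nb + 1).
  { eapply cg_val; [| apply ev_add_lt | |apply (ok_nb_lt HP)].
    - apply cg_add; apply cg_ev; [now apply Vn|apply ev_1].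
    - rewrite N2Z.inj_add. reflexivity. }
  pose proof (jump_lookup mn nb D HD S (Z.of_N k) HS ltac:(lia)) as HJ. cbv zeta in HJ.
  fold d in HJ. fold t in HJ.
  set (T := jump mn nb S (Z.of_N k)) in *.
  set (r3 := run w m (Ifl (Va 8) _ _ _) r2).
  assert (R3 : r3 6%nat = T /\ keep 6 r r3).
  { unfold r3. rewrite run_Ifl, Vn1. change (ev w m r2 (Va 8)) with t.
    destruct (N.ltb_spec t (nb + 1)) as [Ht|Ht].
    - rewrite run_Asg. split; [exact HJ|].
      eapply keep_trans; [eapply keep_le; [|exact K2]; lia|]. apply keep_set; lia.
    - rewrite run_Asg. split.
      + rewrite set_reg_eq, <- HJ.
        assert (Hj : t - (nb + 1) < 2 * nb) by (apply jump_top_index; assumption).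
        assert (Hdm : d mod D < D) by (apply N.mod_lt; lia).
        assert (Hi2 : (t - (nb + 1)) * D + d mod D < 2 * nb * D).
        { revert Hj Hdm. generalize (t - (nb + 1)) (d mod D). clear. intros; nia. }
        assert (Vi2 : ev w m r2 ((Va 8 - (par h_nb + Cst 1)) * par h_D + Va 7 mod par h_D)%exp
           = (t - (nb + 1)) * D + d mod D).
        { eapply cg_val; [| apply ev_add_lt | |].
          - apply cg_add; [apply cg_mul; [apply cg_sub|]|]; try apply cg_ev.
            + rewrite Vn1. apply (ok_nb_lt HP).
            + reflexivity.
            + exact Vn1.
            + apply ev_common; auto. unfold h_D; lia.
            + exact Vo.
          - change (r2 8%nat) with t. rewrite (ok_D HP), (N2Z.inj_add (_ * _)), N2Z.inj_mul, N2Z.inj_sub by exact Ht.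
            reflexivity.
          - destruct (wk_slot HW) as [_ HA]. destruct (HA _ Hi2). lia. }
        rewrite (ev_arr r2 _ _ _ _ _ R0 (wk_slot HW) Vi2 Hi2). f_equal.
        * rewrite N.div_add_l by lia. rewrite N.div_small by exact Hdm. apply N.add_0_r.
        * rewrite N.add_comm, N.Div0.mod_add. apply N.mod_small. exact Hdm.
      + eapply keep_trans; [eapply keep_le; [|exact K2]; lia|]. apply keep_set; lia. }
  destruct R3 as [R36 K3]. rewrite run_Ifl.
  rewrite Vn by (now rewrite K3 by lia). change (ev w m r3 (Va 6)) with (r3 6%nat). rewrite R36.
  destruct (jump_spec mn nb S (Z.of_N k) HS) as (J1 & J2 & J3). fold T in J1, J2, J3.
  destruct HY as (N1 & N2 & N3).
  (* Were [Y] in an earlier block, the minimum of that block would be at most [k] and the jump would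
     have stopped there. *)
  assert (HTY : T * zs 6 <= Y).
  { destruct (N.le_gt_cases (T * zs 6) Y) as [|H]; auto. exfalso.
    set (A := Y / zs 6).
    assert (HA : A * zs 6 <= Y < A * zs 6 + zs 6).
    { pose proof (zs_pos 6). unfold A.
      pose proof (N.div_mod Y (zs 6) ltac:(lia)). pose proof (N.mod_lt Y (zs 6) ltac:(lia)).
      revert H1 H2. generalize (Y / zs 6) (Y mod zs 6). intros; lia. }
    clearbody A.
    assert (HAT : S < A < T) by exact (block_between S A T (zs 6) Y HYS HA H).
    specialize (J2 A HAT). destruct (block_min_spec g E g_pos 6 A) as [B _]. fold mn in B.
    specialize (B Y HA).
    assert (HYl : Y < len) by (pose proof (block_le T nb (zs 6) ltac:(lia)); lia).
    specialize (N3 HYl). lia. }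
  destruct (N.ltb_spec T nb) as [HT|HT].
  - specialize (J3 HT). destruct (block_min_spec g E g_pos 6 T) as [_ (y & Hy & Eyv)].
    fold mn in Eyv. fold (zs 6) in Hy.
    assert (HTv : T * zs 6 + zs 6 <= len) by (rewrite Hlen; now apply block_lt).
    assert (HST : S * zs 6 + zs 6 <= T * zs 6) by (apply block_lt; lia).
    (* Block [T] contains a value at most [k] to the right of [x], so [Y] is no later; with [HTY],
       it lies in block [T]. *)
    assert (HYy : Y <= y).
    { destruct (N.le_gt_cases Y y) as [|H]; auto. exfalso. specialize (N2 y ltac:(lia)). lia. }
    destruct (p_down_ok 6 T r3) as [P1 P2].
    + lia.
    + now rewrite K3 by lia.
    + now rewrite K3 by lia.
    + exact R36.
    + exact HTv.
    + lia.
    + lia.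
    + split.
      * rewrite P1. unfold answer. destruct (N.ltb_spec Y len); [reflexivity|lia].
      * eapply keep_trans; [|exact P2]. eapply keep_le; [|exact K3]; lia.
  - rewrite run_Asg. split.
    + rewrite set_reg_eq, ev_cst by apply W_pos. unfold answer.
      destruct (N.ltb_spec Y len) as [H|H]; [|reflexivity].
      replace T with nb in HTY by lia. rewrite <- Hlen in HTY. lia.
    + eapply keep_trans; [eapply keep_le; [|exact K3]; lia|]. apply keep_set; lia.
Qed.

Lemma p_up_ok n : forall l v r, (n + l = 6)%nat -> r 0%nat = a0 -> r 5%nat = k -> r 6%nat = v ->
  v * zs l + zs l <= len -> v * zs l <= x < v * zs l + zs l -> v * zs l + zs l <= Y ->
  let r' := run w m (p_up u n l) r in r' 4%nat = answer /\ keep 4 r r'.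
Proof.
  induction n as [|n IH]; intros l v r Hn R0 R5 R6 Hv Hxv HYv; cbv zeta; cbn [p_up].
  - assert (l = 6%nat) by lia. subst l. apply (p_jump_ok v r); auto.
    apply (node_count 6 v) in Hv; [|lia]. rewrite N.pow_0_r, N.mul_1_r in Hv. exact Hv.
  - pose proof g_pos as Hg. pose proof len_le as HlenW. pose proof (zs_pos l) as Hz.
    assert (Hmod : v mod g < g) by (apply N.mod_lt; lia).
    assert (Hdm : v = v / g * g + v mod g) by (pose proof (N.div_mod v g ltac:(lia)); lia).
    assert (HvW : v < W).
    { assert (v * 1 <= v * zs l) by (apply N.mul_le_mono_l; lia). lia. }
    pose proof (node_parent l v ltac:(lia) Hv) as Hp.
    rewrite !run_Sq, !run_Asg.
    assert (V1 : ev w m r (Va 6 mod par h_g + Cst 1)%exp = v mod g + 1).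
    { eapply cg_val; [| apply ev_add_lt | |].
      - apply cg_add; apply cg_ev; [|apply ev_1].
        cbn [ev eval_binop]. rewrite ev_common, R6 by (auto; unfold h_g; lia). reflexivity.
      - rewrite (ok_g HP), N2Z.inj_add. reflexivity.
      - assert (g < W) by (rewrite <- (ok_g HP); apply hv_lt; unfold h_g; lia). lia. }
    rewrite V1. set (r1 := set_reg r 7 (v mod g + 1)).
    assert (V2 : ev w m r1 (Va 6 / par h_g)%exp = v / g).
    { cbn [ev eval_binop]. rewrite ev_common by (auto; unfold h_g; lia).
      rewrite (ok_g HP). change (r1 6%nat) with (r 6%nat). now rewrite R6. }
    rewrite V2. set (r2 := set_reg r1 6 (v / g)).
    assert (K2 : keep 6 r r2).
    { eapply keep_trans; apply keep_set; lia. }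
    set (q := v / g) in *. set (c := v mod g) in *. clearbody q c.
    (* Child [c + 1] of the parent begins exactly where the node just searched ends. *)
    assert (Eq : q * zs (S l) + (c + 1) * zs l = v * zs l + zs l).
    { unfold zs. cbn [zsize]. rewrite Hdm. ring. }
    assert (Hxq : q * zs (S l) <= x < q * zs (S l) + zs (S l)).
    { pose proof (child_range g Hg l q c Hmod) as [C1 C2]. rewrite <- Hdm in C1, C2.
      unfold zs in *. lia. }
    destruct (p_level_ok r2 (S l) q (c + 1) k R0 eq_refl eq_refl R5 ltac:(lia) Hp
      ltac:(cbn [fan]; lia) (near_start (S l) q ltac:(lia) Hp Hxq)) as [St K3].
    set (r3 := run w m (p_level u (S l)) r2) in *.
    assert (K03 : keep 6 r r3) by (eapply keep_trans; [exact K2|eapply keep_le; [|exact K3]; lia]).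
    destruct (step_next (S l) q (c + 1) (r3 8%nat) x (Z.of_N k) Y St HY) as [C1 C2].
    { cbn [csize]. fold (zs l). lia. }
    { exact Hp. }
    rewrite run_Ifl, run_Sq, run_Asg.
    assert (Vg : ev w m r3 (par h_g) = g).
    { rewrite ev_common; [apply (ok_g HP)|now rewrite K03 by lia|unfold h_g; lia]. }
    rewrite Vg. change (ev w m r3 (Va 8)) with (r3 8%nat).
    assert (R36 : r3 6%nat = q) by (now rewrite K3 by lia).
    destruct (N.ltb_spec (r3 8%nat) g) as [Hc|Hc].
    + specialize (C1 Hc). cbn [csize] in C1. fold (zs l) in C1.
      destruct (child_node l q _ Hc Hp) as [E1 L1]. rewrite <- E1 in C1.
      assert (V : ev w m r3 (Va 6 * par h_g + Va 8)%exp = q * g + r3 8%nat).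
      { apply ev_child; [exact Vg|exact R36|reflexivity|].
        assert ((q * g + r3 8%nat) * 1 <= (q * g + r3 8%nat) * zs l)
          by (apply N.mul_le_mono_l; lia). lia. }
      rewrite V. set (r4 := set_reg r3 6 _).
      assert (K4 : keep 6 r r4) by (eapply keep_trans; [exact K03|apply keep_set; lia]).
      destruct St as [[Sl _] _].
      assert ((c + 1) * zs l <= r3 8%nat * zs l) by (apply N.mul_le_mono_r; lia).
      destruct (p_down_ok l (q * g + r3 8%nat) r4) as [P1 P2].
      * lia.
      * now rewrite K4 by lia.
      * now rewrite K4 by lia.
      * reflexivity.
      * exact L1.
      * rewrite E1. lia.
      * exact C1.
      * split; [|eapply keep_trans; [|exact P2]; eapply keep_le; [|exact K4]; lia].
        rewrite P1. unfold answer. destruct (N.ltb_spec Y len); [reflexivity|lia].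
    + specialize (C2 Hc).
      destruct (IH (S l) q r3) as [P1 P2].
      * lia.
      * now rewrite K03 by lia.
      * now rewrite K03 by lia.
      * exact R36.
      * exact Hp.
      * exact Hxq.
      * exact C2.
      * split; [exact P1|]. eapply keep_trans; [|exact P2]. eapply keep_le; [|exact K03]; lia.
Qed.

Lemma p_search_ok r : r 0%nat = a0 -> r 4%nat = x -> r 5%nat = k ->
  let r' := run w m (p_search u) r in r' 4%nat = answer /\ keep 4 r r'.
Proof.
  intros R0 R4 R5. cbv zeta. unfold p_search. rewrite !run_Sq, !run_Asg.
  pose proof s_pos as Hs. pose proof len_le as HlenW.
  assert (Hmod : x mod s < s) by (apply N.mod_lt; lia).
  assert (Hdm : x = x / s * s + x mod s) by (pose proof (N.div_mod x s ltac:(lia)); lia).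
  assert (Hsw : s < W) by (rewrite <- (ok_s HP); apply hv_lt; unfold h_s; lia).
  assert (Hv : x / s * s + s <= len) by now apply micro_node.
  assert (V1 : ev w m r (Va 4 / par h_s)%exp = x / s).
  { cbn [ev eval_binop]. rewrite ev_common, R4 by (auto; unfold h_s; lia). now rewrite (ok_s HP). }
  rewrite V1. set (r1 := set_reg r 6 (x / s)).
  assert (V2 : ev w m r1 (Va 4 mod par h_s + Cst 1)%exp = x mod s + 1).
  { eapply cg_val; [| apply ev_add_lt | |].
    - apply cg_add; apply cg_ev; [|apply ev_1].
      cbn [ev eval_binop]. rewrite ev_common by (auto; unfold h_s; lia).
      change (r1 4%nat) with (r 4%nat). rewrite R4. reflexivity.
    - rewrite (ok_s HP), N2Z.inj_add. reflexivity.
    - lia. }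
  rewrite V2. set (r2 := set_reg r1 7 (x mod s + 1)).
  assert (K2 : keep 6 r r2).
  { eapply keep_trans; apply keep_set; lia. }
  set (v := x / s) in *. set (o := x mod s) in *. clearbody v o.
  destruct HY as (N1 & N2 & N3).
  destruct (p_level_ok r2 0 v (o + 1) k R0 eq_refl eq_refl R5 ltac:(lia) Hv
     ltac:(cbn [fan]; fold s; lia)
     (near_start 0 v ltac:(lia) Hv ltac:(change (zs 0) with s; lia))) as [St K3].
  set (r3 := run w m (p_level u 0) r2) in *.
  assert (K03 : keep 6 r r3) by (eapply keep_trans; [exact K2|eapply keep_le; [|exact K3]; lia]).
  destruct (step_next 0 v (o + 1) (r3 8%nat) x (Z.of_N k) Y St HY) as [C1 C2].
  { cbn [csize]. change (zs 0) with s. lia. }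
  { exact Hv. }
  rewrite run_Ifl, run_Asg.
  assert (Vs : ev w m r3 (par h_s) = s).
  { rewrite ev_common; [apply (ok_s HP)|now rewrite K03 by lia|unfold h_s; lia]. }
  rewrite Vs. change (ev w m r3 (Va 8)) with (r3 8%nat).
  assert (R36 : r3 6%nat = v) by (now rewrite K3 by lia).
  change (fan g 0) with s in C1, C2. change (zs 0) with s in C1, C2. cbn [csize] in C1.
  destruct (N.ltb_spec (r3 8%nat) s) as [Hc|Hc].
  - specialize (C1 Hc).
    assert (EY : v * s + r3 8%nat = Y) by lia.
    split; [|eapply keep_trans; [eapply keep_le; [|exact K03]; lia|apply keep_set; lia]].
    rewrite set_reg_eq.
    assert (HYl : Y < len).
    { rewrite <- EY. lia. }
    unfold answer. destruct (N.ltb_spec Y len) as [_|]; [|lia].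
    rewrite <- EY. apply ev_child; [exact Vs|exact R36|reflexivity|]. rewrite EY. lia.
  - specialize (C2 Hc).
    destruct (p_up_ok 6 0 v r3) as [P1 P2].
    + reflexivity.
    + now rewrite K03 by lia.
    + now rewrite K03 by lia.
    + exact R36.
    + exact Hv.
    + change (zs 0) with s. lia.
    + exact C2.
    + split; [exact P1|]. eapply keep_trans; [|exact P2]. eapply keep_le; [|exact K03]; lia.
Qed.

End Query.

Lemma p_excess_ok r x : r 0%nat = a0 -> r 4%nat = x -> x < len ->
  let r' := run w m (p_excess u) r in r' 9%nat = Z.to_N (E x) /\ keep 6 r r'.
Proof.
  intros R0 R4 Hx. cbv zeta. unfold p_excess. rewrite !run_Sq, !run_Asg.
  pose proof s_pos as Hs. pose proof len_le as HlenW.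
  assert (Hmod : x mod s < s) by (apply N.mod_lt; lia).
  assert (Hdm : x = x / s * s + x mod s) by (pose proof (N.div_mod x s ltac:(lia)); lia).
  assert (Hv : x / s * s + s <= len) by now apply micro_node.
  assert (V1 : ev w m r (Va 4 / par h_s)%exp = x / s).
  { cbn [ev eval_binop]. rewrite ev_common, R4 by (auto; unfold h_s; lia). now rewrite (ok_s HP). }
  rewrite V1. set (r1 := set_reg r 6 (x / s)).
  destruct (p_window_ok r1 (x / s) R0 eq_refl Hv) as [W1 W2].
  set (r2 := run w m (p_window u) r1) in *.
  assert (R20 : r2 0%nat = a0) by (now rewrite W2 by lia).
  assert (R26 : r2 6%nat = x / s) by (now rewrite W2 by (clear; lia)).
  destruct (p_start_ok r2 (x / s) R20 R26 Hv) as (S1 & S2 & S3).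
  set (r3 := run w m (p_start u) r2) in *.
  assert (K1 : keep 6 r r1) by (apply keep_set; lia).
  assert (K3 : keep 6 r r3).
  { eapply keep_trans; [exact K1|]. eapply keep_trans; [eapply keep_le; [|exact W2]; lia|].
    eapply keep_le; [|exact S2]; lia. }
  split; [|eapply keep_trans; [exact K3|apply keep_set; lia]].
  rewrite set_reg_eq.
  assert (R30 : r3 0%nat = a0) by (now rewrite K3 by lia).
  assert (Hi : win (x / s) * s + x mod s < 2 ^ s * s).
  { pose proof (win_lt (x / s)). revert H Hmod. generalize (x mod s) (win (x / s)) (2 ^ s).
    clear. intros; nia. }
  assert (Vi : ev w m r3 (Va 12 * par h_s + Va 4 mod par h_s)%exp = win (x / s) * s + x mod s).
  { eapply cg_val; [| apply ev_add_lt | |].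
    - apply cg_add; [apply cg_mul|]; apply cg_ev.
      + cbn [ev]. rewrite S3. exact W1.
      + apply ev_common; auto. unfold h_s; lia.
      + cbn [ev eval_binop]. rewrite ev_common by (auto; unfold h_s; lia).
        rewrite (K3 4%nat) by lia. rewrite R4, (ok_s HP). reflexivity.
    - rewrite (ok_s HP), N2Z.inj_add, N2Z.inj_mul. reflexivity.
    - destruct (wk_phitab HW) as [_ HA]. destruct (HA _ Hi). lia. }
  assert (Hphi := wk_phi HW (x / s) (x mod s) Hv Hmod). rewrite <- Hdm in Hphi.
  assert (Hx0 : x / s * s < len) by (pose proof s_pos; lia).
  destruct (E_val _ Hx) as [Ex Lx]. destruct (E_val _ Hx0) as [E0 L0].
  assert (Hr : x / s * s <= x < x / s * s + s).
  { revert Hdm Hmod. generalize (x / s) (x mod s). clear. intros; lia. }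
  assert (Hr2 : x / s * s <= x / s * s < x / s * s + s).
  { revert Hs. generalize (x / s). clear. intros; lia. }
  (* Ensures that the table entry, the displacement plus [bias], was not cut off at 0 by
     [Z.to_N]. *)
  assert (Hb : (Z.abs (E x - E (x / s * s)) < Z.of_N bias)%Z).
  { pose proof (node_dist g nb E g_pos steps_len 0 (x / s) x (x / s * s) ltac:(lia)
      (node_len 0 _ Hv) Hr Hr2).
    pose proof (zsize_mono g g_pos 0 6 (Nat.le_0_l 6)). pose proof bias_6. unfold zs in *. lia. }
  assert (Vp : ev w m r3 (arr (hw u w_phi) (Va 12 * par h_s + Va 4 mod par h_s)%exp)
    = Z.to_N (phi (win (x / s)) (x mod s) + Z.of_N bias)).
  { rewrite (ev_arr r3 _ _ _ _ _ R30 (wk_phitab HW) Vi Hi).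
    rewrite N.div_add_l by (clear - Hs; lia).
    rewrite (N.div_small (x mod s) s Hmod), N.add_0_r.
    rewrite (N.add_comm (_ * s)), N.Div0.mod_add, (N.mod_small (x mod s) s Hmod). reflexivity. }
  eapply cg_val; [| apply ev_sub_lt | |exact Lx].
  - apply cg_sub; [| apply cg_add |]; try apply cg_ev.
    + rewrite ev_common by (auto; unfold h_bias; lia). apply hv_lt. unfold h_bias; lia.
    + exact S1.
    + exact Vp.
    + apply ev_common; auto. unfold h_bias; lia.
  - rewrite (ok_bias HP), E0, Ex. lia.
Qed.
End Correct.

(** * Bits, words and walks *)

Lemma N_of_bits_testbit l : forall i, N.testbit (N_of_bits l) (N.of_nat i) = nth i l false.
Proof.
  induction l as [|b l IH]; intros i; cbn [N_of_bits].
  - now destruct i.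
  - destruct i as [|i].
    + replace (N.b2n b + 2 * N_of_bits l) with (2 * N_of_bits l + N.b2n b) by lia.
      now rewrite N.testbit_0_r.
    + replace (N.b2n b + 2 * N_of_bits l) with (2 * N_of_bits l + N.b2n b) by lia.
      rewrite Nat2N.inj_succ, N.testbit_succ_r. apply IH.
Qed.

Lemma N_of_bits_lt l : N_of_bits l < 2 ^ N.of_nat (length l).
Proof.
  induction l as [|b l IH]; [cbn; lia|]. cbn [N_of_bits length].
  rewrite Nat2N.inj_succ, N.pow_succ_r'. destruct b; cbn [N.b2n]; lia.
Qed.

Definition bits_of (w : nat) (x : N) : list bool :=
  map (fun i => N.testbit x (N.of_nat i)) (seq 0 w).

Lemma N_of_bits_of w x : N_of_bits (bits_of w x) = trunc w x.
Proof.
  apply N.bits_inj. intros i. rewrite <- (N2Nat.id i), N_of_bits_testbit.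
  unfold trunc, bits_of. destruct (Nat.lt_ge_cases (N.to_nat i) w) as [H|H].
  - rewrite N.mod_pow2_bits_low by lia.
    rewrite nth_indep with (d' := N.testbit x (N.of_nat 0))
      by (rewrite length_map, length_seq; lia).
    rewrite map_nth with (f := fun i => N.testbit x (N.of_nat i)). now rewrite seq_nth by lia.
  - rewrite N.mod_pow2_bits_high by lia.
    apply nth_overflow. rewrite length_map, length_seq. lia.
Qed.

Definition pack_words (w : nat) (L : list N) : list bool := flat_map (bits_of w) L.

Lemma length_bits_of w x : length (bits_of w x) = w.
Proof. unfold bits_of. now rewrite length_map, length_seq. Qed.

Lemma length_pack_words w L : length (pack_words w L) = (length L * w)%nat.
Proof.
  unfold pack_words.
  induction L as [|x L IH]; cbn; [reflexivity|]. now rewrite length_app, length_bits_of, IH.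
Qed.

Lemma packed_word_pack w L : forall i, (i < length L)%nat ->
  packed_word w (pack_words w L) (N.of_nat i) = trunc w (nth i L 0).
Proof.
  unfold packed_word. intros i Hi. rewrite Nat2N.id. rewrite <- N_of_bits_of. f_equal.
  revert i Hi; induction L as [|x L IH]; intros i Hi; cbn [length] in Hi; [lia|].
  unfold pack_words in *. cbn [flat_map]. destruct i as [|i].
  - cbn [Nat.mul skipn nth]. rewrite firstn_app, length_bits_of, Nat.sub_diag.
    cbn [firstn]. rewrite app_nil_r. apply firstn_all2. rewrite length_bits_of. lia.
  - rewrite skipn_app, length_bits_of, skipn_all2 by (rewrite length_bits_of; nia).
    replace (S i * w - w)%nat with (i * w)%nat by nia. cbn [app nth]. apply IH. lia.
Qed.

Lemma packed_word_lt w s a : packed_word w s a < 2 ^ N.of_nat w.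
Proof.
  unfold packed_word. eapply N.lt_le_trans; [apply N_of_bits_lt|].
  apply N.pow_le_mono_r; [lia|]. rewrite length_firstn. lia.
Qed.

Lemma layout_lt w P I a : layout w P I a < 2 ^ N.of_nat w.
Proof. unfold layout. destruct (_ <? _); apply packed_word_lt. Qed.

Lemma layout_index w P L i : (i < length L)%nat ->
  layout w P (pack_words w L) (words w P + N.of_nat i) = trunc w (nth i L 0).
Proof.
  intros Hi. unfold layout. destruct (N.ltb_spec (words w P + N.of_nat i) (words w P)); [lia|].
  replace (words w P + N.of_nat i - words w P) with (N.of_nat i) by lia.
  now apply packed_word_pack.
Qed.

Definition mem_bit (w : nat) (m : N -> N) (p : N) : bool :=
  N.testbit (m (p / N.of_nat w)) (p mod N.of_nat w).

Lemma layout_bit w P I p : (0 < w)%nat -> p < N.of_nat (length P) ->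
  mem_bit w (layout w P I) p = nth (N.to_nat p) P false.
Proof.
  intros Hw Hp. unfold mem_bit, layout.
  pose proof (N.div_mod p (N.of_nat w) ltac:(lia)) as Hdm.
  pose proof (N.mod_lt p (N.of_nat w) ltac:(lia)) as Hm.
  set (a := p / N.of_nat w) in *. set (r := p mod N.of_nat w) in *. clearbody a r.
  assert (Ha : a < words w P).
  { unfold words.
    assert (H : (N.to_nat a < (length P + w - 1) / w)%nat); [|lia].
    apply Nat.lt_le_trans with (S (N.to_nat a)); [lia|].
    apply Nat.div_le_lower_bound; [lia|]. nia. }
  destruct (N.ltb_spec a (words w P)); [|lia].
  unfold packed_word. rewrite <- (N2Nat.id r), N_of_bits_testbit.
  rewrite nth_firstn. destruct (Nat.ltb_spec (N.to_nat r) w); [|lia].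
  rewrite nth_skipn. f_equal. nia.
Qed.

(** As [s <= w], a window meets at most two words, and at each bit one of the two shifted words is
    0. *)
Lemma window_testbit w m s v j : (forall a, m a < 2 ^ N.of_nat w) -> s <= N.of_nat w ->
  j < s -> N.testbit (window w m s v) j = mem_bit w m (v * s + j).
Proof.
  intros Hm Hs Hj. unfold window, mem_bit.
  set (p := v * s). set (W := N.of_nat w) in *.
  assert (HW : 0 < W) by lia.
  rewrite N.mod_pow2_bits_low by exact Hj. rewrite N.lor_spec, N.shiftr_spec'.
  unfold trunc. fold W. rewrite N.mod_pow2_bits_low by lia.
  pose proof (N.div_mod p W ltac:(lia)) as Hdm. pose proof (N.mod_lt p W ltac:(lia)) as Hml.
  set (q := p / W) in *. set (r := p mod W) in *. clearbody q r.
  destruct (N.lt_ge_cases (j + r) W) as [H|H].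
  - replace (p + j) with (q * W + (j + r)) by lia.
    rewrite N.div_add_l, N.div_small, N.add_0_r by lia.
    rewrite (N.add_comm (q * W)), N.Div0.mod_add, N.mod_small by lia.
    rewrite N.shiftl_spec_low by lia. apply Bool.orb_false_r.
  - replace (p + j) with ((q + 1) * W + (j + r - W)) by lia.
    rewrite N.div_add_l, N.div_small, N.add_0_r by lia.
    rewrite (N.add_comm ((q + 1) * W)), N.Div0.mod_add, N.mod_small by lia.
    rewrite N.shiftl_spec_high' by lia.
    replace (j - (W - r)) with (j + r - W) by lia.
    (* The first word has no bits from [w] on. *)
    rewrite <- (N.mod_small (m q) (2 ^ W)) by apply Hm.
    rewrite N.mod_pow2_bits_high by lia. reflexivity.
Qed.

Fixpoint psum_nat (b : N -> bool) (x : nat) : Z :=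
  match x with
  | O => 0%Z
  | S x' => (psum_nat b x' + (if b (N.of_nat x') then 1 else -1))%Z
  end.

Definition psum (b : N -> bool) (x : N) : Z := psum_nat b (N.to_nat x).

Lemma psum_0 b : psum b 0 = 0%Z.
Proof. reflexivity. Qed.

Lemma psum_succ b x : psum b (N.succ x) = (psum b x + (if b x then 1 else -1))%Z.
Proof. unfold psum. rewrite N2Nat.inj_succ. cbn [psum_nat]. now rewrite N2Nat.id. Qed.

Lemma psum_ext b b' x : (forall p, p < x -> b p = b' p) -> psum b x = psum b' x.
Proof.
  induction x as [|x IH] using N.peano_ind; intros H; [reflexivity|].
  rewrite !psum_succ, IH, H by (intros; try apply H; lia). reflexivity.
Qed.

Lemma psum_add b a c : psum b (a + c) = (psum b a + psum (fun j => b (a + j)%N) c)%Z.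
Proof.
  induction c as [|c IH] using N.peano_ind.
  - rewrite N.add_0_r, psum_0. lia.
  - rewrite N.add_succ_r, !psum_succ, IH. lia.
Qed.

Lemma total_excess_app s t : total_excess (s ++ t) = (total_excess s + total_excess t)%Z.
Proof. unfold total_excess. rewrite !count_occ_app. lia. Qed.

Lemma excess_psum P x : (N.to_nat x <= length P)%nat ->
  excess P (N.to_nat x) = psum (fun p => nth (N.to_nat p) P false) x.
Proof.
  induction x as [|x IH] using N.peano_ind; intros H; [reflexivity|].
  rewrite psum_succ, <- IH by lia. unfold excess.
  rewrite N2Nat.inj_succ in *.
  rewrite <- (firstn_skipn (N.to_nat x) (firstn (S (N.to_nat x)) P)), total_excess_app.
  rewrite firstn_firstn, Nat.min_l by lia. f_equal.
  rewrite <- (firstn_skipn (N.to_nat x) P) at 1.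
  rewrite firstn_app, firstn_firstn, length_firstn, Nat.min_r, Nat.min_l by lia.
  replace (S (N.to_nat x) - N.to_nat x)%nat with 1%nat by lia.
  rewrite skipn_app, skipn_all2, length_firstn, Nat.min_l by (rewrite ?length_firstn; lia).
  rewrite Nat.sub_diag. cbn [skipn app].
  rewrite <- (Nat.add_0_r (N.to_nat x)) at 2. rewrite <- nth_skipn.
  destruct (skipn (N.to_nat x) P) as [|b l] eqn:E.
  - apply (f_equal (@length bool)) in E. rewrite length_skipn in E. cbn in E. lia.
  - cbn. now destruct b.
Qed.

Local Open Scope nat_scope.

(** * Matching parentheses *)

Lemma excess_succ P i : i < length P ->
  excess P (S i) = (excess P i + (if nth i P false then 1 else -1))%Z.
Proof.
  intros H.
  rewrite <- (Nat2N.id i), <- N2Nat.inj_succ, !excess_psum by lia.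
  rewrite psum_succ. reflexivity.
Qed.

Lemma excess_0 P : excess P 0 = 0%Z.
Proof. reflexivity. Qed.

Lemma excess_length P : balanced P -> excess P (length P) = 0%Z.
Proof. intros [_ H]. unfold excess. now rewrite firstn_all. Qed.

Lemma excess_le P i : i <= length P -> (excess P i <= Z.of_nat i)%Z.
Proof.
  induction i as [|i IH]; intros H; [reflexivity|].
  rewrite excess_succ by lia. specialize (IH ltac:(lia)). destruct (nth _ _ _); lia.
Qed.

Lemma paren_at_iff P i b : paren_at P i b <->
  position P i /\ excess P i = (excess P (i - 1) + (if b then 1 else -1))%Z.
Proof.
  unfold paren_at. split; intros [Hp H]; split; auto; unfold position in Hp.
  - replace i with (S (i - 1)) at 1 by lia. rewrite excess_succ by lia.
    now rewrite (nth_error_nth _ _ _ H).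
  - replace i with (S (i - 1)) in H at 1 by lia. rewrite excess_succ in H by lia.
    rewrite (nth_error_nth' P false) by lia. f_equal.
    destruct b, (nth (i - 1) P false); auto; lia.
Qed.

Lemma excess_sub P i c a : i + c <= length P -> a <= c ->
  excess (firstn c (skipn i P)) a = (excess P (i + a) - excess P i)%Z.
Proof.
  intros Hc Ha. unfold excess. rewrite firstn_firstn, Nat.min_l by lia.
  rewrite <- (firstn_skipn i (firstn (i + a) P)), total_excess_app, firstn_firstn, Nat.min_l by lia.
  rewrite skipn_firstn_comm. replace (i + a - i) with a by lia. lia.
Qed.

(** [matching] speaks of the balance of a subsequence; this form is a search for a level of the
    excess, which is what the index supports. *)
Definition first_return (P : list bool) (i j : nat) : Prop :=
  i < j <= length P /\ excess P j = (excess P i - 1)%Z /\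
  (forall x, i <= x < j -> (excess P i <= excess P x)%Z).

Lemma first_return_matching P i j : paren_at P i true -> first_return P i j -> matching P i j.
Proof.
  intros Hi (Hj & Ej & Hb). assert (Hpi := Hi). destruct Hpi as [Hpos _]. unfold position in Hpos.
  (* The last step goes down to the new low, so just before it the excess is back at its value at
     [i]: the part between has total 0. *)
  assert (Hprev : excess P (j - 1) = excess P i).
  { pose proof (excess_succ P (j - 1) ltac:(lia)) as H. replace (S (j - 1)) with j in H by lia.
    specialize (Hb (j - 1) ltac:(lia)). destruct (nth _ _ _); lia. }
  split; [exact Hi|]. split; [|split; [lia|split]].
  - apply paren_at_iff. split; [unfold position; lia|]. lia.
  - intros a Ha. rewrite length_firstn, length_skipn in Ha. rewrite excess_sub by lia.
    specialize (Hb (i + a) ltac:(lia)). lia.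
  - pose proof (excess_sub P i (j - i - 1) (j - i - 1) ltac:(lia) ltac:(lia)) as H.
    unfold excess at 1 in H. rewrite firstn_firstn, Nat.min_id in H. rewrite H.
    replace (i + (j - i - 1)) with (j - 1) by lia. lia.
Qed.

Lemma find_seq_first p a n :
  match find p (seq a n) with
  | Some j => a <= j < a + n /\ p j = true /\ (forall x, a <= x < j -> p x = false)
  | None => forall x, a <= x < a + n -> p x = false
  end.
Proof.
  revert a. induction n as [|n IH]; intros a; cbn [seq find]; [intros; lia|].
  destruct (p a) eqn:E.
  - repeat split; auto; try lia.
  - specialize (IH (S a)). destruct (find p (seq (S a) n)) as [j|].
    + destruct IH as (H1 & H2 & H3). repeat split; auto; try lia.
      intros x Hx. destruct (Nat.eq_dec x a) as [->|]; auto. apply H3. lia.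
    + intros x Hx. destruct (Nat.eq_dec x a) as [->|]; auto. apply IH. lia.
Qed.

Lemma next_excess_spec P i k j : i <= length P -> next_excess P i k = j ->
  match j with
  | Some j => i < j <= length P /\ excess P j = k /\ (forall x, i < x < j -> excess P x <> k)
  | None => forall x, i < x <= length P -> excess P x <> k
  end.
Proof.
  intros Hi <-. unfold next_excess.
  pose proof (find_seq_first (fun j => (excess P j =? k)%Z) (S i) (length P - i)) as H.
  destruct (find _ _) as [j|].
  - destruct H as (H1 & H2 & H3). repeat split; try lia.
    intros x Hx. specialize (H3 x ltac:(lia)). lia.
  - intros x Hx. specialize (H x ltac:(lia)). lia.
Qed.

Lemma next_excess_some P i k j : i < j <= length P -> excess P j = k ->
  (forall x, i < x < j -> excess P x <> k) -> next_excess P i k = Some j.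
Proof.
  intros Hj Ej Hb. pose proof (next_excess_spec P i k _ ltac:(lia) eq_refl) as H.
  destruct (next_excess P i k) as [j'|].
  - destruct H as (H1 & H2 & H3). f_equal.
    destruct (Nat.lt_trichotomy j j') as [H|[H|H]]; auto.
    + destruct (H3 j); auto; lia.
    + destruct (Hb j'); auto; lia.
  - destruct (H j); auto; lia.
Qed.

Lemma next_excess_none P i k : i <= length P -> (forall x, i < x <= length P -> excess P x <> k) ->
  next_excess P i k = None.
Proof.
  intros Hi Hb. pose proof (next_excess_spec P i k _ Hi eq_refl) as H.
  destruct (next_excess P i k) as [j'|]; auto. destruct H as (H1 & H2 & H3).
  destruct (Hb j'); auto; lia.
Qed.

(** A discrete intermediate value argument: steps of one unit cannot cross [k] without meeting
    it. *)
Lemma stays_above P i k j : i < length P -> (k < excess P i)%Z ->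
  (forall x, i < x < j -> excess P x <> k) -> j <= S (length P) ->
  forall x, i <= x < j -> (k < excess P x)%Z.
Proof.
  intros Hi Hk Hb Hj x Hx. induction x as [|x IH].
  - replace i with 0 in Hk by lia. exact Hk.
  - destruct (Nat.eq_dec i (S x)) as [<-|]; auto.
    specialize (IH ltac:(lia)). specialize (Hb (S x) ltac:(lia)).
    rewrite excess_succ in * by lia. destruct (nth _ _ _); lia.
Qed.

Definition close_pos (P : list bool) (i : nat) : nat :=
  match next_excess P i (excess P i - 1) with Some j => j | None => 0 end.

(** After an open parenthesis the excess is at least 1, and it ends at 0, so the level just below is
    met again. *)
Lemma close_pos_ok P i : balanced P -> paren_at P i true -> first_return P i (close_pos P i).
Proof.
  intros HP Hi. apply paren_at_iff in Hi as [Hpos Hi]. unfold position in Hpos.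
  assert (H0 : (0 <= excess P (i - 1))%Z) by (apply HP; lia).
  pose proof (excess_length P HP) as Hend.
  assert (Hlt : i < length P).
  { destruct (Nat.eq_dec i (length P)) as [->|]; lia. }
  unfold close_pos.
  pose proof (next_excess_spec P i (excess P i - 1) _ ltac:(lia) eq_refl) as H.
  destruct (next_excess P i (excess P i - 1)) as [j|].
  - destruct H as (H1 & H2 & H3). split; [exact H1|]. split; [exact H2|].
    intros x Hx. pose proof (stays_above P i (excess P i - 1) j Hlt ltac:(lia) H3 ltac:(lia) x Hx).
    lia.
  - exfalso.
    pose proof (stays_above P i (excess P i - 1) (S (length P)) Hlt ltac:(lia)
      ltac:(intros x Hx; apply H; lia) ltac:(lia) (length P) ltac:(lia)). lia.
Qed.

Lemma first_return_close P i j : first_return P i j -> close_pos P i = j.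
Proof.
  intros (Hj & Ej & Hb). unfold close_pos. rewrite (next_excess_some P i _ j); auto.
  intros x Hx E. specialize (Hb x ltac:(lia)). lia.
Qed.

(** The basis of [open] by backward search: the last earlier position not above the excess at [i]
    sits just before the matching parenthesis. *)
Lemma last_low_matching P p i : paren_at P i false -> p < i ->
  (excess P p <= excess P i)%Z -> (forall x, p < x < i -> (excess P i < excess P x)%Z) ->
  paren_at P (S p) true /\ first_return P (S p) i.
Proof.
  intros Hi Hp Ep Hb. apply paren_at_iff in Hi as [Hpos Hi]. unfold position in Hpos.
  (* Before a closing parenthesis the excess is one higher than at [i]. *)
  assert (Hne : p <> i - 1) by (intros ->; lia).
  assert (Es : excess P (S p) = (excess P p + 1)%Z).
  { specialize (Hb (S p) ltac:(lia)). pose proof (excess_succ P p ltac:(lia)).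
    destruct (nth _ _ _); lia. }
  pose proof (Hb (S p) ltac:(lia)).
  split.
  - apply paren_at_iff. split; [unfold position; lia|].
    replace (S p - 1) with p by lia. exact Es.
  - split; [lia|]. split; [lia|]. intros x Hx. specialize (Hb x ltac:(lia)). lia.
Qed.

(** A backward scan from [i - 1] succeeds at position 0 at the latest, where the excess is 0. *)
Lemma last_low_ex P i : balanced P -> 1 <= i <= length P ->
  exists p, p < i /\ (excess P p <= excess P i)%Z /\
    (forall x, p < x < i -> (excess P i < excess P x)%Z).
Proof.
  intros HP Hi.
  assert (H : forall c, c < i -> (exists p, p < i /\ (excess P p <= excess P i)%Z /\
    (forall x, p < x < i -> (excess P i < excess P x)%Z)) \/
    (forall x, c <= x < i -> (excess P i < excess P x)%Z)).
  { intros c Hc. remember (i - 1 - c) as d. revert c Hc Heqd.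
    induction d as [|d IH]; intros c Hc Ed;
      destruct (Z.le_gt_cases (excess P c) (excess P i)) as [Hle|Hgt].
    - left. exists c. repeat split; auto; intros; lia.
    - right. intros x Hx. now replace x with c by lia.
    - destruct (IH (S c) ltac:(lia) ltac:(lia)) as [H|H]; auto.
      left. exists c. repeat split; auto.
    - destruct (IH (S c) ltac:(lia) ltac:(lia)) as [H|H]; auto.
      right. intros x Hx. destruct (Nat.eq_dec x c) as [->|]; [lia|apply H; lia]. }
  destruct (H 0 ltac:(lia)) as [H1|H1]; auto.
  specialize (H1 0 ltac:(lia)). rewrite excess_0 in H1.
  destruct HP as [HP _]. specialize (HP i ltac:(lia)). lia.
Qed.

(** Defined through [close_pos], so that whatever is found matches by [close_pos_ok];
    [last_low_matching] provides that something is found. *)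
Definition open_pos (P : list bool) (i : nat) : nat :=
  match find (fun j => (nth (j - 1) P false) && (close_pos P j =? i))%bool
          (seq 1 (length P)) with
  | Some j => j
  | None => 0
  end.

Lemma open_pos_ok P i : balanced P -> paren_at P i false -> matching P (open_pos P i) i.
Proof.
  intros HP Hi. assert (Hpos := proj1 Hi). unfold position in Hpos.
  destruct (last_low_ex P i HP Hpos) as (p & Hp & Ep & Hb).
  destruct (last_low_matching P p i Hi Hp Ep Hb) as [Ho Hr].
  unfold open_pos.
  pose proof (find_seq_first (fun j => (nth (j - 1) P false) && (close_pos P j =? i))%bool 1 (length P))
    as H.
  destruct (find _ _) as [j|].
  - destruct H as (H1 & H2 & _). apply andb_prop in H2 as [H2 H3]. apply Nat.eqb_eq in H3.
    assert (Hj : paren_at P j true).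
    { split; [unfold position; lia|]. rewrite (nth_error_nth' P false) by lia. congruence. }
    rewrite <- H3. apply first_return_matching; [exact Hj|]. now apply close_pos_ok.
  - specialize (H (S p) ltac:(destruct Ho as [Ho _]; unfold position in Ho; lia)).
    rewrite (first_return_close _ _ _ Hr), Nat.eqb_refl in H.
    destruct Ho as [_ Ho]. rewrite (nth_error_nth _ _ _ Ho) in H. discriminate.
Qed.

Local Open Scope N_scope.

(** * Finitely many sequences *)

(** [Ifl] being the only test, equality is expressed by an exclusive or below 1. *)
Fixpoint all_equal (c : list (nat * N)) (s1 s2 : stm) : stm :=
  match c with
  | [] => s1
  | (x, v) :: c' => Ifl (Bin OpXor (Va x) (Cst v)) (Cst 1) (all_equal c' s1 s2) s2
  end.

Definition row_matches (r : nat -> N) (c : list (nat * N)) : bool :=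
  forallb (fun xv => r (fst xv) =? snd xv) c.

Lemma lxor_lt_1 a b : (N.lxor a b <? 1) = (a =? b).
Proof.
  destruct (N.eqb_spec a b) as [->|H].
  - now rewrite N.lxor_nilpotent.
  - apply N.ltb_ge. destruct (N.eq_dec (N.lxor a b) 0) as [E|]; [|lia].
    now apply N.lxor_eq in E.
Qed.

Lemma run_all_equal w m c s1 s2 r : (0 < w)%nat ->
  (forall x v, In (x, v) c -> v < 2 ^ N.of_nat w) ->
  run w m (all_equal c s1 s2) r = if row_matches r c then run w m s1 r else run w m s2 r.
Proof.
  intros Hw. induction c as [|[x v] c IH]; intros Hc; [reflexivity|].
  cbn [all_equal row_matches forallb fst snd]. rewrite run_Ifl. cbn [ev eval_binop].
  unfold trunc. rewrite (N.mod_small v) by (apply (Hc x); now left).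
  rewrite N.mod_small by (apply N.pow_gt_1; lia). rewrite lxor_lt_1.
  destruct (r x =? v); [|reflexivity]. apply IH. intros; eapply Hc; right; eassumption.
Qed.

(** The remaining rows are copied into every failing branch. Code size does not matter here, since
    only finitely many [n] are treated in this way. *)
Fixpoint table (rows : list (list (nat * N) * N)) : stm :=
  match rows with
  | [] => Asg 0 (Cst 0)
  | (c, v) :: rows' => all_equal c (Asg 0 (Cst v)) (table rows')
  end.

(** A query without a row yields 0, the code for no answer; so [next_rows] may omit the levels
    outside 0 to [length P], which are never attained. *)
Lemma run_table w m rows r v : (0 < w)%nat -> v < 2 ^ N.of_nat w ->
  (forall c v', In (c, v') rows -> forall x b, In (x, b) c -> b < 2 ^ N.of_nat w) ->
  (forall c v', In (c, v') rows -> row_matches r c = true -> v' = v) ->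
  (v <> 0 -> exists c v', In (c, v') rows /\ row_matches r c = true) ->
  run w m (table rows) r 0%nat = v.
Proof.
  intros Hw Hv. induction rows as [|[c v'] rows IH]; intros Hb Hm Hex; cbn [table].
  - rewrite run_Asg, set_reg_eq. cbn [ev].
    destruct (N.eq_dec v 0) as [->|H]; [apply N.Div0.mod_0_l|].
    destruct (Hex H) as (c & v' & [] & _).
  - rewrite run_all_equal; [|exact Hw|intros x b Hx; eapply Hb; [now left|exact Hx]].
    destruct (row_matches r c) eqn:E.
    + rewrite (Hm c v' (or_introl eq_refl) E). rewrite run_Asg, set_reg_eq.
      now apply N.mod_small.
    + apply IH.
      * intros c' v'' H. apply (Hb c' v''). now right.
      * intros c' v'' H. apply (Hm c' v''). now right.
      * intros H. destruct (Hex H) as (c' & v'' & [Hin|Hin] & Hr).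
        -- congruence.
        -- now exists c', v''.
Qed.

Definition bit_at (w : nat) (p : nat) : expr :=
  Bin OpAnd (Bin OpShr (Ld (Cst (N.of_nat p / N.of_nat w))) (Cst (N.of_nat p mod N.of_nat w)))
    (Cst 1).

(** A decision tree with one leaf for each string of [k] further bits; the word size is hard-wired,
    being fixed once [n] is. *)
Fixpoint read_bits (w : nat) (k : nat) (acc : list bool) (leaf : list bool -> stm) : stm :=
  match k with
  | O => leaf acc
  | S k' => Ifl (bit_at w (length acc)) (Cst 1)
              (read_bits w k' (acc ++ [false]) leaf) (read_bits w k' (acc ++ [true]) leaf)
  end.

Lemma run_read_bits w P I leaf r : (0 < w)%nat -> N.of_nat (length P) < 2 ^ N.of_nat w ->
  forall k acc rest, P = acc ++ rest -> length rest = k ->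
  run w (layout w P I) (read_bits w k acc leaf) r = run w (layout w P I) (leaf P) r.
Proof.
  intros Hw HP. assert (H1 : 1 < 2 ^ N.of_nat w) by (apply N.pow_gt_1; lia).
  induction k as [|k IH]; intros acc rest EP Hl; cbn [read_bits].
  - destruct rest; [|discriminate]. now rewrite EP, app_nil_r.
  - destruct rest as [|b rest]; [discriminate|]. rewrite run_Ifl.
    assert (Hp : N.of_nat (length acc) < N.of_nat (length P)).
    { rewrite EP, length_app. cbn. lia. }
    assert (Ev : ev w (layout w P I) r (bit_at w (length acc)) = N.b2n b).
    { unfold bit_at. cbn [ev eval_binop]. unfold trunc.
      assert (HwW : N.of_nat w < 2 ^ N.of_nat w) by (apply N.pow_gt_lin_r; lia).
      pose proof (N.mod_lt (N.of_nat (length acc)) (N.of_nat w) ltac:(lia)).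
      assert (N.of_nat (length acc) / N.of_nat w <= N.of_nat (length acc)).
      { apply N.Div0.div_le_upper_bound. nia. }
      rewrite (N.mod_small 1), (N.mod_small (_ / _)), (N.mod_small (_ mod _)) by lia.
      rewrite (N.land_ones _ 1 : N.land _ 1 = _). rewrite N.shiftr_div_pow2.
      rewrite <- N.testbit_spec'.
      pose proof (layout_bit w P I _ Hw Hp) as Hb. unfold mem_bit in Hb. rewrite Hb.
      f_equal. rewrite Nat2N.id, EP, app_nth2, Nat.sub_diag by lia. reflexivity. }
    rewrite Ev. cbn [ev]. unfold trunc. rewrite N.mod_small by exact H1.
    assert (EP' : P = (acc ++ [b]) ++ rest) by (now rewrite <- app_assoc).
    cbn in Hl. destruct b; apply (IH _ rest); auto; lia.
Qed.

Definition unary_rows (f : nat -> nat) (len : nat) : list (list (nat * N) * N) :=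
  map (fun i => ([(1%nat, N.of_nat i)], N.of_nat (f i))) (seq 1 len).

Lemma run_unary w m f len i rest r : (0 < w)%nat -> N.of_nat len < 2 ^ N.of_nat w ->
  (1 <= i <= len)%nat -> (f i <= len)%nat -> r = (fun e => nth e (rest :: nat_args i) 0) ->
  Z.of_N (run w m (table (unary_rows f len)) r 0%nat) = Z.of_nat (f i).
Proof.
  intros Hw HW Hi Hf ->.
  rewrite (run_table w m _ _ (N.of_nat (f i))); try lia.
  - intros c v' Hin x b Hx. apply in_map_iff in Hin as (a & E & Ha). apply in_seq in Ha.
    injection E as <- <-. destruct Hx as [Hx|[]]. injection Hx as <- <-. lia.
  - intros c v' Hin Hm. apply in_map_iff in Hin as (a & E & Ha).
    injection E as <- <-. cbn in Hm. rewrite Bool.andb_true_r in Hm. apply N.eqb_eq in Hm.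
    f_equal. f_equal. lia.
  - intros _. exists [(1%nat, N.of_nat i)], (N.of_nat (f i)). split.
    + apply in_map_iff. exists i. split; [reflexivity|]. apply in_seq. lia.
    + cbn. rewrite N.eqb_refl. reflexivity.
Qed.

Definition opt_pos (o : option nat) : nat := match o with Some j => j | None => O end.

Definition next_rows (P : list bool) : list (list (nat * N) * N) :=
  flat_map (fun i => map (fun k =>
      ([(1%nat, N.of_nat i); (2%nat, N.of_nat k); (3%nat, 0)],
       N.of_nat (opt_pos (next_excess P i (Z.of_nat k)))))
    (seq 0 (S (length P)))) (seq 1 (length P)).

Lemma answer_opt o : answer_of_option o = Z.of_nat (opt_pos o).
Proof. now destruct o. Qed.

Lemma run_next w m P i k rest : (0 < w)%nat -> N.of_nat (length P) < 2 ^ N.of_nat w ->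
  balanced P -> (1 <= i <= length P)%nat ->
  Z.of_N (run w m (table (next_rows P)) (fun e => nth e (rest :: nat_int_args i k) 0) 0%nat)
  = answer_of_option (next_excess P i k).
Proof.
  intros Hw HW HP Hi. rewrite answer_opt.
  assert (Hle : forall k, (opt_pos (next_excess P i k) <= length P)%nat).
  { intros k'. pose proof (next_excess_spec P i k' _ ltac:(lia) eq_refl) as H.
    destruct (next_excess P i k'); cbn; lia. }
  rewrite (run_table w m _ _ (N.of_nat (opt_pos (next_excess P i k)))); auto.
  - lia.
  - specialize (Hle k). lia.
  - intros c v' Hin x b Hx. apply in_flat_map in Hin as (a & Ha & Hin).
    apply in_map_iff in Hin as (q & E & Hq). apply in_seq in Ha, Hq.
    injection E as <- <-. destruct Hx as [Hx|[Hx|[Hx|[]]]]; injection Hx as <- <-; lia.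
  - intros c v' Hin Hm. apply in_flat_map in Hin as (a & Ha & Hin).
    apply in_map_iff in Hin as (q & E & Hq).
    injection E as <- <-. cbn in Hm.
    rewrite !Bool.andb_true_iff, !N.eqb_eq in Hm. destruct Hm as (M1 & M2 & M3 & _).
    do 3 f_equal; [lia|]. destruct (Z.ltb_spec k 0); [discriminate M3|]. lia.
  - intros Hne.
    pose proof (next_excess_spec P i k _ ltac:(lia) eq_refl) as H.
    destruct (next_excess P i k) as [j|] eqn:Ej; [|now cbn in Hne].
    destruct H as (H1 & H2 & _).
    assert (Hk : (0 <= k <= Z.of_nat (length P))%Z).
    { rewrite <- H2. split; [apply HP; lia|]. pose proof (excess_le P j ltac:(lia)). lia. }
    eexists _, _. split.
    + apply in_flat_map. exists i. split; [apply in_seq; lia|].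
      apply in_map_iff. exists (Z.to_nat k). split; [reflexivity|]. apply in_seq. lia.
    + cbn. rewrite !Bool.andb_true_iff, !N.eqb_eq. repeat split; try lia.
      destruct (Z.ltb_spec k 0); [lia|reflexivity].
Qed.

(** The first word of the index holds [n]. *)
Fixpoint dispatch (small : nat -> stm) (large : stm) (n0 from : nat) : stm :=
  match n0 with
  | O => large
  | S k => Ifl (Bin OpXor (Ld (Va 0)) (Cst (N.of_nat from))) (Cst 1) (small from)
             (dispatch small large k (S from))
  end.

Lemma run_dispatch w m small large n r : (0 < w)%nat -> N.of_nat n < 2 ^ N.of_nat w ->
  m (r 0%nat) = N.of_nat n -> forall n0 from, (from <= n)%nat ->
  run w m (dispatch small large n0 from) r =
  if (n <? n0 + from)%nat then run w m (small n) r else run w m large r.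
Proof.
  intros Hw Hn Hm. induction n0 as [|k IH]; intros from Hf; cbn [dispatch].
  - destruct (Nat.ltb_spec n (0 + from)); [lia|reflexivity].
  - rewrite run_Ifl. cbn [ev eval_binop]. unfold trunc.
    rewrite (N.mod_small (N.of_nat from)), (N.mod_small 1) by (try apply N.pow_gt_1; lia).
    rewrite Hm, lxor_lt_1.
    destruct (N.eqb_spec (N.of_nat n) (N.of_nat from)) as [E|E].
    + destruct (Nat.ltb_spec n (S k + from)); [|lia]. now replace from with n by lia.
    + rewrite IH by lia. now replace (S k + from)%nat with (k + S from)%nat by lia.
Qed.

(** * The index *)

Definition nseq (len : N) : list N := map N.of_nat (seq 0 (N.to_nat len)).

Lemma length_nseq len : length (nseq len) = N.to_nat len.
Proof. unfold nseq. now rewrite length_map, length_seq. Qed.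

Lemma nth_map_nseq (f : N -> N) len i : i < len -> nth (N.to_nat i) (map f (nseq len)) 0 = f i.
Proof.
  intros Hi. unfold nseq. rewrite map_map.
  rewrite nth_indep with (d' := f (N.of_nat 0)) by (rewrite length_map, length_seq; lia).
  rewrite map_nth with (f := fun x => f (N.of_nat x)). rewrite seq_nth by lia. f_equal; lia.
Qed.

Section Tables.
Variables (tlen : nat -> N) (tval : nat -> N -> N).

Fixpoint toff (t : nat) : N := match t with O => 0 | S t' => toff t' + tlen t' end.

Definition flat_tables (T : nat) : list N :=
  flat_map (fun t => map (tval t) (nseq (tlen t))) (seq 0 T).

Lemma flat_tables_S T : flat_tables (S T) = flat_tables T ++ map (tval T) (nseq (tlen T)).
Proof.
  unfold flat_tables. rewrite seq_S, flat_map_app. cbn [flat_map Nat.add]. now rewrite app_nil_r.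
Qed.

Lemma length_flat_tables T : length (flat_tables T) = N.to_nat (toff T).
Proof.
  induction T as [|T IH]; [reflexivity|].
  rewrite flat_tables_S, length_app, length_map, length_nseq, IH. cbn [toff]. lia.
Qed.

Lemma toff_mono t T : (t <= T)%nat -> toff t <= toff T.
Proof. induction 1; cbn [toff]; lia. Qed.

Lemma nth_flat_tables T t i : (t < T)%nat -> i < tlen t ->
  nth (N.to_nat (toff t + i)) (flat_tables T) 0 = tval t i.
Proof.
  intros Ht Hi. induction T as [|T IH]; [lia|]. rewrite flat_tables_S.
  destruct (Nat.eq_dec t T) as [->|Hne].
  - rewrite app_nth2 by (rewrite length_flat_tables; lia).
    rewrite length_flat_tables.
    replace (N.to_nat (toff T + i) - N.to_nat (toff T))%nat with (N.to_nat i) by lia.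
    now apply nth_map_nseq.
  - rewrite app_nth1.
    + apply IH. lia.
    + rewrite length_flat_tables. pose proof (toff_mono (S t) T ltac:(lia)) as H.
      cbn [toff] in H. lia.
Qed.

End Tables.

(** * The four query programs *)

Definition q_excess : stm :=
  4%nat <- Va 1 ;; p_excess 0 ;; 0%nat <- Va 9 - par h_bias.

Definition q_close : stm :=
  4%nat <- Va 1 ;; p_excess 0 ;; 5%nat <- Va 9 - Cst 1 ;; p_search 0 ;; 0%nat <- Va 4.

(** In the reversed walk 2 the position [p] sits at [len - 1 - p]. The start [len - i] is thus
    position [i - 1], where the excess is one above the target. A result [Y] is the position just
    before the match, so the answer is [len - 1 - Y + 1]. *)
Definition q_open : stm :=
  4%nat <- Va 1 ;; p_excess 0 ;; 5%nat <- Va 9 ;; 4%nat <- par h_len - Va 1 ;; p_search 2 ;;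
  0%nat <- par h_len - Va 4.

(** Negative levels never occur, so they are answered by 0 at once. The search starts at [i + 1]
    because the target may equal the excess at [i], and [p_search] wants a target strictly below the
    walk. Higher targets use the negated walk 1, with the level reflected likewise. The last test
    rejects positions after the end of the sequence. *)
Definition q_next : stm :=
  Ifl (Cst 0) (Va 3) (0%nat <- Cst 0)
    (4%nat <- Va 1 + Cst 1 ;; p_excess 0 ;; 5%nat <- Va 2 + par h_bias ;;
     Ifl (Va 9) (Va 5)
       (5%nat <- par h_n + par h_bias + par h_bias - Va 5 ;; p_search 1)
       (Ifl (Va 5) (Va 9) (p_search 0) Skip) ;;
     Ifl (par h_2n) (Va 4) (0%nat <- Cst 0) (0%nat <- Va 4)).

(** * The index of a long sequence *)

Section Index.
Variables (w n lga : nat) (P : list bool).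
Let W := 2 ^ N.of_nat w.
Let nn := N.of_nat n.
Definition par_g : N := 2 ^ N.of_nat lga.
Let g := par_g.
Let s := g * g.
Let B := zsize g 6.
(** The least power of [g] above [B + D], as [B = g ^ 8]. *)
Definition par_bias : N := g ^ 9.
(** [lg n ^ 2] is [O (g ^ 4)]; the fifth factor outgrows the constant. *)
Definition par_D : N := g ^ 5.
Let bias := par_bias.
Let D := par_D.
(** Gives [len >= 2 * nn + 2]: besides positions 0 to [2 * nn], the walk needs [2 * nn + 1], from
    which a search for [next_excess] may start. *)
Definition par_nb : N := (2 * nn + 1) / B + 1.
Let nb := par_nb.
Definition par_nch : N := B / D + 2.
Let nch := par_nch.
Definition par_len : N := nb * B.
Let len := par_len.
Let V := nb * g ^ 6.
Let a0 := words w P.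

Definition tab_len (j : nat) : N :=
  match j with
  | 0%nat | 1%nat => 0
  | 2%nat => 2 ^ s * (s + 1) * 2 ^ g
  | 3%nat => 2 ^ s * s
  | 4%nat => nb * g ^ 5
  | 5%nat => 2 ^ s * (g + 1) * 2 ^ g
  | 6%nat => nb
  | 7%nat => nb * nch
  | 8%nat => 2 * nb * D
  | _ => if (j <? 16)%nat then nb * g ^ N.of_nat (5 - (j - 9))
         else nb * g ^ N.of_nat (5 - (j - 16))
  end.

Definition tlen (t : nat) : N := tab_len (t mod 32).

Definition hdr_len : N := 112.
(** The zero words after the header make every position of the padded sequence
    readable; the bits found there extend the walk beyond the sequence. *)
Definition pre_len : N := 1 + hdr_len + B.
Definition total_words : N := pre_len + toff tlen 96.

Definition hdr (j : N) : N :=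
  if j <? 16 then
    match j with
    | 0 => N.of_nat w | 1 => g | 2 => s | 3 => 2 ^ s | 4 => 2 ^ g | 5 => bias
    | 6 => D | 7 => nb | 8 => nch | 9 => len | 10 => 2 * nn | 11 => nn
    | _ => 0
    end
  else
    let t := N.to_nat (j - 16) in
    match (t mod 32)%nat with
    | 0%nat => if (t / 32 =? 2)%nat then V - 1 else 0
    | 1%nat => if (t / 32 =? 2)%nat then W - 1 else 1
    | _ => a0 + pre_len + toff tlen t
    end.

Definition prefix : list N := nn :: map hdr (nseq hdr_len) ++ repeat 0 (N.to_nat B).

Let m0 := layout w P (pack_words w prefix).
(** The tables are computed from the walk, and the walk extends into the index. To avoid a circle it
    is read from a memory with [prefix] only, which contains every word that the walk reaches. *)
Definition ex (x : N) : Z := psum (mem_bit w m0) x.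

(** By [ex_range] the constants keep all three walks between 0 and [nn + 2 * bias]. *)
Definition walk (u : nat) (x : N) : Z :=
  match u with
  | O => ex x + Z.of_N bias
  | 1%nat => Z.of_N (nn + 2 * bias) - (ex x + Z.of_N bias)
  | _ => ex (len - 1 - x) + Z.of_N bias
  end%Z.

(** In the reversed walk a micro block starts at the last position of its mirror image, hence the
    [s - 1]. *)
Definition walk_phi (u : nat) (p c : N) : Z :=
  match u with
  | O => psum (N.testbit p) c
  | 1%nat => (- psum (N.testbit p) c)%Z
  | _ => (psum (N.testbit p) (s - 1 - c) - psum (N.testbit p) (s - 1))%Z
  end.

Definition walk_pos (u : nat) (v : N) : N := match u with O | 1%nat => v | _ => V - 1 - v end.

Definition tab_val (u j : nat) : N -> N :=
  match j with
  | 2%nat => micro_table g bias (walk_phi u)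
  | 3%nat => fun i => Z.to_N (walk_phi u (i / s) (i mod s) + Z.of_N bias)
  | 4%nat => start_word g bias (walk u)
  | 5%nat => field_table g
  | 6%nat => fun b => Z.to_N (block_min g (walk u) 6 b)
  | 7%nat => fun i => jump_top (block_min g (walk u) 6) nb D (i / nch) (i mod nch)
  | 8%nat => fun i => jump_slot (block_min g (walk u) 6) nb D (i / D) (i mod D)
  | _ => if (j <? 16)%nat then fun v => Z.to_N (walk u (v * zsize g (S (j - 9))))
         else node_word g bias (walk u) (j - 16)
  end.

Definition tval (t : nat) : N -> N := tab_val (t / 32) (t mod 32).

Definition index_words : list N := prefix ++ flat_tables tlen tval 96.
Definition index : list bool := pack_words w index_words.
Let m := layout w P index.

Hypothesis Hs : s <= N.of_nat w.
Hypothesis Hlga : (1 <= lga)%nat.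
Hypothesis Hbias : 2 * bias <= 2 ^ g.
Hypothesis Hfit : a0 + total_words < W.
Hypothesis Hn : 2 * nn < W.
Hypothesis Hn2 : nn + 3 * bias < W.
Hypothesis HP : N.of_nat (length P) = 2 * nn.
Hypothesis Hbal : balanced P.

Lemma g2 : 2 <= g.
Proof.
  unfold g, par_g. apply (N.pow_le_mono_r 2 1); lia.
Qed.

Lemma w_pos : (0 < w)%nat.
Proof. pose proof g2. unfold s in Hs. nia. Qed.

Lemma B_val : B = g ^ 8.
Proof. unfold B. clear. cbn [zsize]. lia. Qed.

Lemma B_pow : B = 2 ^ N.of_nat (8 * lga).
Proof. rewrite B_val. unfold g, par_g. rewrite <- N.pow_mul_r. f_equal. lia. Qed.

Lemma B_pos : 0 < B.
Proof. rewrite B_pow. apply pow2_pos. Qed.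

Lemma D_pos : 0 < D.
Proof. unfold D, par_D. pose proof g2. apply N.neq_0_lt_0, N.pow_nonzero. lia. Qed.

Lemma bias_large : B + D < bias.
Proof.
  rewrite B_val. unfold bias, par_bias, D, par_D. pose proof g2 as Hg.
  replace (g ^ 9) with (g * g ^ 3 * g ^ 5) by (clear; lia).
  replace (g ^ 8) with (g ^ 3 * g ^ 5) by (clear; lia).
  assert (H5 : 0 < g ^ 5) by (apply N.neq_0_lt_0, N.pow_nonzero; lia).
  assert (H3 : 8 <= g ^ 3) by (apply (N.pow_le_mono_l 2 g 3); lia).
  revert H5 H3. generalize (g ^ 5) (g ^ 3). intros x y Hx Hy. nia.
Qed.

Lemma lga_le_w : (8 * lga < w)%nat.
Proof.
  assert (H : 2 ^ N.of_nat (8 * lga) < 2 ^ g).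
  { rewrite <- B_pow. pose proof bias_large. lia. }
  apply N.pow_lt_mono_r_iff in H; [|lia].
  pose proof g2. assert (g <= s) by (unfold s; nia). lia.
Qed.

(** [B] is a power of 2 and divides [W], so rounding up to a multiple of [B] does not pass [W]. This
    is why [g] is chosen as a power of 2. *)
Lemma len_le_W : len <= W.
Proof.
  pose proof lga_le_w as Hl. pose proof B_pos as HB.
  unfold len, par_len, nb, par_nb, W.
  replace (N.of_nat w) with (N.of_nat (w - 8 * lga - 1) + 1 + N.of_nat (8 * lga)) by lia.
  rewrite N.pow_add_r, <- B_pow.
  apply N.mul_le_mono_r.
  enough ((2 * nn + 1) / B < 2 ^ (N.of_nat (w - 8 * lga - 1) + 1)) by lia.
  apply N.Div0.div_lt_upper_bound.
  assert (HW : W = 2 * (B * 2 ^ N.of_nat (w - 8 * lga - 1))).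
  { unfold W. rewrite B_pow, <- N.pow_add_r, <- N.pow_succ_r'. f_equal. lia. }
  rewrite N.pow_add_r. change (2 ^ 1) with 2.
  rewrite HW in Hn. revert Hn. generalize (2 ^ N.of_nat (w - 8 * lga - 1)). clear. intros; nia.
Qed.

Lemma len_bounds : 2 * nn + 2 <= len <= 2 * nn + 1 + B.
Proof.
  pose proof B_pos as HB. unfold len, par_len, nb, par_nb.
  pose proof (N.div_mod (2 * nn + 1) B ltac:(lia)) as H1.
  pose proof (N.mod_lt (2 * nn + 1) B ltac:(lia)) as H2.
  revert H1 H2. generalize ((2 * nn + 1) / B) ((2 * nn + 1) mod B). intros; nia.
Qed.

Lemma V_len : V * s = len.
Proof. unfold V, len, par_len, s, B. clear. cbn [zsize]. lia. Qed.

Lemma V_iff v : v * s + s <= len <-> v < V.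
Proof.
  rewrite <- V_len. assert (0 < s) by (pose proof g2; unfold s; nia).
  clear - H. split; intros; nia.
Qed.

Lemma length_prefix : length prefix = N.to_nat pre_len.
Proof.
  unfold prefix, pre_len. cbn [length]. rewrite length_app, length_map, length_nseq, repeat_length.
  lia.
Qed.

Lemma length_index_words : length index_words = N.to_nat total_words.
Proof.
  unfold index_words, total_words. rewrite length_app, length_prefix, length_flat_tables. lia.
Qed.

(** Closes the circle: the bits that the program reads in the final memory are those from which the
    walk was defined. *)
Lemma m_m0 a : a < a0 + pre_len -> m a = m0 a.
Proof.
  intros Ha. destruct (N.lt_ge_cases a a0) as [H|H].
  - unfold m, m0, layout. fold a0. destruct (N.ltb_spec a a0); [reflexivity|lia].
  - replace a with (a0 + N.of_nat (N.to_nat (a - a0))) by lia.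
    unfold m, m0, a0, index.
    rewrite !layout_index; rewrite ?length_index_words, ?length_prefix; unfold total_words; try lia.
    f_equal. unfold index_words. rewrite app_nth1; [reflexivity|].
    rewrite length_prefix. fold a0. lia.
Qed.

Lemma words_ge p : p < len -> p / N.of_nat w + 1 < a0 + pre_len.
Proof.
  intros Hp. pose proof w_pos as Hw. pose proof len_bounds as Hl.
  assert (Ha : 2 * nn < (a0 + 1) * N.of_nat w).
  { unfold a0, words.
    pose proof (Nat.div_mod (length P + w - 1) w ltac:(lia)) as H1.
    pose proof (Nat.mod_upper_bound (length P + w - 1) w ltac:(lia)) as H2.
    revert H1 H2. generalize ((length P + w - 1) / w)%nat ((length P + w - 1) mod w)%nat.
    intros; nia. }
  assert (p / N.of_nat w < a0 + 1 + B + 2).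
  { apply N.Div0.div_lt_upper_bound. nia. }
  unfold pre_len, hdr_len. lia.
Qed.

Lemma window_m v : v * s + s <= len -> forall j, j < s ->
  N.testbit (window w m s v) j = mem_bit w m0 (v * s + j).
Proof.
  intros Hv j Hj. rewrite window_testbit; auto.
  - unfold mem_bit. rewrite m_m0; [reflexivity|].
    assert (H : v * s + j < len) by lia. apply words_ge in H. lia.
  - intros a. apply layout_lt.
Qed.

Lemma ex_window v c : v * s + s <= len -> c < s ->
  ex (v * s + c) = (ex (v * s) + psum (N.testbit (window w m s v)) c)%Z.
Proof.
  intros Hv Hc. unfold ex. rewrite psum_add. f_equal. apply psum_ext.
  intros p Hp. symmetry. apply window_m; [exact Hv|lia].
Qed.

Lemma ex_steps : unit_steps ex len.
Proof. intros x _. unfold ex. rewrite psum_succ. destruct (mem_bit _ _ _); lia. Qed.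

Lemma ex_excess x : x <= 2 * nn -> ex x = excess P (N.to_nat x).
Proof.
  intros Hx. rewrite excess_psum by lia. unfold ex. apply psum_ext.
  intros p Hp. apply layout_bit; [apply w_pos|lia].
Qed.

Lemma ex_end : ex (2 * nn) = 0%Z.
Proof.
  rewrite ex_excess by lia. destruct Hbal as [_ H]. unfold excess.
  rewrite firstn_all2 by lia. exact H.
Qed.

Lemma ex_range x : x < len ->
  (- Z.of_N bias < ex x <= Z.max (Z.of_N nn) (Z.of_N bias))%Z.
Proof.
  intros Hx. pose proof len_bounds as Hl. pose proof bias_large as Hb. pose proof D_pos as HD.
  destruct (N.le_gt_cases x (2 * nn)) as [H|H].
  - pose proof (unit_steps_dist ex len 0 x ex_steps ltac:(lia)) as H1.
    (* The walk is 0 at both ends, so it is at most the distance to the nearer one, hence at most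
       [nn]. *)
    pose proof (unit_steps_dist ex len x (2 * nn) ex_steps ltac:(lia)) as H2.
    rewrite ex_end in H2. change (ex 0) with 0%Z in H1.
    assert (0 <= ex x)%Z.
    { rewrite ex_excess by exact H. apply Hbal. lia. }
    lia.
  - pose proof (unit_steps_dist ex len (2 * nn) x ex_steps ltac:(lia)) as H2.
    rewrite ex_end in H2. lia.
Qed.

Definition hvv (j : N) : N := trunc w (hdr j).

Lemma total_le : pre_len <= total_words.
Proof. unfold total_words. lia. Qed.

Lemma m_word i : i < total_words -> m (a0 + i) = trunc w (nth (N.to_nat i) index_words 0).
Proof.
  intros Hi. unfold m, index, a0. rewrite <- (N2Nat.id i) at 1.
  now rewrite layout_index by (rewrite length_index_words; lia).
Qed.

Lemma m_n : m a0 = nn.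
Proof.
  rewrite <- (N.add_0_r a0), m_word by (unfold total_words, pre_len; lia).
  unfold index_words, prefix. cbn [N.to_nat app nth]. apply N.mod_small. fold W. lia.
Qed.

Lemma hvv_ok j : j < hdr_len ->
  hvv j < W /\ a0 + (j + 1) < W /\ m (a0 + (j + 1)) = hvv j.
Proof.
  intros Hj. pose proof total_le as Ht. unfold pre_len in Ht. split; [|split].
  - apply trunc_lt.
  - lia.
  - rewrite m_word by lia. unfold hvv. f_equal. unfold index_words.
    rewrite app_nth1 by (rewrite length_prefix; unfold pre_len; lia). unfold prefix.
    replace (N.to_nat (j + 1)) with (S (N.to_nat j)) by lia. cbn [nth].
    rewrite app_nth1 by (rewrite length_map, length_nseq; lia). now apply nth_map_nseq.
Qed.

Lemma hdr_walk u j : (u < 3)%nat -> (j < 32)%nat ->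
  hdr (hw (N.of_nat u) (N.of_nat j)) =
  match j with
  | 0%nat => if (u =? 2)%nat then V - 1 else 0
  | 1%nat => if (u =? 2)%nat then W - 1 else 1
  | _ => a0 + pre_len + toff tlen (32 * u + j)
  end.
Proof.
  intros Hu Hj. unfold hdr, hw.
  destruct (N.ltb_spec (16 + 32 * N.of_nat u + N.of_nat j) 16) as [H|_]; [lia|].
  cbv zeta. replace (N.to_nat (16 + 32 * N.of_nat u + N.of_nat j - 16)) with (u * 32 + j)%nat by lia.
  rewrite Nat.div_add_l, (Nat.div_small j), Nat.add_0_r by lia.
  rewrite (Nat.add_comm (u * 32)), Nat.Div0.mod_add, (Nat.mod_small j) by lia.
  now rewrite (Nat.mul_comm 32 u), (Nat.add_comm _ j).
Qed.

Lemma toff_S_le t : (t < 96)%nat -> toff tlen t + tlen t <= toff tlen 96.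
Proof using. clear. intros Ht. exact (toff_mono tlen (S t) 96 Ht). Qed.

Lemma table_ok u j A : (u < 3)%nat -> (2 <= j < 32)%nat ->
  (forall i, i < tab_len j -> tab_val u j i = A i /\ A i < W) ->
  is_array w m hvv hdr_len (hw (N.of_nat u) (N.of_nat j)) (tab_len j) A.
Proof.
  intros Hu Hj HA. unfold is_array. fold W.
  split; [unfold hw, hdr_len; lia|]. intros i Hi. destruct (HA i Hi) as [EA LA].
  set (t := (32 * u + j)%nat).
  assert (Ht : (t mod 32 = j /\ t / 32 = u /\ t < 96)%nat).
  { unfold t. rewrite (Nat.mul_comm 32 u), Nat.div_add_l, (Nat.div_small j), Nat.add_0_r by lia.
    rewrite (Nat.add_comm (u * 32)), Nat.Div0.mod_add, (Nat.mod_small j) by lia. lia. }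
  destruct Ht as (T1 & T2 & T3).
  pose proof (toff_S_le t T3) as Hoff. unfold tlen at 2 in Hoff. rewrite T1 in Hoff.
  assert (Hb : hvv (hw (N.of_nat u) (N.of_nat j)) = a0 + pre_len + toff tlen t).
  { unfold hvv. rewrite hdr_walk by lia.
    destruct j as [|[|j]]; [lia|lia|]. apply N.mod_small. fold W. unfold total_words in Hfit.
    fold t. lia. }
  rewrite Hb. unfold total_words in Hfit. split; [lia|].
  replace (a0 + pre_len + toff tlen t + i) with (a0 + (pre_len + (toff tlen t + i))) by lia.
  rewrite m_word by (unfold total_words; lia).
  unfold index_words. rewrite app_nth2 by (rewrite length_prefix; lia).
  rewrite length_prefix.
  replace (N.to_nat (pre_len + (toff tlen t + i)) - N.to_nat pre_len)%nat
    with (N.to_nat (toff tlen t + i)) by lia.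
  rewrite nth_flat_tables; [|exact T3|unfold tlen; now rewrite T1].
  unfold tval. rewrite T1, T2, EA. apply N.mod_small. exact LA.
Qed.

Lemma nb_pos : 1 <= nb.
Proof. unfold nb, par_nb. apply N.le_add_l. Qed.

Lemma pow_W x : x <= s -> 2 ^ x < W.
Proof.
  intros Hx. unfold W. apply N.pow_lt_mono_r; [lia|].
  pose proof lga_le_w as H. pose proof g2 as Hg.
  (* With [s = w] the table of [2 ^ s * s] entries alone would overflow the memory. *)
  assert (Hsw : s <> N.of_nat w).
  { intros E. pose proof Hfit as HF. unfold total_words in HF.
    pose proof (toff_S_le 3 ltac:(lia)) as Ht.
    change (tlen 3) with (2 ^ s * s) in Ht. rewrite E in Ht. fold W in Ht.
    assert (W <= W * N.of_nat w) by (pose proof w_pos; nia). lia. }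
  lia.
Qed.

Lemma tab_fits j : (2 <= j < 32)%nat -> tab_len j < W.
Proof.
  intros Hj. pose proof (toff_S_le j ltac:(lia)) as Ht.
  unfold tlen in Ht at 2. rewrite Nat.mod_small in Ht by lia.
  unfold total_words in Hfit. lia.
Qed.

Lemma small_params : g < W /\ s < W /\ 2 ^ s < W /\ 2 ^ g < W /\ bias < W /\ D < W /\
  nb + 1 < W /\ nch < W.
Proof.
  pose proof g2 as Hg. pose proof bias_large as Hb. pose proof nb_pos as Hnb.
  assert (Hgs : g <= s) by (unfold s; nia).
  pose proof (pow_W s ltac:(lia)). pose proof (pow_W g Hgs).
  pose proof (N.pow_gt_lin_r 2 s ltac:(lia)).
  pose proof (tab_fits 7 ltac:(lia)) as H7. cbn [tab_len] in H7.
  pose proof (tab_fits 8 ltac:(lia)) as H8. cbn [tab_len] in H8.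
  pose proof D_pos as HD.
  assert (nch <= nb * nch) by nia.
  assert (2 * nb <= 2 * nb * D) by nia.
  repeat split; lia.
Qed.

Lemma params u : (u < 3)%nat ->
  params_ok w hvv hdr_len g bias nb D nch len (N.of_nat u).
Proof.
  intros Hu. destruct small_params as (P1 & P2 & P3 & P4 & P5 & P6 & P7 & P8).
  assert (HwW : N.of_nat w < W) by (apply N.pow_gt_lin_r; lia).
  assert (HnbW : nb < W) by lia.
  constructor; try (apply N.mod_small; assumption).
  - unfold hw, hdr_len. lia.
  - apply g2.
  - pose proof w_pos. lia.
  - apply D_pos.
  - apply bias_large.
  - exact Hbias.
  - exact P7.
  - reflexivity.
  - apply len_le_W.
  - unfold nch, par_nch, B. lia.
Qed.

Lemma walk_steps u : unit_steps (walk u) len.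
Proof.
  intros x Hx. destruct u as [|[|u]]; cbn [walk].
  - pose proof (ex_steps x Hx). lia.
  - pose proof (ex_steps x Hx). lia.
  - pose proof (ex_steps (len - 1 - N.succ x) ltac:(lia)) as H.
    replace (N.succ (len - 1 - N.succ x)) with (len - 1 - x) in H by lia. lia.
Qed.

Lemma walk_range u x : x < len -> (0 <= walk u x <= Z.of_N (nn + 2 * bias))%Z.
Proof.
  intros Hx. destruct u as [|[|u]]; cbn [walk].
  - pose proof (ex_range x Hx). lia.
  - pose proof (ex_range x Hx). lia.
  - pose proof (ex_range (len - 1 - x) ltac:(lia)). lia.
Qed.

Lemma walk_window u v c : v * s + s <= len -> c < s ->
  walk u (v * s + c) =
  (walk u (v * s) + walk_phi u (window w m s (walk_pos u v)) c)%Z.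
Proof.
  intros Hv Hc. destruct u as [|[|u]]; cbn [walk walk_phi walk_pos].
  - rewrite ex_window by assumption. lia.
  - rewrite ex_window by assumption. lia.
  (* Micro block [v] of the reversed walk is micro block [v'] of the memory, read backwards. *)
  - apply V_iff in Hv. set (v' := V - 1 - v).
    assert (Hv' : v' * s + s <= len) by (apply V_iff; lia).
    assert (El : len = v * s + s + v' * s).
    { rewrite <- V_len. replace V with (v + 1 + v') by lia. ring. }
    replace (len - 1 - (v * s + c)) with (v' * s + (s - 1 - c)) by lia.
    replace (len - 1 - v * s) with (v' * s + (s - 1)) by lia.
    rewrite !ex_window by (assumption || lia). lia.
Qed.

Lemma phi_bound u p c : c < s -> (Z.abs (walk_phi u p c) <= Z.of_N s)%Z.
Proof.
  assert (H : forall c, (Z.abs (psum (N.testbit p) c) <= Z.of_N c)%Z).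
  { intros c'. induction c' as [|c' IH] using N.peano_ind; [reflexivity|].
    rewrite psum_succ. destruct (N.testbit p c'); lia. }
  intros Hc. destruct u as [|[|u]]; cbn [walk_phi].
  - specialize (H c). lia.
  - specialize (H c). lia.
  - rewrite <- (N.sub_add c (s - 1)) at 2 by lia.
    rewrite psum_add.
    assert (H' : forall b c, (Z.abs (psum b c) <= Z.of_N c)%Z).
    { intros b c'. induction c' as [|c' IH] using N.peano_ind; [reflexivity|].
      rewrite psum_succ. destruct (b c'); lia. }
    specialize (H' (fun j => N.testbit p (s - 1 - c + j)) c). lia.
Qed.

Lemma tab_len_hi j : (9 <= j)%nat -> tab_len j =
  if (j <? 16)%nat then nb * g ^ N.of_nat (5 - (j - 9)) else nb * g ^ N.of_nat (5 - (j - 16)).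
Proof using. clear. intros Hj. do 9 (destruct j as [|j]; [lia|]). reflexivity. Qed.

Lemma tab_val_hi u j : (9 <= j)%nat -> tab_val u j =
  if (j <? 16)%nat then fun v => Z.to_N (walk u (v * zsize g (S (j - 9))))
  else node_word g bias (walk u) (j - 16).
Proof using. clear. intros Hj. do 9 (destruct j as [|j]; [lia|]). reflexivity. Qed.

Lemma walks u : (u < 3)%nat ->
  walk_ok w m hvv hdr_len g bias nb D nch len (N.of_nat u) (walk u) (walk_phi u) (walk_pos u).
Proof.
  intros Hu. destruct small_params as (P1 & P2 & P3 & P4 & P5 & P6 & P7 & P8).
  pose proof g2 as Hg. assert (Hg0 : 0 < g) by lia.
  pose proof bias_large as HbL. pose proof D_pos as HD.
  assert (HzB : zsize g 6 < bias) by (fold B; lia).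
  pose proof (walk_steps u) as HE.
  assert (Hlen : len = nb * zsize g 6) by reflexivity.
  assert (Hss : zsize g 0 = s) by reflexivity.
  assert (Hnode : forall l v, (l < 6)%nat -> v < nb * g ^ N.of_nat (5 - l) ->
     v * zsize g (S l) + zsize g (S l) <= len).
  { intros l v Hl Hv.
    apply (node_count w hvv hdr_len g bias nb D nch len (N.of_nat u) (params u Hu) (S l)); [lia|].
    exact Hv. }
  assert (HWr : forall x, x < len -> Z.to_N (walk u x) < W).
  { intros x Hx. pose proof (walk_range u x Hx). lia. }
  assert (Hs8 : s <= B).
  { pose proof (zsize_mono g Hg0 0 6 ltac:(lia)). unfold B. rewrite <- Hss. exact H. }
  constructor.
  - exact HE.
  - intros x Hx. pose proof (walk_range u x Hx). fold W. lia.
  - intros v Hv. fold s in Hv |- *. apply V_iff in Hv.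
    change w_alpha with (N.of_nat 0). change w_beta with (N.of_nat 1).
    unfold hvv. rewrite (hdr_walk u 0), (hdr_walk u 1) by lia.
    assert (HVW : V <= W).
    { pose proof len_le_W. rewrite <- V_len in H. assert (0 < s) by (unfold s; nia).
      clear - H H0. nia. }
    destruct u as [|[|[|u]]]; cbn [Nat.eqb walk_pos]; [| |split; [apply V_iff; lia|]|lia].
    1,2: split; [apply V_iff; lia|]; unfold trunc, cg; fold W;
      rewrite (N.mod_small 0), (N.mod_small 1) by lia; f_equal; lia.
    unfold trunc, cg; fold W. rewrite (N.mod_small (V - 1)), (N.mod_small (W - 1)) by lia.
    (* The factor [W - 1] acts as -1. *)
    replace (Z.of_N (V - 1 + (W - 1) * v)) with (Z.of_N (V - 1 - v) + Z.of_N v * Z.of_N W)%Z by nia.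
    apply Z.mod_add. lia.
  - intros v c Hv Hc. now apply walk_window.
  - apply (table_ok u 2); [exact Hu|lia|]. intros i Hi. split; [reflexivity|].
    unfold micro_table. cbv zeta.
    set (q := i / 2 ^ g). fold s.
    assert (Hq : q mod (s + 1) < s + 1) by (apply N.mod_lt; lia).
    match goal with |- first ?p ?a ?k < _ => destruct (first_spec p k a) as (F & _ & _) end.
    lia.
  - apply (table_ok u 3); [exact Hu|lia|]. intros i Hi. split; [reflexivity|].
    fold s.
    assert (Hq : i mod s < s) by (apply N.mod_lt; unfold s; nia).
    pose proof (phi_bound u (i / s) _ Hq). lia.
  - apply (table_ok u 4); [exact Hu|lia|]. intros i Hi. split; [reflexivity|].
    eapply N.lt_trans; [|exact P3].
    apply (start_word_lt g bias nb (walk u) Hg0 HE HzB Hbias).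
    apply (Hnode 0%nat i); [lia|exact Hi].
  - apply (table_ok u 5); [exact Hu|lia|]. intros i Hi. split; [reflexivity|].
    unfold field_table. cbv zeta.
    set (q := i / 2 ^ g).
    assert (Hq : q mod (g + 1) < g + 1) by (apply N.mod_lt; lia).
    match goal with |- first ?p ?a ?k < _ => destruct (first_spec p k a) as (F & _ & _) end.
    lia.
  - apply (table_ok u 6); [exact Hu|lia|]. intros i Hi. split; [reflexivity|].
    destruct (block_min_spec g (walk u) Hg0 6 i) as [_ (y & Hy & ->)].
    apply HWr. rewrite Hlen. cbn [tab_len] in Hi.
    pose proof (block_lt i nb (zsize g 6) Hi). lia.
  - apply (table_ok u 7); [exact Hu|lia|]. intros i Hi. split; [reflexivity|].
    cbn [tab_len] in Hi.
    assert (i / nch < nb) by (apply N.Div0.div_lt_upper_bound; lia).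
    pose proof (jump_top_le (block_min g (walk u) 6) nb D (i / nch) (i mod nch) H).
    pose proof (tab_fits 8 ltac:(lia)) as H8. cbn [tab_len] in H8.
    (* The largest entry is compared with the length of the slot table, which is known to fit in
       memory. *)
    assert (nb + 1 + 2 * nb <= 2 * nb * D + 0).
    { pose proof nb_pos. unfold D, par_D. fold g.
      assert (32 <= g ^ 5) by (apply (N.pow_le_mono_l 2 g 5); lia). nia. }
    lia.
  - apply (table_ok u 8); [exact Hu|lia|]. intros i Hi. split; [reflexivity|].
    cbn [tab_len] in Hi.
    assert (i / D < 2 * nb) by (apply N.Div0.div_lt_upper_bound; lia).
    pose proof (jump_slot_le (block_min g (walk u) 6) nb D (i / D) (i mod D)
      ltac:(pose proof nb_pos; lia) H). lia.
  - intros l Hl. unfold w_abs.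
    replace (9 + N.of_nat l) with (N.of_nat (9 + l)) by lia.
    assert (El : tab_len (9 + l) = nb * g ^ N.of_nat (5 - l)).
    { rewrite tab_len_hi by lia. destruct (Nat.ltb_spec (9 + l) 16); [|lia].
      now replace (9 + l - 9)%nat with l by lia. }
    rewrite <- El. apply (table_ok u (9 + l)); [exact Hu|lia|]. intros i Hi. rewrite El in Hi.
    split.
    + rewrite tab_val_hi by lia. destruct (Nat.ltb_spec (9 + l) 16); [|lia].
      now replace (9 + l - 9)%nat with l by lia.
    + apply HWr. specialize (Hnode l i Hl Hi). pose proof (zsize_pos g Hg0 (S l)). lia.
  - intros l Hl. unfold w_node.
    replace (16 + N.of_nat l) with (N.of_nat (16 + l)) by lia.
    assert (El : tab_len (16 + l) = nb * g ^ N.of_nat (5 - l)).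
    { rewrite tab_len_hi by lia. destruct (Nat.ltb_spec (16 + l) 16); [lia|].
      now replace (16 + l - 16)%nat with l by lia. }
    rewrite <- El. apply (table_ok u (16 + l)); [exact Hu|lia|]. intros i Hi. rewrite El in Hi.
    split.
    + rewrite tab_val_hi by lia. destruct (Nat.ltb_spec (16 + l) 16); [lia|].
      now replace (16 + l - 16)%nat with l by lia.
    + eapply N.lt_trans; [|exact P3].
      apply (node_word_lt g bias nb (walk u) Hg0 HE HzB Hbias); [exact Hl|].
      now apply Hnode.
Qed.

Lemma is_next_ex E x k : x < len -> exists Y, is_next len E x k Y.
Proof using.
  clear. intros Hx.
  destruct (first_spec (fun y => (E y <=? k)%Z) (N.to_nat (len - N.succ x)) (N.succ x))
    as (F1 & F2 & F3).
  exists (first (fun y => (E y <=? k)%Z) (N.succ x) (N.to_nat (len - N.succ x))).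
  split; [lia|]. split.
  - intros y Hy. specialize (F2 y ltac:(lia)). apply Z.leb_gt in F2. exact F2.
  - intros H. apply Z.leb_le. apply F3. lia.
Qed.

Lemma search_ok u r x k Y : (u < 3)%nat -> r 0%nat = a0 -> r 4%nat = x -> r 5%nat = k ->
  x < len -> (walk u x - Z.of_N D <= Z.of_N k < walk u x)%Z ->
  is_next len (walk u) x (Z.of_N k) Y ->
  let r' := run w m (p_search (N.of_nat u)) r in
  r' 4%nat = (if Y <? len then Y else 0) /\ keep 4 r r'.
Proof.
  intros Hu R0 R4 R5 Hx Hk HY.
  exact (p_search_ok w m a0 hvv hdr_len hvv_ok g bias nb D nch len (N.of_nat u) (walk u)
    (walk_phi u) (walk_pos u) (params u Hu) (walks u Hu) x k Y Hx Hk HY r R0 R4 R5).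
Qed.

Lemma excess_ok r x : r 0%nat = a0 -> r 4%nat = x -> x < len ->
  let r' := run w m (p_excess 0) r in r' 9%nat = Z.to_N (ex x + Z.of_N bias) /\ keep 6 r r'.
Proof.
  intros R0 R4 Hx.
  exact (p_excess_ok w m a0 hvv hdr_len hvv_ok g bias nb D nch len 0 (walk 0)
    (walk_phi 0) (walk_pos 0) (params 0 ltac:(lia)) (walks 0 ltac:(lia)) r x R0 R4 Hx).
Qed.

Lemma next_val u x k Y : (u < 3)%nat -> (k < walk u x)%Z -> is_next len (walk u) x k Y ->
  Y < len -> walk u Y = k.
Proof.
  intros Hu Hk HY HYl.
  exact (is_next_val w m hvv hdr_len g bias nb D nch len (N.of_nat u) (walk u)
    (walk_phi u) (walk_pos u) (walks u Hu) x k Y Hk HY HYl).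
Qed.

Lemma hd_val r j : r 0%nat = a0 -> j < 16 -> ev w m r (par j) = hvv j.
Proof.
  intros R0 Hj. apply (ev_par w m a0 hvv hdr_len hvv_ok); [exact R0|unfold hdr_len; lia].
Qed.

Lemma bias_val r : r 0%nat = a0 -> ev w m r (par h_bias) = bias.
Proof.
  intros R0. rewrite hd_val by (assumption || (unfold h_bias; lia)).
  destruct small_params as (_ & _ & _ & _ & H & _). apply N.mod_small. exact H.
Qed.

Lemma ex_pos i : position P i -> (0 <= ex (N.of_nat i) <= Z.of_N nn)%Z /\
  ex (N.of_nat i) = excess P i /\ N.of_nat i <= 2 * nn /\ 1 <= N.of_nat i.
Proof.
  unfold position. intros Hi. pose proof len_bounds.
  assert (E : ex (N.of_nat i) = excess P i) by (rewrite ex_excess by lia; now rewrite Nat2N.id).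
  split; [|lia].
  pose proof (unit_steps_dist ex len 0 (N.of_nat i) ex_steps ltac:(lia)) as H1.
  pose proof (unit_steps_dist ex len (N.of_nat i) (2 * nn) ex_steps ltac:(lia)) as H2.
  rewrite ex_end in H2. change (ex 0) with 0%Z in H1.
  assert (0 <= excess P i)%Z by (apply Hbal; lia). lia.
Qed.

Definition regs (args : list N) : nat -> N := fun e => nth e (words w P :: args) 0.

Lemma q_excess_ok i : position P i ->
  Z.of_N (run w m q_excess (regs (nat_args i)) 0%nat) = excess P i.
Proof.
  intros Hi. destruct (ex_pos i Hi) as (H1 & <- & H2 & H3). pose proof len_bounds as Hl.
  unfold q_excess. rewrite !run_Sq, !run_Asg.
  set (r1 := set_reg (regs (nat_args i)) 4 _).
  destruct (excess_ok r1 (N.of_nat i) eq_refl eq_refl ltac:(lia)) as [Vx Kp].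
  set (r2 := run w m (p_excess 0) r1) in *.
  assert (R0 : r2 0%nat = a0) by (now rewrite Kp by lia).
  rewrite set_reg_eq.
  assert (E : ev w m r2 (Va 9 - par h_bias)%exp = Z.to_N (ex (N.of_nat i))).
  { eapply cg_val; [| apply ev_sub_lt | |].
    - apply cg_sub; try apply cg_ev.
      + rewrite bias_val by exact R0. fold W. lia.
      + exact Vx.
      + now apply bias_val.
    - lia.
    - fold W. lia. }
  rewrite E. lia.
Qed.

Lemma q_close_ok i : paren_at P i true -> exists j, matching P i j /\
  Z.of_N (run w m q_close (regs (nat_args i)) 0%nat) = Z.of_nat j.
Proof.
  intros Hi. assert (Hpos := proj1 Hi).
  destruct (ex_pos i Hpos) as (H1 & H0 & H2 & H3). pose proof len_bounds as Hl.
  pose proof D_pos as HD.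
  pose proof (proj1 (paren_at_iff P i true) Hi) as [_ He]. unfold position in Hpos.
  assert (Hprev : (0 <= excess P (i - 1))%Z) by (apply Hbal; lia).
  assert (Hlt : N.of_nat i < 2 * nn).
  { destruct (N.eq_dec (N.of_nat i) (2 * nn)) as [E|]; [|lia].
    rewrite E, ex_end in H0. lia. }
  unfold q_close. rewrite !run_Sq, !run_Asg.
  set (r1 := set_reg (regs (nat_args i)) 4 _).
  destruct (excess_ok r1 (N.of_nat i) eq_refl eq_refl ltac:(lia)) as [Vx Kp].
  set (r2 := run w m (p_excess 0) r1) in *.
  set (k := Z.to_N (ex (N.of_nat i) + Z.of_N bias - 1)).
  assert (E : ev w m r2 (Va 9 - Cst 1)%exp = k).
  { assert (E1 : ev w m r2 (Cst 1) = 1).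
    { apply N.mod_small. fold W. lia. }
    eapply cg_val; [| apply ev_sub_lt | |].
    - apply cg_sub; try apply cg_ev.
      + rewrite E1. fold W. lia.
      + exact Vx.
      + exact E1.
    - lia.
    - fold W. lia. }
  rewrite E. set (r3 := set_reg r2 5 k).
  assert (Hk : Z.of_N k = (ex (N.of_nat i) + Z.of_N bias - 1)%Z) by lia.
  destruct (is_next_ex (walk 0) (N.of_nat i) (Z.of_N k) ltac:(lia)) as [Y HY].
  destruct (search_ok 0 r3 (N.of_nat i) k Y) as [S1 S2].
  - lia.
  - change (r2 0%nat = a0). now rewrite Kp by lia.
  - change (r2 4%nat = N.of_nat i). now rewrite Kp by lia.
  - reflexivity.
  - lia.
  - cbn [walk]. lia.
  - exact HY.
  - assert (HYv := next_val 0 (N.of_nat i) (Z.of_N k) Y ltac:(lia) ltac:(cbn [walk]; lia) HY).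
    destruct HY as (Y1 & Y2 & Y3). cbn [walk] in HYv, Y2, Y3.
    (* At the end of the sequence the excess is 0, not above the target, so the search cannot pass
       into the padding. *)
    assert (HYn : Y <= 2 * nn).
    { destruct (N.le_gt_cases Y (2 * nn)) as [|H]; auto. specialize (Y2 (2 * nn) ltac:(lia)).
      rewrite ex_end in Y2. lia. }
    specialize (HYv ltac:(lia)).
    exists (N.to_nat Y). split.
    + apply first_return_matching; [exact Hi|].
      split; [lia|]. split.
      * rewrite <- ex_excess by exact HYn. lia.
      * intros x Hx. destruct (Nat.eq_dec x i) as [->|]; [lia|].
        specialize (Y2 (N.of_nat x) ltac:(lia)). rewrite ex_excess, Nat2N.id in Y2 by lia. lia.
    + rewrite set_reg_eq. cbn [ev]. change (p_search 0) with (p_search (N.of_nat 0)).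
      rewrite S1. destruct (N.ltb_spec Y len); lia.
Qed.

Lemma cg_len r : r 0%nat = a0 -> cg w (ev w m r (par h_len)) (Z.of_N len).
Proof.
  intros R0. rewrite hd_val by (assumption || (unfold h_len; lia)).
  apply trunc_cg. reflexivity.
Qed.

Lemma q_open_ok i : paren_at P i false -> exists j, matching P j i /\
  Z.of_N (run w m q_open (regs (nat_args i)) 0%nat) = Z.of_nat j.
Proof.
  intros Hi. assert (Hpos := proj1 Hi).
  destruct (ex_pos i Hpos) as (H1 & H0 & H2 & H3). pose proof len_bounds as Hl.
  pose proof D_pos as HD. pose proof len_le_W as HlW.
  pose proof (proj1 (paren_at_iff P i false) Hi) as [_ He]. unfold position in Hpos.
  assert (Hi2 : (2 <= i)%nat).
  { destruct (Nat.eq_dec i 1) as [->|]; [|lia]. change (excess P (1 - 1)) with 0%Z in He. lia. }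
  assert (Hex : ex (N.of_nat (i - 1)) = excess P (i - 1)).
  { rewrite ex_excess by lia. now rewrite Nat2N.id. }
  unfold q_open. rewrite !run_Sq, !run_Asg.
  set (r1 := set_reg (regs (nat_args i)) 4 _).
  destruct (excess_ok r1 (N.of_nat i) eq_refl eq_refl ltac:(lia)) as [Vx Kp].
  set (r2 := run w m (p_excess 0) r1) in *.
  set (k := Z.to_N (ex (N.of_nat i) + Z.of_N bias)) in *.
  change (ev w m r2 (Va 9)) with (r2 9%nat). rewrite Vx.
  set (r3 := set_reg r2 5 k).
  assert (R30 : r3 0%nat = a0) by (change (r2 0%nat = a0); now rewrite Kp by lia).
  assert (R31 : r3 1%nat = N.of_nat i) by (change (r2 1%nat = N.of_nat i); now rewrite Kp by lia).
  assert (E : ev w m r3 (par h_len - Va 1)%exp = len - N.of_nat i).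
  { eapply cg_val; [| apply ev_sub_lt | |].
    - apply cg_sub; [|now apply cg_len|apply cg_ev; exact R31].
      cbn [ev]. rewrite R31. fold W. lia.
    - lia.
    - fold W. lia. }
  rewrite E. set (x := len - N.of_nat i). set (r4 := set_reg r3 4 x).
  assert (Hk : Z.of_N k = (ex (N.of_nat i) + Z.of_N bias)%Z) by lia.
  assert (Hwx : walk 2 x = (Z.of_N k + 1)%Z).
  { cbn [walk]. replace (len - 1 - x) with (N.of_nat (i - 1)) by lia. lia. }
  destruct (is_next_ex (walk 2) x (Z.of_N k) ltac:(lia)) as [Y HY].
  destruct (search_ok 2 r4 x k Y) as [S1 S2].
  - lia.
  - exact R30.
  - reflexivity.
  - reflexivity.
  - lia.
  - rewrite Hwx. lia.
  - exact HY.
  - destruct HY as (Y1 & Y2 & Y3).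
    (* Position 0, mirrored to [len - 1], has excess 0 and so is not above the target. *)
    assert (HYl : Y < len).
    { destruct (N.lt_ge_cases Y len) as [|H]; auto. specialize (Y2 (len - 1) ltac:(lia)).
      cbn [walk] in Y2. replace (len - 1 - (len - 1)) with 0 in Y2 by lia.
      change (ex 0) with 0%Z in Y2. lia. }
    specialize (Y3 HYl).
    set (p := N.to_nat (len - 1 - Y)).
    assert (Hp : (p < i - 1)%nat) by lia.
    assert (Ep : ex (len - 1 - Y) = excess P p) by (apply ex_excess; lia).
    cbn [walk] in Y3.
    destruct (last_low_matching P p i Hi) as [O1 O2].
    + lia.
    + lia.
    + intros y Hy. destruct (Nat.eq_dec y (i - 1)) as [->|]; [lia|].
      specialize (Y2 (len - 1 - N.of_nat y) ltac:(lia)). cbn [walk] in Y2.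
      replace (len - 1 - (len - 1 - N.of_nat y)) with (N.of_nat y) in Y2 by lia.
      rewrite (ex_excess (N.of_nat y)), Nat2N.id in Y2 by lia. lia.
    + exists (S p). split; [now apply first_return_matching|].
      rewrite set_reg_eq.
      change (p_search 2) with (p_search (N.of_nat 2)).
      set (r5 := run w m (p_search (N.of_nat 2)) r4) in *.
      assert (R50 : r5 0%nat = a0) by (rewrite S2 by lia; exact R30).
      assert (R54 : r5 4%nat = Y) by (rewrite S1; destruct (N.ltb_spec Y len); lia).
      assert (E5 : ev w m r5 (par h_len - Va 4)%exp = len - Y).
      { eapply cg_val; [| apply ev_sub_lt | |].
        - apply cg_sub; [|now apply cg_len|apply cg_ev; exact R54].
          cbn [ev]. rewrite R54. fold W. lia.
        - lia.
        - fold W. lia. }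
      rewrite E5. lia.
Qed.

(** The extra 1 pays for the step from [i] to [i + 1], where the search starts. *)
Lemma q_next_ok i k : position P i -> (Z.abs (k - excess P i) + 1 <= Z.of_N D)%Z ->
  Z.of_N (run w m q_next (regs (nat_int_args i k)) 0%nat) =
  answer_of_option (next_excess P i k).
Proof.
  intros Hi HkD. destruct (ex_pos i Hi) as (H1 & H0 & H2 & H3). pose proof len_bounds as Hl.
  pose proof len_le_W as HlW. pose proof bias_large as HbL. unfold position in Hi.
  unfold q_next. rewrite run_Ifl.
  change (ev w m (regs (nat_int_args i k)) (Cst 0)) with (trunc w 0).
  change (ev w m (regs (nat_int_args i k)) (Va 3)) with (N.b2n (k <? 0)%Z).
  unfold trunc. rewrite N.mod_small by (fold W; lia).
  destruct (Z.ltb_spec k 0) as [Hneg|Hk0]; cbn [N.b2n N.ltb N.compare].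
  { rewrite next_excess_none by
      (lia || (intros y Hy E; assert (0 <= excess P y)%Z by (apply Hbal; lia); lia)).
    rewrite run_Asg, set_reg_eq. cbn [ev]. unfold trunc. rewrite N.mod_small by (fold W; lia).
    reflexivity. }
  rewrite !run_Sq, !run_Asg.
  assert (Ex : ev w m (regs (nat_int_args i k)) (Va 1 + Cst 1)%exp = N.of_nat i + 1).
  { eapply cg_val; [| apply ev_add_lt | |].
    - apply cg_add; apply cg_ev; [reflexivity|]. apply N.mod_small. fold W. lia.
    - rewrite N2Z.inj_add. reflexivity.
    - fold W. lia. }
  rewrite Ex. set (x := N.of_nat i + 1) in *. set (r1 := set_reg (regs (nat_int_args i k)) 4 x).
  destruct (excess_ok r1 x eq_refl eq_refl ltac:(lia)) as [Vx Kp].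
  set (r2 := run w m (p_excess 0) r1) in *.
  pose proof (ex_range x ltac:(lia)) as Hrx.
  assert (Hst : (Z.abs (ex x - ex (N.of_nat i)) <= 1)%Z).
  { pose proof (ex_steps (N.of_nat i) ltac:(lia)) as H. unfold x.
    now rewrite N.add_1_r. }
  set (kb := Z.to_N (k + Z.of_N bias)).
  assert (Hkb : Z.of_N kb = (k + Z.of_N bias)%Z) by lia.
  assert (R20 : r2 0%nat = a0) by (now rewrite Kp by lia).
  assert (R22 : r2 2%nat = Z.abs_N k) by (now rewrite Kp by lia).
  assert (Ek : ev w m r2 (Va 2 + par h_bias)%exp = kb).
  { eapply cg_val; [| apply ev_add_lt | |].
    - apply cg_add; apply cg_ev; [exact R22|now apply bias_val].
    - lia.
    - fold W. lia. }
  rewrite Ek. set (r3 := set_reg r2 5 kb).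
  assert (R30 : r3 0%nat = a0) by exact R20.
  assert (R34 : r3 4%nat = x) by (change (r2 4%nat = x); now rewrite Kp by lia).
  set (r4 := run w m (Ifl (Va 9) (Va 5) _ _) r3).
  assert (HR : exists Y, N.of_nat i < Y <= len /\
    (forall z, N.of_nat i < z < Y -> ex z <> k) /\ (Y < len -> ex Y = k) /\
    r4 4%nat = (if Y <? len then Y else 0) /\ keep 4 r3 r4).
  { unfold r4. rewrite run_Ifl.
    change (ev w m r3 (Va 9)) with (r2 9%nat). change (ev w m r3 (Va 5)) with kb. rewrite Vx.
    destruct (N.ltb_spec (Z.to_N (ex x + Z.of_N bias)) kb) as [Hup|Hnup].
    - rewrite run_Sq, run_Asg.
      set (k1 := nn + 2 * bias - kb).
      assert (Ek1 : ev w m r3 (par h_n + par h_bias + par h_bias - Va 5)%exp = k1).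
      { assert (R35 : r3 5%nat = kb) by reflexivity.
        assert (En : ev w m r3 (par h_n) = nn).
        { rewrite hd_val by (assumption || (unfold h_n; lia)). apply N.mod_small. fold W. lia. }
        eapply cg_val; [| apply ev_sub_lt | |].
        - apply cg_sub; [|apply cg_add; [apply cg_add|]|]; try apply cg_ev.
          + change (kb < 2 ^ N.of_nat w). fold W. lia.
          + exact En.
          + now apply bias_val.
          + now apply bias_val.
          + exact R35.
        - lia.
        - fold W. lia. }
      rewrite Ek1. set (r' := set_reg r3 5 k1).
      assert (Hk1 : Z.of_N k1 = (Z.of_N (nn + 2 * bias) - Z.of_N kb)%Z) by lia.
      destruct (is_next_ex (walk 1) x (Z.of_N k1) ltac:(lia)) as [Y HY].
      destruct (search_ok 1 r' x k1 Y) as [S1 S2]; try (assumption || lia || reflexivity).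
      { cbn [walk]. lia. }
      change (p_search 1) with (p_search (N.of_nat 1)).
      assert (HYv := next_val 1 x (Z.of_N k1) Y ltac:(lia) ltac:(cbn [walk]; lia) HY).
      destruct HY as (Y1 & Y2 & Y3). cbn [walk] in HYv, Y2, Y3.
      exists Y. split; [lia|]. split; [|split; [|split]].
      + intros z Hz. destruct (N.eq_dec z x) as [->|]; [lia|]. specialize (Y2 z ltac:(lia)). lia.
      + intros H. specialize (HYv H). lia.
      + exact S1.
      + exact (keep_trans 4 r3 _ _ (keep_set 4 r3 5 k1 ltac:(lia)) S2).
    - rewrite run_Ifl.
      change (ev w m r3 (Va 9)) with (r2 9%nat). change (ev w m r3 (Va 5)) with kb. rewrite Vx.
      destruct (N.ltb_spec kb (Z.to_N (ex x + Z.of_N bias))) as [Hdn|Hndn].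
      + destruct (is_next_ex (walk 0) x (Z.of_N kb) ltac:(lia)) as [Y HY].
        destruct (search_ok 0 r3 x kb Y) as [S1 S2]; try (assumption || lia || reflexivity).
        { cbn [walk]. lia. }
        change (p_search 0) with (p_search (N.of_nat 0)).
        assert (HYv := next_val 0 x (Z.of_N kb) Y ltac:(lia) ltac:(cbn [walk]; lia) HY).
        destruct HY as (Y1 & Y2 & Y3). cbn [walk] in HYv, Y2, Y3.
        exists Y. split; [lia|]. split; [|split; [|split]].
        * intros z Hz. destruct (N.eq_dec z x) as [->|]; [lia|]. specialize (Y2 z ltac:(lia)). lia.
        * intros H. specialize (HYv H). lia.
        * exact S1.
        * exact S2.
      (* Neither below nor above: the excess at [i + 1] is already [k]. *)
      + cbn [run]. exists x. split; [lia|]. split; [intros z Hz; lia|]. split; [lia|].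
        split; [|intros z _; reflexivity].
        rewrite R34. destruct (N.ltb_spec x len); [reflexivity|lia]. }
  destruct HR as (Y & Y1 & Y2 & Y3 & Y4 & Y5).
  assert (R40 : r4 0%nat = a0) by (rewrite Y5 by lia; exact R30).
  rewrite run_Ifl.
  assert (E2n : ev w m r4 (par h_2n) = 2 * nn).
  { rewrite hd_val by (assumption || (unfold h_2n; lia)). apply N.mod_small. fold W. lia. }
  rewrite E2n. change (ev w m r4 (Va 4)) with (r4 4%nat). rewrite Y4.
  assert (Ez : ev w m r4 (Cst 0) = 0) by (apply N.mod_small; fold W; lia).
  destruct (N.le_gt_cases Y (2 * nn)) as [HYn|HYn].
  - rewrite (next_excess_some P i k (N.to_nat Y)).
    + destruct (N.ltb_spec Y len); [|lia]. destruct (N.ltb_spec (2 * nn) Y); [lia|].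
      rewrite run_Asg, set_reg_eq. cbn [ev]. rewrite Y4.
      destruct (N.ltb_spec Y len); [|lia]. cbn [answer_of_option]. lia.
    + lia.
    + rewrite <- ex_excess by exact HYn. apply Y3. lia.
    + intros z Hz. specialize (Y2 (N.of_nat z) ltac:(lia)).
      rewrite ex_excess, Nat2N.id in Y2 by lia. exact Y2.
  - rewrite (next_excess_none P i k).
    + destruct (N.ltb_spec Y len) as [Hlt|Hge].
      * destruct (N.ltb_spec (2 * nn) Y); [|lia]. rewrite run_Asg, set_reg_eq, Ez. reflexivity.
      * destruct (N.ltb_spec (2 * nn) 0); [lia|]. rewrite run_Asg, set_reg_eq. cbn [ev].
        rewrite Y4. destruct (N.ltb_spec Y len); [lia|reflexivity].
    + lia.
    + intros z Hz. specialize (Y2 (N.of_nat z) ltac:(lia)).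
      rewrite ex_excess, Nat2N.id in Y2 by lia. exact Y2.
Qed.

End Index.

(** * Asymptotics *)

(** Half of the double logarithm makes [g ^ 2] of order [lg n]; subtracting 1 makes it at most a
    quarter of it, so that tables with [2 ^ (g * g)] rows are far smaller than [n]. *)
Definition lga (n : nat) : nat := N.to_nat (N.log2 (N.log2 (N.of_nat n)) / 2 - 1).

Lemma lga_bounds n A : 1 <= A -> 2 ^ (2 ^ (2 * A + 2)) <= N.of_nat n ->
  let g := par_g (lga n) in
  A <= N.of_nat (lga n) /\ 2 ^ (4 * (g * g)) <= N.of_nat n /\ N.of_nat n < 2 ^ (16 * (g * g)).
Proof.
  intros HA Hn g.
  set (L := N.log2 (N.of_nat n)). set (q := N.log2 L).
  assert (Hn0 : 0 < N.of_nat n) by (pose proof (pow2_pos (2 ^ (2 * A + 2))); lia).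
  destruct (N.log2_spec _ Hn0) as [N1 N2]. fold L in N1, N2.
  assert (HL : 2 ^ (2 * A + 2) <= L).
  { apply N.log2_le_mono in Hn. rewrite N.log2_pow2 in Hn by lia. exact Hn. }
  assert (HL0 : 0 < L) by (pose proof (pow2_pos (2 * A + 2)); lia).
  destruct (N.log2_spec _ HL0) as [L1 L2]. fold q in L1, L2.
  assert (Hq : 2 * A + 2 <= q).
  { apply N.log2_le_mono in HL. rewrite N.log2_pow2 in HL by lia. exact HL. }
  assert (Ea : N.of_nat (lga n) = q / 2 - 1).
  { unfold lga. fold L. fold q. lia. }
  assert (Hd : q = 2 * (q / 2) + q mod 2) by (apply N.div_mod; lia).
  assert (Hm : q mod 2 < 2) by (apply N.mod_lt; lia).
  set (a := N.of_nat (lga n)) in *.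
  assert (Ha : 2 * a + 2 <= q <= 2 * a + 3).
  { revert Ea Hd Hm. generalize (q / 2) (q mod 2). intros; lia. }
  assert (Hg : g * g = 2 ^ (2 * a)).
  { unfold g, par_g. fold a. rewrite <- N.pow_add_r. f_equal. lia. }
  split; [lia|]. rewrite Hg. split.
  - eapply N.le_trans; [|exact N1]. apply N.pow_le_mono_r; [lia|].
    eapply N.le_trans; [|exact L1]. change 4 with (2 ^ 2). rewrite <- N.pow_add_r.
    apply N.pow_le_mono_r; lia.
  - eapply N.lt_le_trans; [exact N2|]. apply N.pow_le_mono_r; [lia|].
    enough (N.succ L <= 2 ^ 4 * 2 ^ (2 * a)) by exact H.
    rewrite <- N.pow_add_r. apply N.le_succ_l. eapply N.lt_le_trans; [exact L2|].
    apply N.pow_le_mono_r; lia.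
Qed.

(** With [g = 2 ^ a] this is [2 * g ^ 9 <= 2 ^ g], read in the exponents; it fails at [a = 5]. *)
Lemma exp_beats_linear a : (6 <= a)%nat -> (9 * a + 1 <= 2 ^ a)%nat.
Proof.
  induction 1 as [|a H IH]; [cbn; lia|]. cbn [Nat.pow]. lia.
Qed.

Lemma bias_small a : (6 <= a)%nat -> 2 * par_bias a <= 2 ^ par_g a.
Proof.
  intros Ha. unfold par_bias, par_g. rewrite <- N.pow_mul_r.
  rewrite <- N.pow_succ_r'. apply N.pow_le_mono_r; [lia|].
  pose proof (exp_beats_linear a Ha) as H.
  replace (2 ^ N.of_nat a) with (N.of_nat (2 ^ a)) by (rewrite Nat2N.inj_pow; reflexivity).
  lia.
Qed.

(** The first summand is for tables indexed by words or bit patterns, the second for arrays with at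
    most [2 * g ^ 5] entries per block. *)
Lemma table_bound n a t : (1 <= a)%nat ->
  let g := par_g a in
  tlen n a t <= 2 ^ (g * g) * (g * g + 1) * 2 ^ g + 2 * par_nb n a * g ^ 5.
Proof.
  intros Ha g. assert (Hg : 2 <= g).
  { unfold g, par_g. apply (N.pow_le_mono_r 2 1); lia. }
  unfold tlen. set (j := (t mod 32)%nat). clearbody j.
  assert (P1 : 1 <= 2 ^ (g * g)) by (pose proof (pow2_pos (g * g)); lia).
  assert (P2 : 1 <= 2 ^ g) by (pose proof (pow2_pos g); lia).
  assert (G5 : 1 <= g ^ 5) by (apply (N.pow_le_mono_l 1 g 5); lia).
  assert (Gs : g + 1 <= g * g + 1) by nia.
  assert (Gl : forall l, (l <= 5)%nat -> g ^ N.of_nat l <= g ^ 5).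
  { intros l Hl. apply N.pow_le_mono_r; lia. }
  assert (Gn : par_nch a <= 2 * g ^ 5).
  { unfold par_nch, par_D. fold g.
    replace (zsize g 6) with (g ^ 3 * g ^ 5) by (cbn [zsize]; lia).
    rewrite N.div_mul by lia.
    replace (g ^ 5) with (g * g * g ^ 3) by lia.
    assert (1 <= g ^ 3) by (apply (N.pow_le_mono_l 1 g 3); lia).
    assert (4 <= g * g) by nia. generalize dependent (g * g). intros s Hs.
    generalize dependent (g ^ 3). intros; nia. }
  set (X := 2 ^ (g * g)) in *. set (Y := 2 ^ g) in *. set (nb := par_nb n a).
  destruct j as [|[|[|[|[|[|[|[|[|j]]]]]]]]];
    [cbn [tab_len]; unfold par_D; fold g; fold X; fold Y; fold nb..|].
  - lia.
  - lia.
  - lia.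
  - assert (X * (g * g) <= X * (g * g + 1) * Y) by (generalize (g * g); intros; nia). lia.
  - generalize (g ^ 5). intros; nia.
  - assert (X * (g + 1) * Y <= X * (g * g + 1) * Y)
      by (apply N.mul_le_mono_r, N.mul_le_mono_l; lia). lia.
  - generalize dependent (g ^ 5). intros; nia.
  - generalize dependent (g ^ 5). intros; nia.
  - lia.
  - rewrite tab_len_hi by lia. fold g. fold nb.
    assert (H : forall l, (l <= 5)%nat -> nb * g ^ N.of_nat l <= 2 * nb * g ^ 5).
    { intros l Hl. specialize (Gl l Hl). nia. }
    destruct (Nat.ltb_spec (S (S (S (S (S (S (S (S (S j))))))))) 16);
      (eapply N.le_trans; [apply H; lia|lia]).
Qed.

Lemma toff_bound (f : nat -> N) M T : (forall t, f t <= M) -> toff f T <= N.of_nat T * M.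
Proof.
  intros H. induction T as [|T IH]; cbn [toff]; [lia|]. specialize (H T). lia.
Qed.

(** The saving [g ^ 3] beats the [O (g ^ 2)] bits of a word by one factor [g]. The constant covers
    96 tables of at most [9 * n / g ^ 3] entries, and the prefix. *)
Lemma total_words_bound n a : (6 <= a)%nat ->
  let g := par_g a in
  2 ^ (4 * (g * g)) <= N.of_nat n ->
  total_words n a * g ^ 3 <= 1000 * N.of_nat n /\ 3 * par_bias a <= N.of_nat n /\ 64 <= g.
Proof.
  intros Ha g Hn. set (nn := N.of_nat n) in *.
  pose proof (bias_small a Ha) as Hb. fold g in Hb. unfold par_bias in *. fold g in Hb |- *.
  assert (Hg : 64 <= g).
  { unfold g, par_g. apply (N.pow_le_mono_r 2 6); lia. }
  assert (Hgg : 64 * g <= g * g) by nia.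
  assert (Hpow : forall e, e <= 4 * (g * g) -> 2 ^ e <= nn).
  { intros e He. eapply N.le_trans; [|exact Hn]. apply N.pow_le_mono_r; lia. }
  assert (H2g : 2 ^ g * 2 ^ g <= nn).
  { rewrite <- N.pow_add_r. apply Hpow. lia. }
  assert (P2 : 2 <= 2 ^ g) by (apply (N.pow_le_mono_r 2 1); lia).
  assert (H3 : 3 * g ^ 9 <= nn).
  { eapply N.le_trans; [|exact H2g]. generalize dependent (2 ^ g). intros; nia. }
  assert (G3 : 64 <= g ^ 3).
  { replace (g ^ 3) with (g * g * g) by lia. nia. }
  split; [|split; assumption].
  assert (H89 : 113 + g ^ 8 <= g ^ 9).
  { replace (g ^ 9) with (g * g ^ 8) by lia.
    assert (64 <= g ^ 8).
    { replace (g ^ 8) with (g * g ^ 7) by lia.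
      assert (1 <= g ^ 7) by (apply (N.pow_le_mono_l 1 g 7); lia). nia. }
    nia. }
  assert (H12 : g ^ 9 * g ^ 3 <= nn).
  { eapply N.le_trans; [|exact H2g]. apply N.mul_le_mono; [lia|].
    eapply N.le_trans; [apply (N.pow_le_mono_r g 3 9); lia|]. lia. }
  assert (Hz : zsize g 6 = g ^ 8) by (cbn [zsize]; lia).
  assert (Hpre : pre_len a * g ^ 3 <= nn).
  { unfold pre_len, hdr_len. fold g. rewrite Hz.
    eapply N.le_trans; [|exact H12]. apply N.mul_le_mono_r. lia. }
  assert (Hlen : par_nb n a * g ^ 8 <= 2 * nn + 1 + g ^ 8).
  { unfold par_nb. fold g. rewrite Hz. fold nn.
    pose proof (N.Div0.mul_div_le (2 * nn + 1) (g ^ 8)). lia. }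
  assert (Hnb : 2 * par_nb n a * g ^ 5 * g ^ 3 <= 8 * nn).
  { replace (2 * par_nb n a * g ^ 5 * g ^ 3) with (2 * (par_nb n a * g ^ 8)) by lia. lia. }
  (* One more factor [2 ^ g] absorbs the polynomial ones, and the exponent [g * g + g + g] is below
     [4 * (g * g)]. *)
  assert (Htab : 2 ^ (g * g) * (g * g + 1) * 2 ^ g * g ^ 3 <= nn).
  { assert (Hx : (g * g + 1) * g ^ 3 <= 2 ^ g).
    { eapply N.le_trans; [|exact Hb].
      replace (g ^ 9) with (g ^ 6 * g ^ 3) by lia.
      assert (g * g <= g ^ 6).
      { replace (g ^ 6) with (g * g * g ^ 4) by lia.
        assert (1 <= g ^ 4) by (apply (N.pow_le_mono_l 1 g 4); lia). nia. }
      nia. }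
    eapply N.le_trans; [|apply (Hpow (g * g + g + g)); nia].
    rewrite !N.pow_add_r. generalize dependent (2 ^ (g * g)). generalize dependent (2 ^ g).
    intros Y; intros.
    replace (n0 * (g * g + 1) * Y * g ^ 3) with (n0 * Y * ((g * g + 1) * g ^ 3)) by ring.
    apply N.mul_le_mono_l. exact Hx. }
  pose proof (toff_bound (tlen n a) _ 96 (fun t => table_bound n a t ltac:(lia))) as Ht.
  fold g in Ht. unfold total_words.
  set (T := 2 ^ (g * g) * (g * g + 1) * 2 ^ g + 2 * par_nb n a * g ^ 5) in *.
  assert (HT : T * g ^ 3 <= 9 * nn).
  { unfold T. rewrite N.mul_add_distr_r. lia. }
  rewrite N.mul_add_distr_r.
  assert (toff (tlen n a) 96 * g ^ 3 <= N.of_nat 96 * T * g ^ 3) by (apply N.mul_le_mono_r, Ht).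
  rewrite <- N.mul_assoc in H. change (N.of_nat 96) with 96 in H. lia.
Qed.

Local Open Scope R_scope.

Lemma lg_bounds (n q : nat) : (1 <= n)%nat -> (N.of_nat n <= 2 ^ N.of_nat q)%N ->
  0 <= lg n <= INR q.
Proof.
  intros Hn Hq. unfold lg, Rlog.
  assert (L2 : 0 < ln 2) by (rewrite <- ln_1; apply ln_increasing; lra).
  assert (Hn1 : 1 <= INR n) by (apply (le_INR 1); exact Hn).
  assert (Hln : 0 <= ln (INR n)).
  { rewrite <- ln_1. destruct (Rle_lt_or_eq_dec _ _ Hn1) as [H|H]; [|rewrite <- H; lra].
    left. apply ln_increasing; lra. }
  assert (Hpow : INR n <= 2 ^ q).
  { replace 2 with (INR 2) by (simpl; lra). rewrite <- pow_INR. apply le_INR.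
    assert (E : N.of_nat (2 ^ q) = (2 ^ N.of_nat q)%N) by (rewrite Nat2N.inj_pow; reflexivity).
    lia. }
  split.
  - apply Rmult_le_pos; [exact Hln|]. left. now apply Rinv_0_lt_compat.
  - apply Rmult_le_reg_r with (ln 2); [exact L2|].
    unfold Rdiv. rewrite Rmult_assoc, Rinv_l, Rmult_1_r by lra.
    rewrite <- ln_pow by lra.
    destruct (Rle_lt_or_eq_dec _ _ Hpow) as [H|H]; [|rewrite H; lra].
    left. apply ln_increasing; lra.
Qed.

Local Close Scope R_scope.

(** * Combining short and long sequences *)

Definition small (w : nat -> nat) (leaf : list bool -> stm) (n : nat) : stm :=
  read_bits (w n) (2 * n) [] leaf.

Definition answerer (w : nat -> nat) (n0 : nat) (leaf : list bool -> stm) (q : stm) : stm :=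
  dispatch (small w leaf) q n0 0.

Definition index_for (w : nat -> nat) (n0 n : nat) (P : list bool) : list bool :=
  if (n <? n0)%nat then pack_words (w n) [N.of_nat n] else index (w n) n (lga n) P.

Definition index_size (w : nat -> nat) (n0 n : nat) : nat :=
  if (n <? n0)%nat then w n else (N.to_nat (total_words n (lga n)) * w n)%nat.

(** [c] is the constant of [w = O (lg n)], expressed through [g]; [g] exceeds its square so that
    [D = g ^ 5] can dominate [w ^ 2]. *)
Record large (w n : nat) (c : N) : Prop := {
  lg_lga : (6 <= lga n)%nat;
  lg_c : c * c + 1 <= par_g (lga n);
  lg_pow : 2 ^ (4 * (par_g (lga n) * par_g (lga n))) <= N.of_nat n;
  lg_w : N.of_nat w <= c * (par_g (lga n) * par_g (lga n));
  lg_n : 2 * N.of_nat n < 2 ^ N.of_nat w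
}.

Section Large.
Variables (w n : nat) (c : N) (P : list bool).
Hypothesis HL : large w n c.
Hypothesis HP : length P = (2 * n)%nat.
Let g := par_g (lga n).

Lemma large_w : 4 * (g * g) < N.of_nat w.
Proof using HL.
  clear HP.
  destruct HL. fold g in lg_pow0.
  assert (H : 2 ^ (4 * (g * g)) < 2 ^ N.of_nat w) by lia.
  apply N.pow_lt_mono_r_iff in H; lia.
Qed.

Lemma large_fit : words w P + total_words n (lga n) < 2 ^ N.of_nat w.
Proof.
  pose proof large_w as Hw. destruct HL. fold g in lg_pow0.
  destruct (total_words_bound n (lga n) lg_lga0 lg_pow0) as (H1 & H2 & H3). fold g in H1, H3.
  (* Eight times the constant 1000, so the index has at most [n / 8] words. *)
  assert (G3 : 8000 <= g ^ 3) by (apply (N.pow_le_mono_l 20 g 3); lia).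
  assert (T : 8 * total_words n (lga n) <= N.of_nat n).
  { revert H1 G3. generalize (total_words n (lga n)) (g ^ 3). intros; nia. }
  assert (Wd : words w P * 4 <= 2 * N.of_nat n + 4).
  { unfold words. rewrite HP.
    pose proof (Nat.Div0.mul_div_le (2 * n + w - 1) w) as Hd.
    assert (16 <= w)%nat by nia.
    revert Hd. generalize ((2 * n + w - 1) / w)%nat. intros d Hd. nia. }
  assert (16 <= N.of_nat n).
  { eapply N.le_trans; [|exact lg_pow0]. apply (N.pow_le_mono_r 2 4); nia. }
  lia.
Qed.

Lemma large_hyps :
  g * g <= N.of_nat w /\ (1 <= lga n)%nat /\ 2 * par_bias (lga n) <= 2 ^ g /\
  words w P + total_words n (lga n) < 2 ^ N.of_nat w /\ 2 * N.of_nat n < 2 ^ N.of_nat w /\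
  N.of_nat n + 3 * par_bias (lga n) < 2 ^ N.of_nat w /\ N.of_nat (length P) = 2 * N.of_nat n.
Proof.
  pose proof large_w as Hw. pose proof large_fit as Hf. destruct HL. fold g in lg_pow0.
  destruct (total_words_bound n (lga n) lg_lga0 lg_pow0) as (H1 & H2 & H3).
  pose proof (bias_small (lga n) lg_lga0).
  repeat split; try lia; assumption.
Qed.

Lemma large_size : N.of_nat (N.to_nat (total_words n (lga n)) * w) * g <= 1000 * c * N.of_nat n.
Proof using HL.
  clear HP.
  destruct HL. fold g in lg_pow0, lg_w0.
  destruct (total_words_bound n (lga n) lg_lga0 lg_pow0) as (H1 & _ & _). fold g in H1.
  rewrite Nat2N.inj_mul, N2Nat.id.
  replace (g ^ 3) with (g * g * g) in H1 by lia.
  revert H1 lg_w0. generalize (total_words n (lga n)) (N.of_nat w). intros T v H1 Hv.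
  apply N.le_trans with (T * (c * (g * g)) * g); [|nia].
  apply N.mul_le_mono_r, N.mul_le_mono_l, Hv.
Qed.

(** From [lg n <= w <= c * g ^ 2], the square plus 1 is at most [(c ^ 2 + 1) * g ^ 4], hence at most
    [g ^ 5]. *)
Lemma large_offset (k e : Z) : (Rabs (IZR k - IZR e) <= lg n ^ 2)%R ->
  (Z.abs (k - e) + 1 <= Z.of_N (par_D (lga n)))%Z.
Proof using HL.
  clear HP.
  intros H. pose proof large_w as Hw. destruct HL. fold g in lg_c0, lg_pow0, lg_w0.
  assert (Hn1 : (1 <= n)%nat).
  { assert (1 <= 2 ^ (4 * (g * g))) by (pose proof (pow2_pos (4 * (g * g))); lia). lia. }
  destruct (lg_bounds n w Hn1 ltac:(lia)) as [B1 B2].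
  assert (H2 : (Z.abs (k - e) <= Z.of_nat (w * w))%Z).
  { apply le_IZR. rewrite abs_IZR, minus_IZR, <- INR_IZR_INZ, mult_INR.
    eapply Rle_trans; [exact H|]. simpl. rewrite Rmult_1_r. apply Rmult_le_compat; assumption. }
  unfold par_D. fold g.
  assert (H3 : N.of_nat (w * w) + 1 <= g ^ 5).
  { rewrite Nat2N.inj_mul. replace (g ^ 5) with (g * (g * g * (g * g))) by lia.
    assert (N.of_nat w * N.of_nat w <= c * (g * g) * (c * (g * g))) by (apply N.mul_le_mono; exact lg_w0).
    assert (1 <= g * g * (g * g)) by (assert (1 <= g) by lia; nia).
    replace (c * (g * g) * (c * (g * g))) with (c * c * (g * g * (g * g))) in * by ring.
    generalize dependent (g * g * (g * g)). generalize dependent (c * c). intros; nia. }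
  lia.
Qed.

End Large.

Lemma large_exists w : big_theta (fun n => INR (w n)) lg ->
  (forall n : nat, (2 * n < 2 ^ w n)%nat) ->
  exists c n1, forall n, (n1 <= n)%nat -> large (w n) n c.
Proof.
  intros (c1 & c2 & Hc1 & Hc2 & n0 & Hth) Hw.
  (* [w <= c2 * lg n], and [lg n] is at most [16 * g ^ 2]. *)
  set (c := Z.to_N (up (16 * c2))).
  assert (Hc : (16 * c2 <= IZR (Z.of_N c))%R).
  { destruct (archimed (16 * c2)) as [A1 _].
    unfold c. rewrite Z2N.id; [lra|]. apply le_IZR. simpl. lra. }
  (* As [A <= lga n < g], this yields both [6 <= lga n] and [c * c + 1 <= g]. *)
  set (A := c * c + 6).
  exists c, (Nat.max n0 (N.to_nat (2 ^ (2 ^ (2 * A + 2))))). intros n Hn.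
  destruct (lga_bounds n A ltac:(lia)) as (B1 & B2 & B3).
  { pose proof (Nat.le_max_r n0 (N.to_nat (2 ^ (2 ^ (2 * A + 2))))). lia. }
  specialize (Hth n). specialize (Hw n).
  set (g := par_g (lga n)) in *.
  assert (Hn1 : (1 <= n)%nat).
  { pose proof (pow2_pos (4 * (g * g))). lia. }
  constructor; fold g.
  - lia.
  - assert (N.of_nat (lga n) < g) by (apply N.pow_gt_lin_r; lia). lia.
  - exact B2.
  - destruct (lg_bounds n (N.to_nat (16 * (g * g))) Hn1) as [L1 L2].
    { rewrite N2Nat.id. lia. }
    destruct Hth as [_ Hup]; [lia|].
    rewrite (Rabs_pos_eq (INR (w n))), (Rabs_pos_eq (lg n)) in Hup by (apply pos_INR || exact L1).
    assert (HR : (INR (w n) <= IZR (Z.of_N (c * (g * g))))%R).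
    { eapply Rle_trans; [exact Hup|].
      eapply Rle_trans; [apply Rmult_le_compat_l; [lra|exact L2]|].
      rewrite N2Z.inj_mul, mult_IZR, INR_IZR_INZ, N_nat_Z, N2Z.inj_mul, mult_IZR.
      change (IZR (Z.of_N 16)) with 16%R.
      rewrite <- Rmult_assoc, (Rmult_comm c2). apply Rmult_le_compat_r; [|exact Hc].
      apply IZR_le. lia. }
    rewrite INR_IZR_INZ in HR. apply le_IZR in HR. lia.
  - assert (E : N.of_nat (2 ^ w n) = 2 ^ N.of_nat (w n)) by (rewrite Nat2N.inj_pow; reflexivity).
    lia.
Qed.

Lemma index_size_little_o w c n0 :
  (forall n, (n0 <= n)%nat -> large (w n) n c) ->
  little_o (fun n => INR (index_size w n0 n)) INR.
Proof.
  intros HL eps Heps.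
  (* The size is at most [1000 * c * n / g], so it suffices that [g] exceed [1000 * c / eps]. *)
  set (K := Z.to_N (up (IZR (Z.of_N (1000 * c)) / eps))).
  assert (HK : (IZR (Z.of_N (1000 * c)) <= eps * IZR (Z.of_N K))%R).
  { destruct (archimed (IZR (Z.of_N (1000 * c)) / eps)) as [A1 _].
    assert (0 <= IZR (Z.of_N (1000 * c)) / eps)%R.
    { apply Rmult_le_pos; [apply IZR_le; lia|]. left. now apply Rinv_0_lt_compat. }
    unfold K. rewrite Z2N.id by (apply le_IZR; lra).
    apply Rmult_gt_compat_l with (r := eps) in A1; [|exact Heps].
    replace (eps * (IZR (Z.of_N (1000 * c)) / eps))%R with (IZR (Z.of_N (1000 * c))) in A1
      by (field; lra). lra. }
  exists (Nat.max n0 (N.to_nat (2 ^ (2 ^ (2 * (K + 1) + 2))))). intros n Hn.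
  pose proof (Nat.le_max_l n0 (N.to_nat (2 ^ (2 ^ (2 * (K + 1) + 2))))).
  pose proof (Nat.le_max_r n0 (N.to_nat (2 ^ (2 ^ (2 * (K + 1) + 2))))).
  destruct (lga_bounds n (K + 1) ltac:(lia) ltac:(lia)) as (B1 & _ & _).
  specialize (HL n ltac:(lia)).
  rewrite !Rabs_pos_eq by apply pos_INR.
  unfold index_size. destruct (Nat.ltb_spec n n0) as [?|_]; [lia|].
  pose proof (large_size (w n) n c HL) as Hs.
  set (g := par_g (lga n)) in *. set (x := (N.to_nat (total_words n (lga n)) * w n)%nat) in *.
  assert (Hg : K < g).
  { assert (N.of_nat (lga n) < g) by (apply N.pow_gt_lin_r; lia). lia. }
  clearbody x g.
  rewrite !INR_IZR_INZ.
  assert (Hs' : (IZR (Z.of_nat x) * IZR (Z.of_N g) <= IZR (Z.of_N (1000 * c)) * IZR (Z.of_nat n))%R).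
  { rewrite <- !mult_IZR. apply IZR_le. lia. }
  assert (Hg' : (IZR (Z.of_N K) + 1 <= IZR (Z.of_N g))%R).
  { rewrite <- plus_IZR. apply IZR_le. lia. }
  assert (K0 : (0 <= IZR (Z.of_N K))%R) by (apply IZR_le; lia).
  assert (N0' : (0 <= IZR (Z.of_nat n))%R) by (apply IZR_le; lia).
  apply Rmult_le_reg_r with (IZR (Z.of_N g)); [lra|].
  eapply Rle_trans; [exact Hs'|].
  apply Rle_trans with (eps * IZR (Z.of_N K) * IZR (Z.of_nat n))%R.
  - now apply Rmult_le_compat_r.
  - replace (eps * IZR (Z.of_nat n) * IZR (Z.of_N g))%R
      with (eps * IZR (Z.of_N g) * IZR (Z.of_nat n))%R by ring.
    apply Rmult_le_compat_r; [exact N0'|]. apply Rmult_le_compat_l; lra.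
Qed.

Lemma answerer_small w n0 n P leaf q args : (0 < w n)%nat -> (n < n0)%nat ->
  (2 * n < 2 ^ w n)%nat -> length P = (2 * n)%nat ->
  let m := layout (w n) P (index_for w n0 n P) in
  let r := fun e => nth e (words (w n) P :: args) 0 in
  run (w n) m (answerer w n0 leaf q) r = run (w n) m (leaf P) r.
Proof.
  intros Hw Hn Hn2 HP m r.
  assert (E : N.of_nat (2 ^ w n) = 2 ^ N.of_nat (w n)) by (rewrite Nat2N.inj_pow; reflexivity).
  unfold answerer. rewrite (run_dispatch _ _ _ _ n); try lia.
  - destruct (Nat.ltb_spec n (n0 + 0)); [|lia]. unfold small, m.
    apply (run_read_bits (w n) P _ leaf r Hw) with (rest := P); [lia|reflexivity|exact HP].
  - unfold m, r, index_for. destruct (Nat.ltb_spec n n0); [|lia]. cbn [nth].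
    rewrite <- (N.add_0_r (words _ _)). change 0 with (N.of_nat 0).
    rewrite layout_index by (cbn; lia). apply N.mod_small. lia.
Qed.

Lemma answerer_large w n0 n c P leaf q args : (n0 <= n)%nat -> large (w n) n c ->
  length P = (2 * n)%nat ->
  let m := layout (w n) P (index_for w n0 n P) in
  let r := fun e => nth e (words (w n) P :: args) 0 in
  m = layout (w n) P (index (w n) n (lga n) P) /\
  run (w n) m (answerer w n0 leaf q) r = run (w n) m q r.
Proof.
  intros Hn HL HP m r.
  assert (Em : m = layout (w n) P (index (w n) n (lga n) P)).
  { unfold m, index_for. destruct (Nat.ltb_spec n n0); [lia|reflexivity]. }
  split; [exact Em|].
  destruct (large_hyps (w n) n c P HL HP) as (h1 & h2 & h3 & h4 & h5 & h6 & h7).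
  pose proof (large_w (w n) n c HL) as Hw.
  unfold answerer. rewrite (run_dispatch _ _ _ _ n); try lia.
  - destruct (Nat.ltb_spec n (n0 + 0)); [lia|reflexivity].
  - change (m (words (w n) P) = N.of_nat n). rewrite Em. now apply m_n.
Qed.

Lemma length_index_for w n0 n c P : (large (w n) n c \/ (n < n0)%nat) ->
  length P = (2 * n)%nat -> length (index_for w n0 n P) = index_size w n0 n.
Proof.
  intros HL HP. unfold index_for, index_size. destruct (Nat.ltb_spec n n0).
  - rewrite length_pack_words. cbn. lia.
  - destruct HL as [HL|]; [|lia].
    destruct (large_hyps (w n) n c P HL HP) as (h1 & h2 & h3 & h4 & h5 & h6 & h7).
    unfold index. rewrite length_pack_words, (length_index_words (w n) n (lga n) P); auto.
Qed.

Local Open Scope nat_scope.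

Theorem theorem5 :
  forall w : nat -> nat,
  big_theta (fun n => INR (w n)) lg ->
  (forall n : nat, 2 * n < 2 ^ w n) ->
  exists (open_prog close_prog excess_prog next_excess_prog : program)
         (t : nat) (r : nat -> nat),
    little_o (fun n => INR (r n)) INR /\
    forall (n : nat) (P : list bool),
    length P = 2 * n ->
    balanced P ->
    exists I : list bool,
      length I <= r n /\
      (forall i : nat, paren_at P i false ->
         exists j : nat, matching P j i /\
           answers (w n) P I open_prog t (nat_args i) (Z.of_nat j)) /\
      (forall i : nat, paren_at P i true ->
         exists j : nat, matching P i j /\
           answers (w n) P I close_prog t (nat_args i) (Z.of_nat j)) /\
      (forall i : nat, position P i ->
         answers (w n) P I excess_prog t (nat_args i) (excess P i)) /\
      (forall (i : nat) (k : Z), position P i ->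
         (Rabs (IZR k - IZR (excess P i)) <= lg n ^ 2)%R ->
         answers (w n) P I next_excess_prog t (nat_int_args i k)
           (answer_of_option (next_excess P i k))).
Proof.
  intros w Hth Hw.
  destruct (large_exists w Hth Hw) as (c & n0 & HL).
  set (unary := fun (f : list bool -> nat -> nat) P => table (unary_rows (f P) (length P))).
  destruct (stm_program (answerer w n0 (unary open_pos) q_open)) as (po & to & Ho).
  destruct (stm_program (answerer w n0 (unary close_pos) q_close)) as (pc & tc & Hc).
  destruct (stm_program (answerer w n0 (unary (fun P i => Z.to_nat (excess P i))) q_excess))
    as (pe & te & He).
  destruct (stm_program (answerer w n0 (fun P => table (next_rows P)) q_next)) as (px & tx & Hx).
  exists po, pc, pe, px, (to + tc + te + tx), (index_size w n0).
  split; [now apply index_size_little_o with c|].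
  intros n P HP Hbal. exists (index_for w n0 n P).
  assert (HW := Hw n).
  assert (E : N.of_nat (2 ^ w n) = (2 ^ N.of_nat (w n))%N) by (rewrite Nat2N.inj_pow; reflexivity).
  assert (HLn : large (w n) n c \/ n < n0).
  { destruct (Nat.lt_ge_cases n n0) as [H|H]; [now right|left; now apply HL]. }
  split; [now rewrite (length_index_for w n0 n c)|].
  assert (Hle : forall i, position P i -> (0 <= excess P i <= Z.of_nat (length P))%Z).
  { intros i Hi. unfold position in Hi. split; [apply Hbal; lia|].
    pose proof (excess_le P i ltac:(lia)). lia. }
  (* [w 0] may be 0, but then the sequence is empty and there is nothing to query. *)
  assert (Hw0 : forall i, position P i -> 0 < w n).
  { intros i Hi. unfold position in Hi. destruct (w n); [cbn in HW|]; lia. }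
  destruct (Nat.lt_ge_cases n n0) as [Hn|Hn].
  - assert (Hunary : forall f q i, position P i -> f P i <= length P ->
        Z.of_N (run (w n) (layout (w n) P (index_for w n0 n P)) (answerer w n0 (unary f) q)
          (fun e => nth e (words (w n) P :: nat_args i) 0%N) 0) = Z.of_nat (f P i)).
    { intros f q i Hi Hf. rewrite answerer_small by (try eapply Hw0; eassumption).
      apply run_unary with (rest := words (w n) P); auto.
      - eapply Hw0; eassumption.
      - lia. }
    repeat split.
    + intros i Hi. exists (open_pos P i).
      assert (Hm := open_pos_ok P i Hbal Hi). split; [exact Hm|].
      apply Ho; [lia|]. apply Hunary.
      * apply Hi.
      * destruct Hm as ((Hm & _) & _). unfold position in Hm. lia.
    + intros i Hi. exists (close_pos P i).
      assert (Hm := close_pos_ok P i Hbal Hi). split; [now apply first_return_matching|].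
      apply Hc; [lia|]. apply Hunary.
      * apply Hi.
      * destruct Hm as (Hm & _). lia.
    + intros i Hi. specialize (Hle i Hi).
      apply He; [lia|]. rewrite Hunary by (assumption || lia). lia.
    + intros i k Hi _. apply Hx; [lia|].
      rewrite answerer_small by (try eapply Hw0; eassumption).
      apply run_next; auto; [eapply Hw0; eassumption|lia].
  - specialize (HL n Hn).
    destruct (large_hyps (w n) n c P HL HP) as (h1 & h2 & h3 & h4 & h5 & h6 & h7).
    repeat split.
    + intros i Hi.
      destruct (q_open_ok (w n) n (lga n) P h1 h2 h3 h4 h5 h6 h7 Hbal i Hi) as (j & Hm & Hj).
      exists j. split; [exact Hm|]. apply Ho; [lia|].
      destruct (answerer_large w n0 n c P (unary open_pos) q_open (nat_args i) Hn HL HP) as [Em ->].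
      rewrite Em. exact Hj.
    + intros i Hi.
      destruct (q_close_ok (w n) n (lga n) P h1 h2 h3 h4 h5 h6 h7 Hbal i Hi) as (j & Hm & Hj).
      exists j. split; [exact Hm|]. apply Hc; [lia|].
      destruct (answerer_large w n0 n c P (unary close_pos) q_close (nat_args i) Hn HL HP) as [Em ->].
      rewrite Em. exact Hj.
    + intros i Hi. apply He; [lia|].
      destruct (answerer_large w n0 n c P (unary (fun P i => Z.to_nat (excess P i))) q_excess
        (nat_args i) Hn HL HP) as [Em ->].
      rewrite Em. exact (q_excess_ok (w n) n (lga n) P h1 h2 h3 h4 h5 h6 h7 Hbal i Hi).
    + intros i k Hi Hk. apply Hx; [lia|].
      destruct (answerer_large w n0 n c P (fun P => table (next_rows P)) q_next
        (nat_int_args i k) Hn HL HP) as [Em ->].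
      rewrite Em. apply (q_next_ok (w n) n (lga n) P h1 h2 h3 h4 h5 h6 h7 Hbal i k Hi).
      now apply (large_offset (w n) n c HL).
Qed.
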